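(* Let $c,h,h_W\in\mathbb{C}$ and suppose $2h_W+\frac{p^2-1}{12}c=0$ for some $p\in\mathbb{N}$. Then there exists a singular vector $u'\in V(c,h,h_W)_{h+p}\cap\mathcal{W}$ such that $\overline{u'}=W_{-p}v$ and $U(\mathcal{L})u'\cong V(c,h+p,h_W)$. The images of the vectors $W_{-m_s}\cdots W_{-m_1}L_{-n_t}\cdots L_{-n_1}v$ such that $m_i\neq p$ for all $i$ form a PBW basis for $L'(c,h,h_W):=V(c,h,h_W)/U(\mathcal{L})u'$. Moreover: (i) Let $h\neq h_W+\frac{(13p+1)(p-1)}{12}+\frac{(1-r)p}{2}$ for all $r\in\mathbb{N}$. Then $U(\mathcal{L})u'=J(c,h,h_W)$ is the maximal submodule in $V(c,h,h_W)$ and $L'(c,h,h_W)=L(c,h,h_W)$ is irreducible. (ii) Suppose $L'(c,h,h_W)$ is reducible. Then there exists a subsingular vector $u\in V(c,h,h_W)$ such that $\overline{u}=L_{-p}^r v$ for some $r\in\mathbb{N}$. The vectors $u$ and $u'$ generate the maximal submodule $J(c,h,h_W)$, and the images of all vectors $W_{-m_s}\cdots W_{-m_1}L_{-n_t}\cdots L_{-n_1}v$ in which neither $W_{-p}$ nor $L_{-p}^k$ for $k\geq r$ occurs as a factor form a PBW basis for the irreducible module $L(c,h,h_W)=V(c,h,h_W)/J(c,h,h_W)$.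
   Context: $\mathbb{N}=\{1,2,\dots\}$. $\mathcal{L}=W(2,2)$ is the complex Lie algebra with basis $\{W_n,L_n,C:n\in\mathbb{Z}\}$ and brackets $[L_n,L_m]=(n-m)L_{n+m}+\delta_{n,-m}\frac{n^3-n}{12}C$, $[L_n,W_m]=(n-m)W_{n+m}+\delta_{n,-m}\frac{n^3-n}{12}C$, $[W_n,W_m]=0$, $[\mathcal{L},C]=0$. Put $\mathcal{L}_{\pm}=\bigoplus_{n>0}(\mathbb{C}L_{\pm n}+\mathbb{C}W_{\pm n})$. $U(\cdot)$ denotes the universal enveloping algebra. The Verma module $V(c,h,h_W)$ is the quotient of $U(\mathcal{L})$ by the left ideal generated by $L_n,W_n$ ($n\in\mathbb{N}$), $C-c$, $L_0-h$, $W_0-h_W$; $v$ is the image of $1$. It has the PBW basis $W_{-m_s}\cdots W_{-m_1}L_{-n_t}\cdots L_{-n_1}v$ with $m_s\ge\cdots\ge m_1\ge1$, $n_t\ge\cdots\ge n_1\ge1$ ($s,t\ge0$). $V(c,h,h_W)_{h+k}$ is the $L_0$-eigenspace of eigenvalue $h+k$. $J(c,h,h_W)$ is the unique maximal (proper) submodule, and $L(c,h,h_W)=V(c,h,h_W)/J(c,h,h_W)$. The $W$-degree of the PBW vector $W_{-m_s}\cdots W_{-m_1}L_{-n_t}\cdots L_{-n_1}v$ is $s$. For nonzero $x\in V(c,h,h_W)$, written in the PBW basis, $\overline{x}$ is its lowest nonzero homogeneous component with respect to $W$-degree. $\mathcal{W}$ is the span of the vectors $W_{-m_s}\cdots W_{-m_1}v$.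 A singular vector in a module is a nonzero $L_0$-eigenvector annihilated by $\mathcal{L}_+$. A subsingular vector is an $L_0$-eigenvector $u\in V(c,h,h_W)$ whose image in $L'(c,h,h_W)$ is a singular vector (the case that $u$ is itself singular in $V(c,h,h_W)$ is allowed).
   Formalization: The formal theorem assumes c ≠ 0; for c = 0 (hence h_W = 0) the claim fails: if p ≥ 2, L_1u' has the nonzero term (p+1)W_{-(p-1)}v, and if p = 1, W_{-2}v is singular and nonzero in L', contradicting (i) and the basis in (ii). *)

(* Defs.v *)
From HB Require Import structures.
From mathcomp Require Import all_boot all_order all_algebra.
From mathcomp Require Import finmap generic_quotient ring_quotient.
From mathcomp Require Import boolp.
From mathcomp Require Import monalg.
From mathcomp Require Import ring zify.

Set Implicit Arguments.
Unset Strict Implicit.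
Unset Printing Implicit Defensive.

Import GRing.Theory.
Local Open Scope ring_scope.
Local Open Scope quotient_scope.

(** Several operations below are [locked] only to keep unification from
    unfolding quotients and finitely supported functions. *)

Record submodule (A : pzRingType) (V : lmodType A) := Submodule {
  submod_pred :> {pred V};
  submodP : submod_closed submod_pred
}.

Section Submodules.
Variables (A : pzRingType) (V : lmodType A).
Implicit Types (N M : submodule V) (S : V -> Prop).

Fact submod_subsemimod_closed N : GRing.subsemimod_closed (submod_pred N).
Proof.
case: (submodP N) => N0 NL; split.
  by split=> // x y Nx Ny; rewrite -[x]scale1r NL.
by move=> a x Nx; rewrite -[_ *: _]addr0 NL.
Qed.

HB.instance Definition _ N :=
  GRing.isSubmodClosed.Build A V (submod_pred N) (submod_subsemimod_closed N).

Lemma submod_eqP N M : N =i M -> N = M.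
Proof.
case: N M => [P PP] [Q QQ] /= eqPQ.
have ePQ : P = Q by apply: funext => x; exact: eqPQ.
by subst Q; congr Submodule; exact: Prop_irrelevance.
Qed.

Definition submod_gen_pred S : {pred V} :=
  fun x => `[< forall N, (forall y, S y -> y \in N) -> x \in N >].

Fact submod_gen_closed S : submod_closed (submod_gen_pred S).
Proof.
split; first by apply/asboolP => N _; exact: rpred0.
move=> a x y /asboolP Sx /asboolP Sy; apply/asboolP => N SN.
by rewrite rpredD ?rpredZ ?Sx ?Sy.
Qed.

Definition submod_gen S : submodule V := Submodule (submod_gen_closed S).

Definition cyclic_pred (x : V) : {pred V} := fun y => `[< exists a : A, y = a *: x >].

Fact cyclic_closed x : submod_closed (cyclic_pred x).
Proof.
split; first by apply/asboolP; exists 0; rewrite scale0r.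
move=> a _ _ /asboolP[b ->] /asboolP[d ->]; apply/asboolP.
by exists (a * b + d); rewrite scalerDl scalerA.
Qed.

Definition cyclic x : submodule V := Submodule (cyclic_closed x).

Definition proper_submod N : Prop := exists x, x \notin N.

Definition maximal_submod N : Prop :=
  proper_submod N /\ forall M, proper_submod M -> {subset N <= M} -> M = N.

(** The sum of all proper submodules: if it is proper, then it is the unique
    maximal submodule, see [max_submodP]. *)
Definition max_submod : submodule V :=
  submod_gen (fun x => exists2 N, proper_submod N & x \in N).

Lemma max_submodP : proper_submod max_submod ->
  forall N, maximal_submod N <-> N = max_submod.
Proof.
have sub N : proper_submod N -> {subset N <= max_submod}.
  by move=> Np x Nx; apply/asboolP => M; apply; exists N.
move=> Jp N; split=> [[Np Nm]|->]; first by rewrite -(Nm _ Jp (sub _ Np)).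
split=> // M Mp JM; apply: submod_eqP => x; apply/idP/idP; first exact: sub.
exact: JM.
Qed.

Definition irreducible_mod : Prop :=
  (exists x : V, x != 0) /\
  forall N, (forall x, x \in N -> x = 0) \/ (forall x, x \in N).

Record submod_type N := SubmodElt { submod_val : V; _ : submod_val \in N }.

HB.instance Definition _ N := [isSub for @submod_val N].
HB.instance Definition _ N := [Choice of submod_type N by <:].
HB.instance Definition _ N := [SubChoice_isSubLmodule of submod_type N by <:].

Definition quot_mod N : Type := Quotient.quot (submod_pred N).

HB.instance Definition _ N := GRing.Zmodule.on (quot_mod N).

Definition qproj N : V -> quot_mod N := \pi_(Quotient.quot (submod_pred N)).

Lemma qproj_eq0 N x : (qproj N x == 0) = (x \in N).
Proof. by rewrite /qproj -[0](@pi_zeror _ _ _ _ _ _) -Quotient.idealrBE subr0. Qed.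

Lemma qproj_surj N (y : quot_mod N) : exists x, y = qproj N x.
Proof. by exists (repr y); rewrite /qproj reprK. Qed.

Fact qproj_zmod_morphism N : zmod_morphism (qproj N).
Proof. by move=> x y; rewrite /qproj raddfB. Qed.

HB.instance Definition _ N :=
  GRing.isZmodMorphism.Build V (quot_mod N) (qproj N) (qproj_zmod_morphism N).

Definition qscale N : A -> quot_mod N -> quot_mod N :=
  locked (fun a y => qproj N (a *: repr y)).

Lemma qscaleE N a x : qscale a (qproj N x) = qproj N (a *: x).
Proof.
rewrite /qscale -lock; apply/eqP; rewrite -subr_eq0 -raddfB -scalerBr /= qproj_eq0 rpredZ //.
by rewrite -qproj_eq0 raddfB /= subr_eq0 /qproj reprK.
Qed.

Fact qscaleA N a b (y : quot_mod N) : qscale a (qscale b y) = qscale (a * b) y.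
Proof. by have [x ->] := qproj_surj y; rewrite !qscaleE scalerA. Qed.
Fact qscale1 N : left_id 1 (@qscale N).
Proof. by move=> y; have [x ->] := qproj_surj y; rewrite qscaleE scale1r. Qed.
Fact qscaleDr N : right_distributive (@qscale N) +%R.
Proof.
move=> a y z; have [[x ->] [t ->]] := (qproj_surj y, qproj_surj z).
by rewrite -raddfD !qscaleE -raddfD scalerDr.
Qed.
Fact qscaleDl N (y : quot_mod N) : {morph (@qscale N)^~ y : a b / a + b}.
Proof.
by move=> a b; have [x ->] := qproj_surj y; rewrite !qscaleE -raddfD scalerDl.
Qed.

HB.instance Definition _ N := GRing.Zmodule_isLmodule.Build A (quot_mod N)
  (@qscaleA N) (@qscale1 N) (@qscaleDr N) (@qscaleDl N).

Fact qproj_scalable N : scalable (qproj N).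
Proof. by move=> a x; rewrite -qscaleE. Qed.

HB.instance Definition _ N :=
  GRing.isScalable.Build A V (quot_mod N) *:%R (qproj N) (@qproj_scalable N).

End Submodules.

Definition isomorphic_mod (A : pzRingType) (V V' : lmodType A) : Prop :=
  exists f : {linear V -> V'}, bijective f.

Record ideal (A : pzRingType) := Ideal {
  ideal_pred :> {pred A};
  ideal_zmod : zmod_closed ideal_pred;
  ideal_mull : forall a x, x \in ideal_pred -> a * x \in ideal_pred;
  ideal_mulr : forall a x, x \in ideal_pred -> x * a \in ideal_pred
}.

HB.instance Definition _ (A : pzRingType) (I : ideal A) :=
  GRing.isZmodClosed.Build A (ideal_pred I) (ideal_zmod I).

Section IdealGen.
Variables (A : pzRingType) (S : A -> Prop).

Definition ideal_gen_pred : {pred A} :=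
  fun x => `[< forall I : ideal A, (forall y, S y -> y \in I) -> x \in I >].

Fact ideal_gen_zmod : zmod_closed ideal_gen_pred.
Proof.
split; first by apply/asboolP => I _; exact: rpred0.
move=> x y /asboolP Sx /asboolP Sy; apply/asboolP => I SI.
by rewrite rpredB ?Sx ?Sy.
Qed.

Fact ideal_gen_mull a x : x \in ideal_gen_pred -> a * x \in ideal_gen_pred.
Proof. by move=> /asboolP Sx; apply/asboolP => I /Sx; exact: ideal_mull. Qed.

Fact ideal_gen_mulr a x : x \in ideal_gen_pred -> x * a \in ideal_gen_pred.
Proof. by move=> /asboolP Sx; apply/asboolP => I /Sx; exact: ideal_mulr. Qed.

Definition ideal_gen : ideal A := Ideal ideal_gen_zmod ideal_gen_mull ideal_gen_mulr.

End IdealGen.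

Section QuotRing.
Variables (A : pzRingType) (I : ideal A).

Definition quot_ring : Type := Quotient.quot (ideal_pred I).

HB.instance Definition _ := GRing.Zmodule.on quot_ring.

Definition rproj : A -> quot_ring := \pi_(Quotient.quot (ideal_pred I)).

Lemma rproj_eq0 x : (rproj x == 0) = (x \in I).
Proof. by rewrite /rproj -[0](@pi_zeror _ _ _ _ _ _) -Quotient.idealrBE subr0. Qed.

Lemma rproj_surj y : exists x, y = rproj x.
Proof. by exists (repr y); rewrite /rproj reprK. Qed.

Fact rproj_zmod_morphism : zmod_morphism rproj.
Proof. by move=> x y; rewrite /rproj raddfB. Qed.

HB.instance Definition _ :=
  GRing.isZmodMorphism.Build A quot_ring rproj rproj_zmod_morphism.

Definition qmul : quot_ring -> quot_ring -> quot_ring :=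
  locked (fun y z => rproj (repr y * repr z)).

Lemma qmulE x t : qmul (rproj x) (rproj t) = rproj (x * t).
Proof.
have repI u : repr (rproj u) - u \in I.
  by rewrite -rproj_eq0 raddfB /= subr_eq0 /rproj reprK.
rewrite /qmul -lock; apply/eqP; rewrite -subr_eq0 -raddfB /= rproj_eq0.
rewrite -(subrKA (x * repr (rproj t))) -mulrBl -mulrBr.
by apply: rpredD; [exact: ideal_mulr|exact: ideal_mull].
Qed.

Fact qmulA : associative qmul.
Proof.
move=> x y z; have [[x' ->] [y' ->] [z' ->]] := And3 (rproj_surj x) (rproj_surj y) (rproj_surj z).
by rewrite !qmulE mulrA.
Qed.
Fact qmul1 : left_id (rproj 1) qmul.
Proof. by move=> y; have [x ->] := rproj_surj y; rewrite qmulE mul1r. Qed.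
Fact qmulr1 : right_id (rproj 1) qmul.
Proof. by move=> y; have [x ->] := rproj_surj y; rewrite qmulE mulr1. Qed.
Fact qmulDl : left_distributive qmul +%R.
Proof.
move=> x y z; have [[x' ->] [y' ->] [z' ->]] := And3 (rproj_surj x) (rproj_surj y) (rproj_surj z).
by rewrite -raddfD !qmulE -raddfD mulrDl.
Qed.
Fact qmulDr : right_distributive qmul +%R.
Proof.
move=> x y z; have [[x' ->] [y' ->] [z' ->]] := And3 (rproj_surj x) (rproj_surj y) (rproj_surj z).
by rewrite -raddfD !qmulE -raddfD mulrDr.
Qed.

HB.instance Definition _ := GRing.Zmodule_isPzRing.Build quot_ring
  qmulA qmul1 qmulr1 qmulDl qmulDr.

Fact rproj_monoid_morphism : monoid_morphism rproj.
Proof. by split=> // x y; rewrite -qmulE. Qed.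

HB.instance Definition _ :=
  GRing.isMonoidMorphism.Build A quot_ring rproj rproj_monoid_morphism.

End QuotRing.

HB.mixin Record Lmodule_isLieAlgebra (K : fieldType) (g : Type)
    of GRing.Lmodule K g := {
  lie : g -> g -> g;
  lieDl : forall a x y z, lie (a *: x + y) z = a *: lie x z + lie y z;
  lieDr : forall a x y z, lie x (a *: y + z) = a *: lie x y + lie x z;
  liexx : forall x, lie x x = 0;
  lie_jacobi : forall x y z, lie x (lie y z) + lie y (lie z x) + lie z (lie x y) = 0
}.

#[short(type="lieAlgType")]
HB.structure Definition LieAlgebra (K : fieldType) :=
  {g of Lmodule_isLieAlgebra K g & GRing.Lmodule K g}.

Section Enveloping.
Variables (K : fieldType) (g : lieAlgType K).

(** The free associative algebra on the set [g]. *)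
Local Notation free_alg := {malg K[{fmonom g}]}.

Definition fgen (x : g) : free_alg := << fmu x >>.

(** The first kind of relators cuts the free algebra down to the tensor
    algebra of the vector space [g]. *)
Variant env_relator : free_alg -> Prop :=
| EnvLinear a x y : env_relator (fgen (a *: x + y) - (a *: fgen x + fgen y))
| EnvBracket x y : env_relator (fgen x * fgen y - fgen y * fgen x - fgen (lie x y)).

Definition env : Type := quot_ring (ideal_gen env_relator).
HB.instance Definition _ := GRing.PzRing.on env.

Definition env_proj : free_alg -> env := rproj (ideal_gen env_relator).
HB.instance Definition _ := GRing.RMorphism.on env_proj.

Definition env_in : g -> env := locked (fun x => env_proj (fgen x)).

Lemma env_inE x : env_in x = env_proj (fgen x).
Proof. by rewrite /env_in -lock. Qed.

Definition augm_mon (m : {fmonom g}) : K := (m == mone)%:R.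

Fact augm_mmorphism : mmorphism augm_mon.
Proof.
split; last by rewrite /augm_mon eqxx.
by move=> m n; rewrite /augm_mon fmM_eq1; case: (m == _); rewrite ?(mul1r, mul0r).
Qed.
HB.instance Definition _ := isMultiplicative.Build _ _ augm_mon augm_mmorphism.

Definition augm : {rmorphism free_alg -> K} := mmap idfun augm_mon.

Definition augm_pred : {pred free_alg} := fun x => augm x == 0.

Fact augm_zmod : zmod_closed augm_pred.
Proof.
split; first by rewrite unfold_in /augm_pred rmorph0.
by move=> x y /eqP x0 /eqP y0; rewrite unfold_in /augm_pred rmorphB x0 y0 subr0.
Qed.
Fact augm_mull a x : x \in augm_pred -> a * x \in augm_pred.
Proof. by move=> /eqP x0; rewrite unfold_in /augm_pred rmorphM x0 mulr0. Qed.
Fact augm_mulr a x : x \in augm_pred -> x * a \in augm_pred.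
Proof. by move=> /eqP x0; rewrite unfold_in /augm_pred rmorphM x0 mul0r. Qed.

Lemma augm_fgen x : augm (fgen x) = 0.
Proof. by rewrite [LHS]mmapU /= /augm_mon fm1_eq1 mulr0. Qed.

Lemma augmZ a x : augm (a *: x) = a * augm x.
Proof. by rewrite [LHS]mmapZ. Qed.

Fact env_oner_neq0 : (1 : env) != 0.
Proof.
rewrite -(rmorph1 env_proj) rproj_eq0; apply/asboolPn => H.
have /eqP/eqP : 1 \in augm_pred.
  apply: (H (Ideal augm_zmod augm_mull augm_mulr)) => z; rewrite unfold_in /= /augm_pred.
  case=> [a x y|x y]; apply/eqP; rewrite (rmorphB augm).
    by rewrite (rmorphD augm) augmZ !augm_fgen mulr0 addr0 subr0.
  rewrite (rmorphB augm) augm_fgen subr0.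
  have comm0 (p q : K) : p = 0 -> q = 0 -> p * q - q * p = 0.
    by move=> -> ->; rewrite mulr0 subr0.
  rewrite -[RHS](comm0 _ _ (augm_fgen x) (augm_fgen y)).
  by congr (_ - _); exact: rmorphM.
by rewrite rmorph1 (negPf (oner_neq0 _)).
Qed.
HB.instance Definition _ := GRing.PzSemiRing_isNonZero.Build env env_oner_neq0.

Definition env_scale : K -> env -> env := locked (fun a x => env_proj a%:MP * x).

Lemma env_scaleE a x : env_scale a x = env_proj a%:MP * x.
Proof. by rewrite /env_scale -lock. Qed.

Fact env_scaleA a b x : env_scale a (env_scale b x) = env_scale (a * b) x.
Proof.
rewrite !env_scaleE (rmorphM (malgC : K -> free_alg)).
by rewrite mulrA; congr (_ * _); symmetry; exact: rmorphM.
Qed.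
Fact env_scale1 : left_id 1 env_scale.
Proof. by move=> x; rewrite env_scaleE !rmorph1 mul1r. Qed.
Fact env_scaleDr : right_distributive env_scale +%R.
Proof. by move=> a x y; rewrite !env_scaleE mulrDr. Qed.
Fact env_scaleDl x : {morph env_scale^~ x : a b / a + b}.
Proof. by move=> a b; rewrite !env_scaleE !rmorphD mulrDl. Qed.
HB.instance Definition _ := GRing.Zmodule_isLmodule.Build K env
  env_scaleA env_scale1 env_scaleDr env_scaleDl.

Fact env_scaleAl a (x y : env) : a *: (x * y) = (a *: x) * y.
Proof. by rewrite -[LHS]/(env_scale _ _) -[a *: x]/(env_scale _ _) !env_scaleE mulrA. Qed.
HB.instance Definition _ := GRing.Lmodule_isLalgebra.Build K env env_scaleAl.

Lemma malgC_comm (a : K) (x : free_alg) : a%:MP * x = x * a%:MP.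
Proof.
rewrite !malgM_def fgmulUg fgmulgU; apply: eq_bigr => k _.
by rewrite mul1m mulm1 mulrC.
Qed.

Lemma env_proj_comm (a : K) (x : env) : env_proj a%:MP * x = x * env_proj a%:MP.
Proof.
have [x' ->] : exists x', x = env_proj x' by exact: rproj_surj.
rewrite -(rmorphM env_proj a%:MP x') -(rmorphM env_proj x' a%:MP).
by rewrite malgC_comm.
Qed.

Fact env_scaleAr a (x y : env) : a *: (x * y) = x * (a *: y).
Proof.
rewrite -[LHS]/(env_scale _ _) -[a *: y]/(env_scale _ _) !env_scaleE.
by rewrite !mulrA env_proj_comm.
Qed.
HB.instance Definition _ := GRing.Lalgebra_isAlgebra.Build K env env_scaleAr.

Lemma env_projZ a x : env_proj (a *: x) = a *: env_proj x.
Proof. by rewrite -mul_malgC rmorphM -env_scaleE. Qed.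

Fact env_in_linear : linear env_in.
Proof.
move=> a x y; apply/eqP; rewrite !env_inE -env_projZ -rmorphD -subr_eq0 -rmorphB.
by rewrite rproj_eq0; apply/asboolP => I; apply; exact: EnvLinear.
Qed.
HB.instance Definition _ := GRing.isLinear.Build K g env *:%R env_in env_in_linear.

Lemma env_in_lie x y : env_in x * env_in y - env_in y * env_in x = env_in (lie x y).
Proof.
apply/eqP; rewrite !env_inE -!rmorphM -rmorphB -subr_eq0 -rmorphB rproj_eq0.
by apply/asboolP => I; apply; exact: EnvBracket.
Qed.

End Enveloping.

Inductive w22_idx := IL of int | IW of int | IC.

Definition w22_idx_enc (i : w22_idx) : int + int + unit :=
  match i with IL n => inl (inl n) | IW n => inl (inr n) | IC => inr tt end.
Definition w22_idx_dec (i : int + int + unit) : w22_idx :=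
  match i with inl (inl n) => IL n | inl (inr n) => IW n | inr tt => IC end.
Lemma w22_idx_encK : cancel w22_idx_enc w22_idx_dec.
Proof. by case. Qed.
HB.instance Definition _ := Countable.copy w22_idx (can_type w22_idx_encK).

Section W22.
Variable K : fieldType.

Definition w22 := {malg K[w22_idx]}.
HB.instance Definition _ := GRing.Lmodule.on w22.

Definition w22_bas : w22_idx -> w22 := locked (fun i => << i >>).

Lemma w22_basE i : w22_bas i = << i >>.
Proof. by rewrite /w22_bas -lock. Qed.

Definition bL (n : int) : w22 := w22_bas (IL n).
Definition bW (n : int) : w22 := w22_bas (IW n).
Definition bC : w22 := w22_bas IC.

Definition cocycle (n m : int) : K :=
  if n == - m then (n ^+ 3 - n)%:~R / 12%:R else 0.

Definition w22_brk (i j : w22_idx) : w22 :=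
  match i, j with
  | IL n, IL m => (n - m)%:~R *: bL (n + m) + cocycle n m *: bC
  | IL n, IW m => (n - m)%:~R *: bW (n + m) + cocycle n m *: bC
  | IW n, IL m => - ((m - n)%:~R *: bW (m + n) + cocycle m n *: bC)
  | _, _ => 0
  end.

Definition w22_ext (V : lmodType K) (f : w22_idx -> V) (x : w22) : V :=
  \sum_(i <- msupp x) x@_i *: f i.

Definition w22_lie : w22 -> w22 -> w22 :=
  locked (fun x y => w22_ext (fun i => w22_ext (w22_brk i) y) x).

Lemma w22_lieE x y : w22_lie x y = w22_ext (fun i => w22_ext (w22_brk i) y) x.
Proof. by rewrite /w22_lie -lock. Qed.

Lemma w22_extE (V : lmodType K) (f : w22_idx -> V) (d : {fset w22_idx}) (x : w22) :
  fsubset (msupp x) d -> w22_ext f x = \sum_(i <- d) x@_i *: f i.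
Proof.
move=> sxd; apply: big_fset_incl => // i _ /mcoeff_outdom ->.
by rewrite scale0r.
Qed.

Lemma w22_ext_linear (V : lmodType K) (f : w22_idx -> V) : linear (w22_ext f).
Proof.
move=> a x y.
pose d := fsetU (msupp (a *: x + y)) (fsetU (msupp x) (msupp y)).
have [s1 s2 s3] : [/\ fsubset (msupp (a *: x + y)) d, fsubset (msupp x) d
                    & fsubset (msupp y) d].
  split; rewrite /d ?fsubsetUl // fsubsetU // ?fsubsetUl ?fsubsetUr ?orbT //.
rewrite (w22_extE f s1) (w22_extE f s2) (w22_extE f s3) scaler_sumr -big_split /=.
by apply: eq_bigr => i _; rewrite mcoeffD mcoeffZ scalerDl scalerA.
Qed.

Lemma w22_ext_basis (V : lmodType K) (f : w22_idx -> V) i : w22_ext f (w22_bas i) = f i.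
Proof. by rewrite w22_basE (w22_extE f (msuppU_le)) big_seq_fset1 mcoeffUU scale1r. Qed.

Lemma w22_basis (x : w22) : x = w22_ext w22_bas x.
Proof.
rewrite {1}[x]monalgE; apply: eq_bigr => i _; apply/malgP => k.
by rewrite w22_basE mcoeffZ !mcoeffU mulrnAr mulr1.
Qed.

Lemma w22_ind (P : w22 -> Prop) : P 0 ->
  (forall a i y, P y -> P (a *: w22_bas i + y)) -> forall x, P x.
Proof.
move=> P0 PD x; rewrite [x]w22_basis /w22_ext.
elim: (enum_fset _) => [|i s IH]; first by rewrite big_nil.
by rewrite big_cons; exact: PD.
Qed.

Lemma w22_lieDl (a : K) (x y z : w22) : w22_lie (a *: x + y) z = a *: w22_lie x z + w22_lie y z.
Proof. by rewrite !w22_lieE w22_ext_linear. Qed.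

Lemma w22_lieDr (a : K) (x y z : w22) : w22_lie x (a *: y + z) = a *: w22_lie x y + w22_lie x z.
Proof.
rewrite !w22_lieE /(w22_ext _ x) scaler_sumr -big_split /=; apply: eq_bigr => i _.
by rewrite -/(w22_ext (w22_brk i) _) w22_ext_linear scalerDr !scalerA mulrC.
Qed.

Lemma w22_lie0x x : w22_lie 0 x = 0.
Proof. by have := w22_lieDl (-1) 0 0 x; rewrite scaler0 addr0 scaleN1r addNr. Qed.

Lemma w22_liex0 x : w22_lie x 0 = 0.
Proof. by have := w22_lieDr (-1) x 0 0; rewrite scaler0 addr0 scaleN1r addNr. Qed.

Lemma w22_lie_basis i j : w22_lie (w22_bas i) (w22_bas j) = w22_brk i j.
Proof. by rewrite w22_lieE !w22_ext_basis. Qed.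

Lemma cocycleN n m : cocycle m n = - cocycle n m.
Proof.
rewrite /cocycle; have -> : (m == - n) = (n == - m) by apply/eqP/eqP; lia.
case: eqP => [->|_]; last by rewrite oppr0.
by rewrite -mulNr -rmorphN; congr (_%:~R / _); ring.
Qed.

Lemma w22_brkN i j : w22_brk j i = - w22_brk i j.
Proof.
case: i => [n|n|]; case: j => [m|m|] /=; rewrite ?(oppr0, opprK) //.
rewrite (addrC m n) cocycleN opprD -!scaleNr -(rmorphN intr).
by have -> : m - n = - (n - m) by ring.
Qed.

Lemma w22_brkxx i : w22_brk i i = 0.
Proof.
case: i => [n|n|] //=; rewrite subrr scale0r add0r /cocycle.
by case: eqP => [H|_]; rewrite ?scale0r //; have -> : n = 0 by [lia];
  rewrite expr0n subrr mul0r scale0r.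
Qed.

Lemma w22_lieN x y : w22_lie y x = - w22_lie x y.
Proof.
elim/w22_ind: x => [|a i x IHx]; first by rewrite w22_liex0 w22_lie0x oppr0.
rewrite w22_lieDl w22_lieDr IHx opprD; suff -> : w22_lie y (w22_bas i) = - w22_lie (w22_bas i) y.
  by rewrite scalerN.
elim/w22_ind: y {IHx} => [|b j y IHy]; first by rewrite w22_liex0 w22_lie0x oppr0.
by rewrite w22_lieDl w22_lieDr IHy opprD !w22_lie_basis (w22_brkN i j) scalerN.
Qed.

Lemma w22_liexx x : w22_lie x x = 0.
Proof.
elim/w22_ind: x => [|a i x IHx]; first exact: w22_liex0.
rewrite w22_lieDl !w22_lieDr IHx addr0 (w22_lieN (w22_bas i) x) w22_lie_basis w22_brkxx.
by rewrite scaler0 add0r scalerN subrr.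
Qed.

Definition w22_jac x y z : w22 :=
  w22_lie x (w22_lie y z) + w22_lie y (w22_lie z x) + w22_lie z (w22_lie x y).

Lemma w22_jac_rot x y z : w22_jac y z x = w22_jac x y z.
Proof. by rewrite /w22_jac [LHS]addrC addrA. Qed.

Lemma addr_perm6 (p p' q q' r r' : w22) :
  p + p' + (q + q') + (r + r') = p + q + r + (p' + q' + r').
Proof. by rewrite (addrACA p) (addrACA (p + q)). Qed.

Lemma w22_jacD a x1 x2 y z : w22_jac (a *: x1 + x2) y z = a *: w22_jac x1 y z + w22_jac x2 y z.
Proof.
rewrite /w22_jac !(w22_lieDl, w22_lieDr) !scalerDr.
exact: addr_perm6.
Qed.

Lemma w22_jac0 y z : w22_jac 0 y z = 0.
Proof. by rewrite /w22_jac !(w22_lie0x, w22_liex0) !addr0. Qed.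

Lemma w22_lieZr a x y : w22_lie x (a *: y) = a *: w22_lie x y.
Proof. by have := w22_lieDr a x y 0; rewrite w22_liex0 !addr0. Qed.

Lemma w22_lieNr x y : w22_lie x (- y) = - w22_lie x y.
Proof. by rewrite -scaleN1r w22_lieZr scaleN1r. Qed.

Lemma w22_lie_C x : w22_lie x bC = 0.
Proof.
elim/w22_ind: x => [|a i x IHx]; first exact: w22_lie0x.
by rewrite w22_lieDl IHx addr0 w22_lie_basis; case: i => *; exact: scaler0.
Qed.

Lemma w22_lie_brk i n a b (B : int -> w22) :
  w22_lie (w22_bas i) (a *: B n + b *: bC) = a *: w22_lie (w22_bas i) (B n).
Proof. by rewrite w22_lieDr w22_lieZr w22_lie_C scaler0 addr0. Qed.

Lemma lieWbrk n a b m : w22_lie (w22_bas (IW n)) (a *: bW m + b *: bC) = 0.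
Proof. by rewrite w22_lie_brk w22_lie_basis scaler0. Qed.

Lemma lieCbrk a b m : w22_lie (w22_bas IC) (a *: bW m + b *: bC) = 0.
Proof. by rewrite w22_lie_brk w22_lie_basis scaler0. Qed.

Lemma w22_jac_aux (B : w22) (n m k : int) :
  (m - k)%:~R *: ((n - (m + k))%:~R *: B + cocycle n (m + k) *: bC)
  + (k - n)%:~R *: ((m - (k + n))%:~R *: B + cocycle m (k + n) *: bC)
  + (n - m)%:~R *: ((k - (n + m))%:~R *: B + cocycle k (n + m) *: bC) = 0.
Proof.
rewrite !scalerDr addr_perm6 !scalerA -!scalerDl -!rmorphM -!rmorphD.
have -> : (m - k) * (n - (m + k)) + (k - n) * (m - (k + n)) + (n - m) * (k - (n + m)) = 0.
  by ring.
rewrite scale0r add0r; suff -> : (m - k)%:~R * cocycle n (m + k)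
  + (k - n)%:~R * cocycle m (k + n) + (n - m)%:~R * cocycle k (n + m) = 0.
  by rewrite scale0r.
rewrite /cocycle.
have -> : (m == - (k + n)) = (n == - (m + k)) by apply/eqP/eqP; lia.
have -> : (k == - (n + m)) = (n == - (m + k)) by apply/eqP/eqP; lia.
case: eqP => [->|_]; last by rewrite !mulr0 !addr0.
rewrite !mulrA -!mulrDl -!rmorphM -!rmorphD.
set e := (X in _ X / _); have -> : e = 0 by rewrite /e; ring.
by rewrite rmorph0 mul0r.
Qed.

Lemma w22_jac_LL n m i : w22_jac (bL n) (bL m) (w22_bas i) = 0.
Proof.
rewrite /w22_jac !w22_lie_basis; case: i => [k|k|] /=; last first.
- by rewrite !w22_liex0 w22_lieN w22_lie_C oppr0 !addr0.
- rewrite w22_lieNr !w22_lie_brk !w22_lie_basis /=.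
  rewrite -(w22_jac_aux (bW (n + (m + k))) n m k).
  have e2 X : (k - n)%:~R *: X = - ((n - k)%:~R *: X) :> w22.
    by rewrite -scaleNr -rmorphN opprB.
  have e3 X : (k - (n + m))%:~R *: X + cocycle k (n + m) *: bC
      = - ((n + m - k)%:~R *: X + cocycle (n + m) k *: bC) :> w22.
    by rewrite [RHS]opprD -!scaleNr -rmorphN opprB -cocycleN.
  rewrite e2 e3 (addrC k n).
  have -> : m + (n + k) = n + (m + k) by ring.
  by have -> : n + m + k = n + (m + k) by ring.
by rewrite !w22_lie_brk !w22_lie_basis /=; 
  rewrite -(w22_jac_aux (bL (n + (m + k))) n m k);
  have -> : m + (k + n) = n + (m + k) by [ring];
  have -> : k + (n + m) = n + (m + k) by [ring].
Qed.

Lemma w22_jacobi x y z :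
  w22_lie x (w22_lie y z) + w22_lie y (w22_lie z x) + w22_lie z (w22_lie x y) = 0.
Proof.
rewrite -/(w22_jac x y z).
elim/w22_ind: x => [|a i x IHx]; first exact: w22_jac0.
rewrite w22_jacD IHx addr0; suff -> : w22_jac (w22_bas i) y z = 0 by rewrite scaler0.
rewrite -w22_jac_rot; elim/w22_ind: y {IHx} => [|b j y IHy]; first exact: w22_jac0.
rewrite w22_jacD IHy addr0; suff -> : w22_jac (w22_bas j) z (w22_bas i) = 0 by rewrite scaler0.
rewrite -w22_jac_rot; elim/w22_ind: z {IHy} => [|d k z IHz]; first exact: w22_jac0.
rewrite w22_jacD IHz addr0; suff -> : w22_jac (w22_bas k) (w22_bas i) (w22_bas j) = 0.
  by rewrite scaler0.
case: k {IHz} => [k|k|]; case: i => [i|i|]; case: j => [j|j|]; rewrite -?/(bL _);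
  match goal with
  | |- w22_jac (bL _) (bL _) _ = 0 => exact: w22_jac_LL
  | |- w22_jac _ (bL _) (bL _) = 0 => rewrite -w22_jac_rot; exact: w22_jac_LL
  | |- w22_jac (bL _) _ (bL _) = 0 => rewrite w22_jac_rot; exact: w22_jac_LL
  | |- _ => idtac
  end; rewrite /w22_jac.
all: by rewrite !w22_lie_basis /= ?w22_lieNr ?lieWbrk ?lieCbrk ?oppr0 ?w22_liex0 ?addr0.
Qed.

HB.instance Definition _ := Lmodule_isLieAlgebra.Build K w22
  w22_lieDl w22_lieDr w22_liexx w22_jacobi.

End W22.

Section Verma.
Variable K : fieldType.

Definition U22 := env (w22 K).

HB.instance Definition _ := GRing.Algebra.on U22.

Definition uL (n : int) : U22 := env_in (bL K n).
Definition uW (n : int) : U22 := env_in (bW K n).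
Definition uC : U22 := env_in (bC K).

Lemma uLL n m : uL n * uL m - uL m * uL n =
  (n - m)%:~R *: uL (n + m) + cocycle K n m *: uC.
Proof. by rewrite env_in_lie [lie _ _]w22_lie_basis linearD !linearZ. Qed.

Lemma uLW n m : uL n * uW m - uW m * uL n =
  (n - m)%:~R *: uW (n + m) + cocycle K n m *: uC.
Proof. by rewrite env_in_lie [lie _ _]w22_lie_basis linearD !linearZ. Qed.

Lemma uWW n m : uW n * uW m - uW m * uW n = 0.
Proof. by rewrite env_in_lie [lie _ _]w22_lie_basis linear0. Qed.

(** The scalar action of the ground field on a [U22]-module. *)
Definition kscale (M : lmodType U22) (a : K) (x : M) : M := (a%:A : U22) *: x.

Local Notation "a •: x" := (kscale a x) (at level 40, left associativity).

Variant verma_relator (c h hW : K) : U22^o -> Prop :=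
| VermaL (n : nat) of (0 < n)%N : verma_relator c h hW (uL n%:Z)
| VermaW (n : nat) of (0 < n)%N : verma_relator c h hW (uW n%:Z)
| VermaC : verma_relator c h hW (uC - c%:A)
| VermaL0 : verma_relator c h hW (uL 0 - h%:A)
| VermaW0 : verma_relator c h hW (uW 0 - hW%:A).

(** [U22^o] is the left regular module, so its submodules are the left ideals. *)
Definition verma (c h hW : K) : lmodType U22 :=
  quot_mod (submod_gen (verma_relator c h hW)).

Definition vac (c h hW : K) : verma c h hW := qproj _ (1 : U22^o).

Definition weight_vec (M : lmodType U22) (a : K) (x : M) : Prop := uL 0 *: x = a •: x.

Definition singular (M : lmodType U22) (x : M) : Prop :=
  [/\ x != 0, exists a, weight_vec a x
    & forall n : nat, (0 < n)%N -> uL n%:Z *: x = 0 /\ uW n%:Z *: x = 0].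

Definition subsingular (c h hW : K) (N : submodule (verma c h hW)) (u : verma c h hW) :=
  (exists a, weight_vec a u) /\ singular (qproj N u).

(** The index [(ms, ns)], with [ms = [:: m_s; ...; m_1]] and
    [ns = [:: n_t; ...; n_1]], stands for [W_{-m_s}...W_{-m_1} L_{-n_t}...L_{-n_1}]. *)
Definition pbw_idx := (seq nat * seq nat)%type.

Definition part (s : seq nat) : bool := sorted geq s && all (leq 1) s.

Definition is_pbw (i : pbw_idx) : bool := part i.1 && part i.2.

Definition pbw_mon (i : pbw_idx) : U22 :=
  (\prod_(m <- i.1) uW (- m%:Z)) * (\prod_(n <- i.2) uL (- n%:Z)).

Definition Wdeg (i : pbw_idx) : nat := size i.1.

Definition lin_comb (M : lmodType U22) (I : eqType) (s : seq I) (a : I -> K) (e : I -> M) : M :=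
  \sum_(i <- s) a i •: e i.

Definition in_span (M : lmodType U22) (I : eqType) (P : pred I) (e : I -> M) (x : M) : Prop :=
  exists (s : seq I) (a : I -> K), all P s /\ x = lin_comb s a e.

Definition is_basis (M : lmodType U22) (I : eqType) (P : pred I) (e : I -> M) : Prop :=
  (forall x, in_span P e x) /\
  (forall (s : seq I) (a : I -> K), uniq s -> all P s ->
     lin_comb s a e = 0 -> {in s, forall i, a i = 0}).

(** The graph of [x |-> \overline{x}]: [s] is the support of the expansion of
    [x] in the PBW basis and [d] the lowest W-degree occurring in it. *)
Definition lowest_comp (c h hW : K) (x y : verma c h hW) : Prop :=
  exists (s : seq pbw_idx) (a : pbw_idx -> K) (d : nat),
    let e i := pbw_mon i *: vac c h hW in
    [/\ uniq s && all is_pbw s, {in s, forall i, a i != 0}, x = lin_comb s a e,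
        has (fun i => Wdeg i == d) s && all (fun i => d <= Wdeg i)%N s
      & y = lin_comb [seq i <- s | Wdeg i == d] a e].

Definition in_calW (c h hW : K) (x : verma c h hW) : Prop :=
  in_span (fun i : pbw_idx => is_pbw i && (i.2 == [::]))
    (fun i => pbw_mon i *: vac c h hW) x.

Definition Jmax (c h hW : K) : submodule (verma c h hW) := max_submod (verma c h hW).

Definition irr_quot (c h hW : K) : lmodType U22 := quot_mod (Jmax c h hW).

End Verma.

(* Main.v *)
From HB Require Import structures.
Require Import Defs.
From mathcomp Require Import all_boot all_order all_algebra.
From mathcomp Require Import ssrAC finmap boolp monalg.
From mathcomp Require Import reals complex.
From mathcomp Require Import ring zify.

(** The proof is a study of leading terms. Let [v] be the highest weight vector
    and [phi n = 2 hW + (n^2 - 1) c / 12], which under the hypothesis is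
    [(n^2 - p^2) c / 12] and so vanishes, for [n > 0], exactly at [n = p]. Order
    the PBW vectors by W-degree, a lower one being more significant, and within
    a W-degree by the number of L-factors, a higher one being more significant.
    Up to less significant terms, [W_n] with [n > 0] removes one factor [L_{-n}],
    and [L_n] removes one factor [W_{-n}], in both cases with the coefficient
    [n phi n] times a multiplicity ([gW_ev], [gL_ev]). So the positive modes
    detect all factors of a leading term except [L_{-p}] and [W_{-p}].

    All of this presupposes that the PBW vectors are linearly independent. The
    bracket of the negative part is the commutator of a pre-Lie product; hence
    the symmetric functions on multisets of negative letters carry a
    representation of the negative part ([ract_comm]), and separate the PBW
    monomials modulo the relations ([pbw_free]).

    The factor [W_{-p}]. The recursion [a_0 = 1],
    [a_k = 6 / (c k (p - k)) * sum_(i = 1 .. k) W_{-i} a_{k-i}] makes the vector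
    [u' = sum_(i = 1 .. p) W_{-i} a_{p-i} v = W_{-p} v + ...] singular ([uop_hw]).
    The vectors obtained from [u'] by applying PBW monomials have as leading
    terms precisely the PBW vectors with a factor [W_{-p}] ([f1_low]). This
    triangularity gives at once the freeness of the submodule generated by [u']
    and the basis of the quotient [L'] ([u1_free], [reduce1], [N1_eq0]).

    The factor [L_{-p}]. Submodules are graded, so a quotient by a proper
    submodule is irreducible unless it contains a singular vector of positive
    degree ([irr_or_sing]). Let [z] represent such a vector of [L'], reduced to
    have no factors [W_{-p}]. If its leading term had a factor other than
    [L_{-p}], the mode detecting it would produce an element of the submodule
    generated by [u'] whose leading term has no factor [W_{-p}], which is absurd.
    Therefore [z] is [L_{-p}^r v] plus terms of positive W-degree ([lead_sing],
    [lead_exact]). Comparing the coordinate of [W_n z], for [0 < n < p], at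
    [W_{n-p} L_{-p}^{r-1} v] with the coordinate of [L_p z] at
    [L_{-p}^{r-1} v] eliminates the unknown terms of W-degree one, and what
    remains is the stated relation between [h] and [r] ([sing_h]). This proves
    (i), and the existence of [u] in (ii).

    In (ii) the relation determines [r], so [L'] has no singular vectors of
    positive degree outside weight [h + r p] ([sing1_wt]). This uniqueness does
    the rest. It forces [W_0 u = hW u] and the vanishing of the singular
    operator on [u] in [L'], so the image of [u] in [L'] generates a quotient of
    the module [L'] of highest weight [h + r p], spanned by PBW monomials
    without [W_{-p}] ([act_u2]). Consequently the submodule generated by [u] and
    [u'] is again triangular, with leading terms the PBW vectors having a factor
    [W_{-p}] or [L_{-p}^r] ([f2_low], [N2_f2]). A singular vector of its quotient
    would have leading term [L_{-p}^s v] with [0 < s < r], would already be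
    singular in [L'] as its weight is too small to involve [u], and would violate
    the uniqueness. So this quotient is irreducible ([N2_irr]). *)

Set Implicit Arguments.
Unset Strict Implicit.
Unset Printing Implicit Defensive.

Import GRing.Theory.
Local Open Scope ring_scope.

(** * Equalities in abelian groups *)

(** Equalities between sums in an abelian group, up to associativity,
    commutativity and cancellation, are decided by comparing the integer
    coefficients of the atoms. *)
Inductive zexp := ZVar of nat | ZAdd of zexp & zexp | ZOpp of zexp | ZNul.

Fixpoint zeval (V : zmodType) (s : seq V) (e : zexp) : V :=
  match e with
  | ZVar n => s`_n
  | ZAdd a b => zeval s a + zeval s b
  | ZOpp a => - zeval s a
  | ZNul => 0
  end.

Fixpoint zcoef (e : zexp) (i : nat) : int :=
  match e with
  | ZVar n => (n == i)%:Z
  | ZAdd a b => zcoef a i + zcoef b i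
  | ZOpp a => - zcoef a i
  | ZNul => 0
  end.

Lemma zevalE (V : zmodType) (s : seq V) e : zeval s e = \sum_(i < size s) s`_i *~ zcoef e i.
Proof.
elim: e => [n|a IHa b IHb|a IHa|] /=.
- have [ns|sn] := ltnP n (size s).
    rewrite (bigD1 (Ordinal ns)) //= eqxx big1 ?addr0 // => i ni.
    by rewrite eq_sym; move: ni; rewrite -val_eqE /= => /negPf->.
  rewrite nth_default // big1 // => i _.
  by have := ltn_ord i; rewrite ltnNge; case: eqP => // <-; rewrite sn.
- by rewrite IHa IHb -big_split; apply: eq_bigr => i _; rewrite mulrzDr.
- by rewrite IHa -sumrN; apply: eq_bigr => i _; rewrite mulrNz.
by rewrite big1 // => i _.
Qed.

Lemma zmod_eq (V : zmodType) (s : seq V) a b :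
  all (fun i => zcoef a i == zcoef b i) (iota 0 (size s)) -> zeval s a = zeval s b.
Proof.
move=> /allP ab; rewrite !zevalE; apply: eq_bigr => i _.
by rewrite (eqP (ab (val i) _)) // mem_iota /= add0n.
Qed.

(** Atoms are compared up to conversion, because one scalar may occur with two
    different structure paths. *)
Ltac zmod_find x l :=
  lazymatch l with
  | ?y :: ?l' =>
    match goal with
    | _ => let _ := match goal with _ => unify x y end in constr:(Some 0%N)
    | _ =>
      let r := zmod_find x l' in
      lazymatch r with Some ?n => constr:(Some n.+1) | None => constr:(@None nat) end
    end
  | _ => constr:(@None nat)
  end.
Ltac zmod_add x l :=
  let r := zmod_find x l in lazymatch r with Some _ => l | None => constr:(x :: l) end.
Ltac zmod_atoms t l :=
  lazymatch t with
  | (?a + ?b)%R => let l' := zmod_atoms a l in zmod_atoms b l'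
  | (- ?a)%R => zmod_atoms a l
  | 0%R => l
  | _ => zmod_add t l
  end.
Ltac zmod_reify t l :=
  lazymatch t with
  | (?a + ?b)%R => let a' := zmod_reify a l in let b' := zmod_reify b l in constr:(ZAdd a' b')
  | (- ?a)%R => let a' := zmod_reify a l in constr:(ZOpp a')
  | 0%R => constr:(ZNul)
  | _ => let r := zmod_find t l in lazymatch r with Some ?n => constr:(ZVar n) end
  end.
Ltac zmod :=
  lazymatch goal with
  | |- @eq ?V ?a ?b =>
    let l := zmod_atoms a (@nil V) in
    let l := zmod_atoms b l in
    let a' := zmod_reify a l in
    let b' := zmod_reify b l in
    exact: (@zmod_eq _ l a' b' isT)
  end.

(** * The Lie algebra acting on words in negative letters *)

Section LinearExtension.
Variables (K : fieldType) (I : choiceType) (M : lmodType K) (f : I -> M).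

Definition lext (x : {malg K[I]}) : M := \sum_(i <- msupp x) x@_i *: f i.

Lemma lextE (d : {fset I}) x : fsubset (msupp x) d -> lext x = \sum_(i <- d) x@_i *: f i.
Proof.
by move=> sxd; apply: big_fset_incl => // i _ /mcoeff_outdom ->; rewrite scale0r.
Qed.

Lemma lext_linear : linear lext.
Proof.
move=> a x y.
pose d := fsetU (msupp (a *: x + y)) (fsetU (msupp x) (msupp y)).
have [s1 s2 s3] : [/\ fsubset (msupp (a *: x + y)) d, fsubset (msupp x) d
                    & fsubset (msupp y) d].
  by split; rewrite /d ?fsubsetUl // fsubsetU // ?fsubsetUl ?fsubsetUr ?orbT.
rewrite (lextE s1) (lextE s2) (lextE s3) scaler_sumr -big_split /=.
by apply: eq_bigr => i _; rewrite mcoeffD mcoeffZ scalerDl scalerA.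
Qed.
HB.instance Definition _ := GRing.isLinear.Build K {malg K[I]} M *:%R lext lext_linear.

Lemma lextU i : lext << i >> = f i.
Proof. by rewrite (lextE msuppU_le) big_seq_fset1 mcoeffUU scale1r. Qed.

End LinearExtension.

Lemma malg_lin_ind (K : fieldType) (I : choiceType) (P : {malg K[I]} -> Prop) :
  P 0 -> (forall a i y, P y -> P (a *: << i >> + y)) -> forall x, P x.
Proof.
move=> P0 PD x; rewrite [x]monalgE.
elim: (enum_fset _) => [|i s IH]; first by rewrite big_nil.
rewrite big_cons.
suff -> : << x@_i *g i >> = x@_i *: << i >> :> {malg K[I]} by exact: PD.
by apply/malgP => k; rewrite mcoeffZ !mcoeffU mulrnAr mulr1.
Qed.

(** In this part and the next one, [(true, k)] stands for [W_{-(k+1)}] and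
    [(false, k)] for [L_{-(k+1)}], so that every pair of a boolean and a
    number is a letter. *)
Definition letter := (bool * nat)%type.

(** The free module [T] on the words in negative letters is kept abstract: only
    its basis [wb], linear extension [ext] and induction principle are used. The
    negative modes act on [T] by prefixing a letter, the other basis elements of the Lie
    algebra by commuting through the word. This is not yet a representation:
    the defect lies in the span of the commutation relations between negative
    letters, see [relT_defect]. *)
Section FreeVerma.
Variables (K : fieldType) (c h hW : K).
Local Notation g := (w22 K).
Local Notation br := (@w22_lie K).

Variables (T : lmodType K) (wb : seq letter -> T).
Variable ext : forall M : lmodType K, (seq letter -> M) -> T -> M.
Hypothesis extP : forall (M : lmodType K) (f : seq letter -> M), linear (ext f).
Hypothesis ext_wb : forall (M : lmodType K) (f : seq letter -> M) w, ext f (wb w) = f w.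
Hypothesis T_ind : forall P : T -> Prop,
  P 0 -> (forall a w t, P t -> P (a *: wb w + t)) -> forall t, P t.

Definition lidx (z : letter) : w22_idx := if z.1 then IW (Negz z.2) else IL (Negz z.2).

Lemma lin0 (M N : lmodType K) (f : M -> N) : linear f -> f 0 = 0.
Proof. by move=> lf; have := lf (-1) 0 0; rewrite scaler0 addr0 scaleN1r addNr. Qed.

Definition consT (z : letter) : T -> T := ext (fun w => wb (z :: w)).

Lemma consTP z a t t' : consT z (a *: t + t') = a *: consT z t + consT z t'.
Proof. exact: extP. Qed.
Lemma consT0 z : consT z 0 = 0. Proof. by apply: lin0; exact: extP. Qed.
Lemma consTU z w : consT z (wb w) = wb (z :: w).
Proof. exact: ext_wb. Qed.

(** The character of the Borel subalgebra on the highest weight vector. *)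
Definition actv (X : w22_idx) : K :=
  match X with IL (Posz 0) => h | IW (Posz 0) => hW | IC => c | _ => 0 end.

Fixpoint actw (w : seq letter) (X : w22_idx) : T :=
  match X with
  | IL (Negz k) => wb ((false, k) :: w)
  | IW (Negz k) => wb ((true, k) :: w)
  | _ => if w is z :: w' then
           consT z (actw w' X) + w22_ext (actw w') (w22_brk K X (lidx z))
         else actv X *: wb [::]
  end.

Definition isneg (X : w22_idx) : bool :=
  match X with IL (Negz _) | IW (Negz _) => true | _ => false end.

Lemma isnegP X : isneg X -> exists z, X = lidx z.
Proof. by case: X => [[|k]|[|k]|] //= _; [exists (false, k)|exists (true, k)]. Qed.

Definition rho (x : g) : T -> T := ext (fun w => w22_ext (actw w) x).
Lemma rhoP x a t t' : rho x (a *: t + t') = a *: rho x t + rho x t'.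
Proof. exact: extP. Qed.
Lemma rho0r x : rho x 0 = 0. Proof. by apply: lin0; exact: extP. Qed.
Lemma rhoU x w : rho x (wb w) = w22_ext (actw w) x.
Proof. exact: ext_wb. Qed.

Lemma rho_basU X w : rho (w22_bas K X) (wb w) = actw w X.
Proof. by rewrite rhoU w22_ext_basis. Qed.

Lemma rhoDl a x y t : rho (a *: x + y) t = a *: rho x t + rho y t.
Proof.
elim/T_ind: t => [|b w t IH]; first by rewrite !rho0r scaler0 addr0.
rewrite !rhoP IH !rhoU w22_ext_linear scalerDr scalerA mulrC -scalerA.
by rewrite addrACA -scalerDr.
Qed.

Lemma rho0l t : rho 0 t = 0.
Proof. by have := rhoDl (-1) 0 0 t; rewrite scaler0 addr0 scaleN1r addNr. Qed.

Lemma rhoNl x t : rho (- x) t = - rho x t.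
Proof. by have := rhoDl (-1) x 0 t; rewrite addr0 rho0l addr0 !scaleN1r. Qed.

Lemma rho_neg z t : rho (w22_bas K (lidx z)) t = consT z t.
Proof.
elim/T_ind: t => [|a w t IH]; first by rewrite rho0r consT0.
rewrite rhoP consTP IH (rho_basU _ w) (consTU z w).
by suff -> : actw w (lidx z) = wb (z :: w) by []; case: z {IH} => [[] k]; case: w.
Qed.

Lemma rho_cons X z t : ~~ isneg X ->
  rho (w22_bas K X) (consT z t) =
  consT z (rho (w22_bas K X) t) + rho (br (w22_bas K X) (w22_bas K (lidx z))) t.
Proof.
move=> negX; elim/T_ind: t => [|a w t IH]; first by rewrite (consT0 z) !rho0r consT0 addr0.
rewrite consTP !rhoP IH (consTU z w) consTP !rho_basU w22_lie_basis rhoU.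
have -> : actw (z :: w) X = consT z (actw w X) + w22_ext (actw w) (w22_brk K X (lidx z)).
  by case: X negX {IH} => [[n|]|[n|]|].
by rewrite scalerDr addrACA.
Qed.

(** With [T] seen as the tensor algebra of the negative part, this is the ideal
    whose quotient is the enveloping algebra. Closing under prefixes is enough,
    because the relators stand in front of an arbitrary element. *)
Inductive relT : T -> Prop :=
| RelT0 : relT 0
| RelTD a x y of relT x & relT y : relT (a *: x + y)
| RelTcons z t of relT t : relT (consT z t)
| RelTcomm y z t : relT (consT y (consT z t) - consT z (consT y t)
                         - rho (br (w22_bas K (lidx y)) (w22_bas K (lidx z))) t).

Lemma relTZ a x : relT x -> relT (a *: x).
Proof. by move=> Nx; rewrite -[_ *: _]addr0; apply: RelTD => //; exact: RelT0. Qed.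
Lemma relTA x y : relT x -> relT y -> relT (x + y).
Proof. by move=> Nx; rewrite -[x]scale1r; apply: RelTD. Qed.
Lemma relTN x : relT x -> relT (- x).
Proof. by rewrite -scaleN1r; exact: relTZ. Qed.

Definition defect x y t := rho x (rho y t) - rho y (rho x t) - rho (br x y) t.

Lemma defectP x y t a t' : defect x y (a *: t + t') = a *: defect x y t + defect x y t'.
Proof.
rewrite /defect !rhoP !opprD (addrACA (a *: _)) (addrACA (a *: _ - _)) -!scalerBr.
by [].
Qed.

Lemma defectPl a x x' y t : defect (a *: x + x') y t = a *: defect x y t + defect x' y t.
Proof.
by rewrite /defect w22_lieDl !rhoDl rhoP !opprD (addrACA (a *: _)) (addrACA (a *: _ - _)) -!scalerBr.
Qed.

Lemma defectC x y t : defect y x t = - defect x y t.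
Proof.
by rewrite /defect w22_lieN rhoNl !opprD !opprK (addrC (- rho x _)).
Qed.

Lemma defectPr a x y y' t : defect x (a *: y + y') t = a *: defect x y t + defect x y' t.
Proof.
by rewrite defectC defectPl opprD -scalerN (defectC x y) (defectC x y') !opprK.
Qed.

Lemma defect0l y t : defect 0 y t = 0.
Proof. by rewrite /defect !rho0l w22_lie0x rho0l rho0r !subr0. Qed.

Lemma defect0r x t : defect x 0 t = 0.
Proof. by rewrite defectC defect0l oppr0. Qed.

Lemma defectT0 x y : defect x y 0 = 0.
Proof. by rewrite /defect !rho0r !subr0. Qed.

Lemma defect_ind (P : T -> Prop) t :
  P 0 -> (forall a u v, P u -> P v -> P (a *: u + v)) ->
  (forall X Y, P (defect (w22_bas K X) (w22_bas K Y) t)) -> forall x y, P (defect x y t).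
Proof.
move=> P0 PD PXY x y; elim/w22_ind: x => [|a X x IHx]; first by rewrite defect0l.
rewrite defectPl; apply: (PD) => // {IHx}; elim/w22_ind: y => [|a' Y y IHy].
  by rewrite defect0r.
by rewrite defectPr; apply: PD.
Qed.

(** When one of the two elements is negative, the defect is itself a relator, or
    vanishes by the very definition of the action on a prefixed word. *)
Lemma defect_negl z y t : relT (defect (w22_bas K (lidx z)) y t).
Proof.
elim/w22_ind: y => [|a X y IH]; first by rewrite defect0r; exact: RelT0.
rewrite defectPr; apply: RelTD => //.
have [/isnegP[y' ->]|posX] := boolP (isneg X).
  rewrite /defect !rho_neg; exact: RelTcomm.
rewrite defectC /defect !rho_neg rho_cons // (addrC (consT _ _)) addrK subrr oppr0.
exact: RelT0.
Qed.


(** This is all that [defect_cons] needs of the nonnegative modes and of their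
    brackets, which satisfy it by [borel_bas] and [borel_brk]. *)
Definition borel (x : g) : Prop :=
  forall z t, rho x (consT z t) = consT z (rho x t) + rho (br x (w22_bas K (lidx z))) t.

Lemma borelD a x y : borel x -> borel y -> borel (a *: x + y).
Proof.
move=> bx hy z t; rewrite !rhoDl consTP bx hy w22_lieDl rhoDl scalerDr.
by rewrite addrACA.
Qed.

Lemma borel0 : borel 0.
Proof. by move=> z t; rewrite w22_lie0x !rho0l consT0 addr0. Qed.

Lemma borel_bas X : ~~ isneg X -> borel (w22_bas K X).
Proof. by move=> posX z t; exact: rho_cons. Qed.

Lemma borel_brk X Y : ~~ isneg X -> ~~ isneg Y -> borel (br (w22_bas K X) (w22_bas K Y)).
Proof.
have bD a b X' Y' : ~~ isneg X' -> ~~ isneg Y' ->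
    borel (a *: w22_bas K X' + b *: w22_bas K Y').
  move=> pX pY; apply: borelD; first exact: borel_bas.
  by rewrite -[_ *: _]addr0; apply: borelD; [exact: borel_bas|exact: borel0].
rewrite w22_lie_basis; case: X => [[n|]|[n|]|] //; case: Y => [[m|]|[m|]|] // _ _;
  try exact: borel0; rewrite /= -?PoszD; try exact: bD.
rewrite -[- _]add0r -scaleN1r addrC.
apply: borelD; last exact: borel0.
exact: bD.
Qed.

(** By the Jacobi identity the defect passes through a letter, at the price of
    defects with one bracketed entry; this is the step of the induction on
    words in [relT_defect]. *)
Lemma defect_cons x y z t : borel x -> borel y -> borel (br x y) ->
  let bz := w22_bas K (lidx z) in
  defect x y (consT z t) =
  consT z (defect x y t) + (defect (br x bz) y t + defect x (br y bz) t).
Proof.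
move=> bx hy bxy bz; rewrite /defect bx hy bxy.
have -> : rho x (consT z (rho y t) + rho (br y bz) t) =
          consT z (rho x (rho y t)) + rho (br x bz) (rho y t) + rho x (rho (br y bz) t).
  by rewrite -[consT z _]scale1r rhoP scale1r bx.
have -> : rho y (consT z (rho x t) + rho (br x bz) t) =
          consT z (rho y (rho x t)) + rho (br y bz) (rho x t) + rho y (rho (br x bz) t).
  by rewrite -[consT z _]scale1r rhoP scale1r hy.
have -> : consT z (rho x (rho y t) - rho y (rho x t) - rho (br x y) t) =
  consT z (rho x (rho y t)) - consT z (rho y (rho x t)) - consT z (rho (br x y) t).
  by rewrite -!scaleN1r addrC consTP [rho x _ + _]addrC consTP !scaleN1r addrC [- _ + consT _ _]addrC.
have -> : rho (br (br x y) bz) t = rho (br (br x bz) y) t + rho (br x (br y bz)) t.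
  rewrite -[rho (br (br x bz) y) t]scale1r -rhoDl scale1r; congr (rho _ t).
  rewrite (w22_lieN y (br x bz)) (w22_lieN bz x) w22_lieNr opprK (w22_lieN bz) -[LHS]add0r.
  by rewrite -(w22_jacobi x y bz) addrK addrC.
move: (consT z _) (consT z _) (consT z _) => A B C.
move: (rho _ _) (rho _ _) (rho _ _) (rho _ _) (rho _ _) (rho _ _) => D E F G H I.
zmod.
Qed.

(** The action is a representation modulo the relations. For two Borel elements
    the case of the empty word says that [actv] is a character of the Borel
    subalgebra: a bracket of nonnegative modes has no component along [L_0],
    [W_0] or [C]. *)
Lemma relT_defect x y t : relT (defect x y t).
Proof.
have PD a u v : relT u -> relT v -> relT (a *: u + v) by exact: RelTD.
elim/T_ind: t => [|a w t IH].
  rewrite defectT0; exact: RelT0.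
rewrite defectP; apply: (PD) => // {a t IH}.
elim: w x y => [|z w IH] x y; apply: (@defect_ind relT _ RelT0 PD) => X Y.
all: have [/isnegP[X' ->]|posX] := boolP (isneg X); first exact: defect_negl.
all: have [/isnegP[Y' ->]|posY] := boolP (isneg Y);
  first (rewrite defectC; apply: relTN; exact: defect_negl).
  suff -> : defect (w22_bas K X) (w22_bas K Y) (wb [::]) = 0 by exact: RelT0.
  have a0 Z : ~~ isneg Z -> rho (w22_bas K Z) (wb [::]) = actv Z *: wb [::].
    by rewrite rho_basU; case: Z => [[n|]|[n|]|].
  have aa Z Z' : ~~ isneg Z -> ~~ isneg Z' ->
    rho (w22_bas K Z) (rho (w22_bas K Z') (wb [::])) = (actv Z * actv Z') *: wb [::].
    by move=> pZ pZ'; rewrite !a0 // -[_ *: _]addr0 rhoP rho0r addr0 a0 // scalerA mulrC.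
  have rDD a b Z Z' : ~~ isneg Z -> ~~ isneg Z' ->
    rho (a *: w22_bas K Z + b *: w22_bas K Z') (wb [::]) = (a * actv Z + b * actv Z') *: wb [::].
    move=> pZ pZ'; rewrite rhoDl -[b *: _]addr0 rhoDl rho0l addr0 !a0 //.
    by rewrite !scalerA -scalerDl.
  have cc (n m : nat) u : (n%:Z - m%:Z)%:~R * (if (n + m)%N == 0%N then u else 0)
                       + cocycle K n%:Z m%:Z * c = 0.
    rewrite /cocycle; case: (eqVneq (n + m)%N 0%N) => [/eqP|nm0].
      rewrite addn_eq0 => /andP[/eqP-> /eqP->].
      rewrite subrr mul0r add0r oppr0 eqxx. by rewrite mulr0z !mul0r.
    rewrite mulr0 add0r; case: eqP => [|_]; last by rewrite mul0r.
    by move=> e; case/eqP: nm0; lia.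
  rewrite /defect !aa // [actv Y * _]mulrC subrr sub0r w22_lie_basis.
  apply/eqP; rewrite oppr_eq0; apply/eqP.
  case: X posX => [[n|]|[n|]|] // _; case: Y posY => [[m|]|[m|]|] // _; rewrite /= ?rho0l //.
  - by rewrite [LHS](rDD _ _ (IL (n + m)%N) IC) // -[RHS](scale0r (wb [::])) -(cc n m h);
      case: n; case: m.
  - by rewrite [LHS](rDD _ _ (IW (n + m)%N) IC) // -[RHS](scale0r (wb [::])) -(cc n m hW);
      case: n; case: m.
  - rewrite rhoNl [X in - X](rDD _ _ (IW (m + n)%N) IC) // -[RHS]oppr0.
    by rewrite -[X in _ = - X](scale0r (wb [::])) -(cc m n hW); case: n; case: m.
rewrite -(consTU z w) defect_cons; try exact: borel_bas; last exact: borel_brk.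
apply: relTA; first by apply: RelTcons; exact: IH.
by apply: relTA; exact: IH.
Qed.

(** The relations are stable under the whole Lie algebra: moving [X] through a
    relator only produces defects, which are relations by [relT_defect]. *)
Lemma relT_rho x t : relT t -> relT (rho x t).
Proof.
move=> Nt; elim/w22_ind: x => [|a X x IH]; first by rewrite rho0l; exact: RelT0.
rewrite rhoDl; apply: RelTD => // {IH x}; elim: Nt X => {t}.
- by move=> X; rewrite rho0r; exact: RelT0.
- by move=> b x y _ IHx _ IHy X; rewrite rhoP; exact: RelTD.
- move=> z t Nt IH X; have [/isnegP[y ->]|posX] := boolP (isneg X).
    by rewrite rho_neg; apply: RelTcons; exact: RelTcons.
  rewrite rho_cons //; apply: relTA; first exact: RelTcons.
  elim/w22_ind: (br _ _) => [|b Y y IHy]; first by rewrite rho0l; exact: RelT0.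
  by rewrite rhoDl; apply: RelTD.
move=> y z t X; have [/isnegP[y' ->]|posX] := boolP (isneg X).
  by rewrite rho_neg; apply: RelTcons; exact: RelTcomm.
set bx := w22_bas K X; set bY := w22_bas K _; set bz := w22_bas K _.
have rhoD x1 u v : rho x1 (u + v) = rho x1 u + rho x1 v.
  by rewrite -[u]scale1r rhoP !scale1r.
have rhoN x1 u : rho x1 (- u) = - rho x1 u.
  by rewrite -scaleN1r -[_ *: u]addr0 rhoP rho0r addr0 scaleN1r.
rewrite -!rho_neg -/bY -/bz.
have -> : rho bx (rho bY (rho bz t) - rho bz (rho bY t) - rho (br bY bz) t) =
  defect bY bz (rho bx t) + defect (br bx bY) bz t + defect bY (br bx bz) t
  + (defect bx bY (rho bz t) + rho bY (defect bx bz t) - defect bx bz (rho bY t)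
     - rho bz (defect bx bY t) - defect bx (br bY bz) t).
  have J : rho (br bx (br bY bz)) t - rho (br (br bx bY) bz) t - rho (br bY (br bx bz)) t = 0.
    rewrite (w22_lieN bz (br bx bY)) (w22_lieN bz bx) w22_lieNr !rhoNl !opprK.
    have rhoDl1 x1 x2 : rho (x1 + x2) t = rho x1 t + rho x2 t.
      by rewrite -[x1]scale1r rhoDl !scale1r.
    by rewrite -!rhoDl1 addrAC w22_jacobi rho0l.
  rewrite /defect !(rhoN, rhoD) -[LHS]addr0 -J; zmod.
rewrite -/bY -/bz !rho_neg; do ![exact: relT_defect|exact: relTN|apply: relTA|apply: RelTcons|apply: relTN].
Qed.

(** The Lie bracket of the negative part is the commutator of the product
    [a o z = circ_coef a z * circ a z], that is [L_{-n} o L_{-m} = m L_{-n-m}],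
    [L_{-n} o W_{-m} = m W_{-n-m}], [W_{-n} o L_{-m} = m W_{-n-m}] and
    [W o W = 0]. This product is pre-Lie ([circ_jac]), which allows the PBW
    theorem to be proved by an explicit action on symmetric functions of
    letters, as in the Guin-Oudom construction. *)
Definition circ (a z : letter) : letter := (a.1 || z.1, (a.2 + z.2).+1).
Definition circ_coef (a z : letter) : K := if a.1 && z.1 then 0 else z.2.+1%:R.

Lemma circC a z : circ a z = circ z a.
Proof. by rewrite /circ orbC addnC. Qed.
Lemma circA a b z : circ a (circ b z) = circ (circ a b) z.
Proof. by rewrite /circ /= orbA addnS addSn addnA. Qed.

Lemma circ_jac y z x :
  circ_coef z x * circ_coef y (circ z x) - circ_coef y x * circ_coef z (circ y x) =
  (circ_coef y z - circ_coef z y) * circ_coef (circ y z) x.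
Proof.
case: x => [[] x]; case: y => [[] y]; case: z => [[] z]; rewrite /circ_coef /= -?natr1 ?natrD; ring.
Qed.

Lemma br_neg a z : br (w22_bas K (lidx a)) (w22_bas K (lidx z)) =
  (circ_coef a z - circ_coef z a) *: w22_bas K (lidx (circ a z)).
Proof.
have e k l : (Negz k - Negz l)%:~R = l.+1%:R - k.+1%:R :> K.
  by rewrite !NegzE opprK addrC rmorphB.
have e0 k l : cocycle K (Negz k) (Negz l) = 0.
  by rewrite /cocycle; case: eqP => //; lia.
have e1 k l : (Negz k + Negz l) = Negz (k + l).+1 by lia.
rewrite w22_lie_basis; case: a z => [[] k] [[] l] /=.
- by rewrite /circ_coef /= subrr scale0r.
- by rewrite e0 scale0r addr0 e e1 -scaleNr opprB addnC.
- by rewrite e0 scale0r addr0 e e1.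
- by rewrite e0 scale0r addr0 e e1.
Qed.

Implicit Types f : seq letter -> K.
(** A function of words which is symmetric is a linear form on the symmetric
    algebra. [ract a] is the transpose of the action of the letter [a]: multiply
    by [a], and let [a] act as a derivation through the pre-Lie product. *)
Definition symf f := forall l l', perm_eq l l' -> f l = f l'.
Definition dl a f l : K := \sum_(z <- l) circ_coef a z * f (circ a z :: rem z l).
Definition ract a f l : K := f (a :: l) + dl a f l.

Lemma symf_cons x f : symf f -> symf (fun l => f (x :: l)).
Proof. by move=> sf l l' ll'; apply: sf; rewrite perm_cons. Qed.

Lemma dl_sym a f : symf f -> symf (dl a f).
Proof.
move=> sf l l' ll'; rewrite /dl (perm_big _ ll'); apply: eq_bigr => z _.
congr (_ * _); apply: sf; rewrite perm_cons.
have [zl|zl] := boolP (z \in l).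
  rewrite -(perm_cons z) -(permPl (perm_to_rem zl)) (permPl ll').
  by rewrite perm_to_rem // -(perm_mem ll').
by rewrite !rem_id // -(perm_mem ll').
Qed.

Lemma ract_sym a f : symf f -> symf (ract a f).
Proof.
move=> sf l l' ll'; rewrite /ract (dl_sym _ sf ll'); congr (_ + _).
by apply: sf; rewrite perm_cons.
Qed.

Lemma dl_cons a f x l : symf f ->
  dl a f (x :: l) = circ_coef a x * f (circ a x :: l) + dl a (fun l' => f (x :: l')) l.
Proof.
move=> sf; rewrite /dl big_cons /= eqxx; congr (_ + _).
rewrite big_seq [RHS]big_seq; apply: eq_bigr => z zl; congr (_ * _); apply: sf.
case: eqP => [e|_]; last exact: (permEl (perm_catCA [:: _] [:: _] _)).
apply: (perm_trans _ (permEl (perm_catCA [:: circ a z] [:: x] (rem z l)))).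
by rewrite /= perm_cons e perm_to_rem.
Qed.

Lemma dlD a b f g l : dl a (fun l' => b * f l' + g l') l = b * dl a f l + dl a g l.
Proof.
rewrite /dl big_distrr -big_split /=; apply: eq_bigr => z _; ring.
Qed.

Lemma eq_dl a f f' l : f =1 f' -> dl a f l = dl a f' l.
Proof. by move=> e; apply: eq_bigr => z _; rewrite e. Qed.

(** The derivations attached to letters represent the Lie algebra. This is
    where the pre-Lie identity is used. *)
Lemma dl_comm y z f l : symf f ->
  dl z (dl y f) l - dl y (dl z f) l =
  (circ_coef y z - circ_coef z y) * dl (circ y z) f l.
Proof.
elim: l f => [|x l IH] f sf; first by rewrite /dl !big_nil; ring.
have E a b : dl a (dl b f) (x :: l) =
    circ_coef a x * circ_coef b (circ a x) * f (circ b (circ a x) :: l)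
    + circ_coef a x * dl b (fun l' => f (circ a x :: l')) l
    + circ_coef b x * dl a (fun l' => f (circ b x :: l')) l
    + dl a (dl b (fun l' => f (x :: l'))) l.
  rewrite dl_cons; last exact: dl_sym.
  rewrite dl_cons //.
  rewrite (@eq_dl a (fun l' => dl b f (x :: l')) (fun l' => circ_coef b x * f (circ b x :: l') + dl b (fun l'' => f (x :: l'')) l')).
    have -> := dlD a (circ_coef b x) (fun l' => f (circ b x :: l')) (dl b (fun l' => f (x :: l'))) l.
    ring.
  by move=> l'; rewrite dl_cons.
rewrite !E dl_cons // mulrDr -(IH (fun l' => f (x :: l'))); last exact: symf_cons.
have e : circ z (circ y x) = circ (circ y z) x by rewrite circA [circ z y]circC.
rewrite e (circA y z x) [X in _ = X + _]mulrA -circ_jac; ring.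
Qed.

(** Hence the letters act on symmetric functions through the Lie bracket. *)
Lemma ract_comm y z f l : symf f ->
  ract z (ract y f) l - ract y (ract z f) l =
  (circ_coef y z - circ_coef z y) * ract (circ y z) f l.
Proof.
move=> sf; rewrite {1 3}/ract mulrDr -dl_comm //.
have E a b : dl a (ract b f) l = dl a (fun l' => f (b :: l')) l + dl a (dl b f) l.
  rewrite -[X in X + _]mul1r -dlD; apply: eq_dl => l'.
  by rewrite mul1r.
rewrite !E /ract !dl_cons // [circ z y]circC.
have -> : f (z :: y :: l) = f (y :: z :: l) by apply: sf; exact: (permEl (perm_catCA [:: z] [:: y] l)).
ring.
Qed.

(** The value of the word [w] on [f]: its letters act on [f], and the result is
    evaluated at the empty multiset. *)
Fixpoint wfun (w : seq letter) f : K :=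
  if w is a :: w' then wfun w' (ract a f) else f [::].
Definition tfun f (t : T) : K^o := ext (M := K^o) (fun w => wfun w f : K^o) t.

Lemma tfunP f a t t' : tfun f (a *: t + t') = a * tfun f t + tfun f t'.
Proof. exact: (extP (M := K^o)). Qed.
Lemma tfun0 f : tfun f 0 = 0.
Proof. exact: (@lin0 T K^o (tfun f) (extP _)). Qed.
Lemma tfunU f w : tfun f (wb w) = wfun w f.
Proof. exact: (ext_wb (M := K^o)). Qed.

Lemma tfunB f t t' : tfun f (t - t') = tfun f t - tfun f t'.
Proof. by rewrite -scaleN1r addrC tfunP mulN1r addrC. Qed.

Lemma eq_wfun w f1 f2 : f1 =1 f2 -> wfun w f1 = wfun w f2.
Proof.
elim: w f1 f2 => [|a v IH] f1 f2 e /=; first exact: e.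
by apply: IH => l; rewrite /ract e; congr (_ + _); apply: eq_dl.
Qed.

Lemma wfunD b f g w : wfun w (fun l => b * f l + g l) = b * wfun w f + wfun w g.
Proof.
elim: w f g => [//|a w IH] f g /=; rewrite -IH; apply: eq_wfun => l.
by rewrite /ract dlD; ring.
Qed.

Lemma eq_tfun f1 f2 t : f1 =1 f2 -> tfun f1 t = tfun f2 t.
Proof.
move=> e; elim/T_ind: t => [|b w t IH]; first by rewrite !tfun0.
by rewrite !tfunP IH !tfunU (eq_wfun _ e).
Qed.

Lemma tfun_comb b f g t : tfun (fun l => b * f l + g l) t = b * tfun f t + tfun g t.
Proof.
elim/T_ind: t => [|d w t IH]; first by rewrite !tfun0 mulr0 addr0.
by rewrite !tfunP IH !tfunU wfunD; ring.
Qed.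

Lemma tfun_cons f a t : tfun f (consT a t) = tfun (ract a f) t.
Proof.
elim/T_ind: t => [|b w t IH]; first by rewrite consT0 !tfun0.
by rewrite consTP !tfunP IH consTU !tfunU.
Qed.

(** A symmetric function cannot see the relations, by [ract_comm]. *)
Lemma tfun_rel f t : symf f -> relT t -> tfun f t = 0.
Proof.
move=> sf Nt; elim: Nt f sf => {t}.
- by move=> f _; rewrite tfun0.
- by move=> a x y _ IHx _ IHy f sf; rewrite tfunP IHx // IHy // mulr0 addr0.
- by move=> z t _ IH f sf; rewrite tfun_cons IH //; exact: ract_sym.
move=> y z t f sf; rewrite br_neg -[_ *: w22_bas _ _]addr0 rhoDl rho0l addr0 rho_neg.
have tfunZ b t' : tfun f (b *: t') = b * tfun f t'.
  by rewrite -[b *: t']addr0 tfunP tfun0 addr0.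
rewrite !tfunB tfunZ !tfun_cons.
pose k := circ_coef y z - circ_coef z y.
have -> : tfun (ract z (ract y f)) t = k * tfun (ract (circ y z) f) t + tfun (ract y (ract z f)) t.
  rewrite -tfun_comb; apply: eq_tfun => l.
  by rewrite -ract_comm // subrK.
by rewrite -/k; ring.
Qed.

(** The derivation part of [ract] does not lengthen words, so a function
    supported in lengths at least the length of [w] is simply evaluated at [w].
    Such functions separate the multisets of letters of maximal length. *)
Lemma wfun_top w f : (forall l, (size l < size w)%N -> f l = 0) -> wfun w f = f w.
Proof.
elim: w f => [//|a w IH] f f0 /=.
have dl0 l : (size l <= size w)%N -> dl a f l = 0.
  move=> lw; rewrite /dl big_seq big1 // => z zl.
  rewrite f0 ?mulr0 //= size_rem //.
  by case: l lw zl => [//|x l] /= ; rewrite ltnS.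
rewrite IH => [|l lw]; rewrite /ract dl0 ?addr0 //; last exact: ltnW.
by rewrite f0.
Qed.

Local Notation fA := {malg K[{fmonom g}]}.

Definition fwact (z : fA) (t : T) : T := lext (fun m : {fmonom g} => foldr rho t m) z.

Lemma fwactP t a z z' : fwact (a *: z + z') t = a *: fwact z t + fwact z' t.
Proof. exact: lext_linear. Qed.
Lemma fwact0 t : fwact 0 t = 0.
Proof. exact: (lin0 (fun a z z' => fwactP t a z z')). Qed.
Lemma fwactU m t : fwact << m >> t = foldr rho t m.
Proof. exact: lextU. Qed.
Lemma fwact_gen x t : fwact (fgen x) t = rho x t.
Proof. by rewrite fwactU fmU. Qed.
Lemma fwact1 t : fwact 1 t = t.
Proof. by rewrite fwactU fm1. Qed.

Lemma fwactPr z a t t' : fwact z (a *: t + t') = a *: fwact z t + fwact z t'.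
Proof.
elim/malg_lin_ind: z => [|b m z IH]; first by rewrite !fwact0 scaler0 addr0.
rewrite !fwactP IH !fwactU; set l : seq g := m.
suff -> : foldr rho (a *: t + t') l = a *: foldr rho t l + foldr rho t' l.
  by rewrite !scalerDr !scalerA mulrC addrACA.
by elim: l => [//|x l IHl] /=; rewrite IHl rhoP.
Qed.

Lemma fwactMU m z' t : fwact (<< m >> * z') t = fwact << m >> (fwact z' t).
Proof.
move eU: << m >> => U; elim/malg_lin_ind: z' => [|b m' z' IH].
  by rewrite mulr0 !fwact0 -eU fwactU; elim: (m : seq g) => //= x l <-; rewrite rho0r.
move eU' : << m' >> => U'.
have -> : U * (b *: U' + z') = b *: (U * U') + U * z'.
  by rewrite mulrDr -!mul_malgC !mulrA malgC_comm.
rewrite (fwactP t b (U * U')) (fwactP t b U') fwactPr IH; suff -> : fwact (U * U') t = fwact U (fwact U' t) by [].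
rewrite -eU -eU' malgM_def fgmulUU mul1r !fwactU.
by rewrite -foldr_cat; congr foldr; rewrite /mmul /= fmmulE.
Qed.

Lemma fwactM z z' t : fwact (z * z') t = fwact z (fwact z' t).
Proof.
elim/malg_lin_ind: z => [|a m z IH]; first by rewrite mul0r !fwact0.
have := fwactMU m z' t; move: << m >> => U HU.
by rewrite mulrDl -scalerAl (fwactP t a (U * z')) (fwactP _ a U) HU IH.
Qed.

Lemma fwact_sum (J : Type) (s : seq J) (a : J -> K) (F : J -> fA) t :
  fwact (\sum_(j <- s) a j *: F j) t = \sum_(j <- s) a j *: fwact (F j) t.
Proof.
by rewrite /fwact (linear_sum (lext _)); apply: eq_bigr => j _; rewrite (linearZ_LR (lext _)).
Qed.

Lemma fwact_word w : fwact (\prod_(z <- w) fgen (w22_bas K (lidx z))) (wb [::]) = wb w.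
Proof.
elim: w => [|x w IH]; first by rewrite big_nil fwact1.
by rewrite big_cons fwactM IH fwact_gen rho_neg consTU.
Qed.

Lemma relT_fwact z t : relT t -> relT (fwact z t).
Proof.
move=> Nt; elim/malg_lin_ind: z => [|a m z IH]; first by rewrite fwact0; exact: RelT0.
rewrite fwactP; apply: RelTD => // {z IH}; rewrite fwactU.
by elim: (m : seq g) => //= x l; exact: relT_rho.
Qed.

Lemma relT_env z t : z \in ideal_gen (@env_relator K g) -> relT (fwact z t).
Proof.
pose P : {pred fA} := fun z => `[< forall t, relT (fwact z t) >].
have P_zmod : zmod_closed P.
  split; first by apply/asboolP => u; rewrite fwact0; exact: RelT0.
  move=> x y /asboolP Px /asboolP Py; apply/asboolP => u.
  by rewrite -scaleN1r addrC fwactP; exact: RelTD.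
have P_mull a x : x \in P -> a * x \in P.
  by move=> /asboolP Px; apply/asboolP => u; rewrite fwactM; exact: relT_fwact.
have P_mulr a x : x \in P -> x * a \in P.
  by move=> /asboolP Px; apply/asboolP => u; rewrite fwactM.
have fwactN x u : fwact (- x) u = - fwact x u.
  by have := fwactP u (-1) x 0; rewrite addr0 fwact0 addr0 !scaleN1r.
have fwactD x y u : fwact (x + y) u = fwact x u + fwact y u.
  by rewrite -[x]scale1r fwactP !scale1r.
move=> /asboolP /(_ (Ideal P_zmod P_mull P_mulr)) Pz.
suff /Pz/asboolP : forall y, env_relator y -> y \in Ideal P_zmod P_mull P_mulr by [].
move=> _ [a x y|x y]; apply/asboolP => u.
  rewrite fwactD fwactN fwactP !fwact_gen rhoDl subrr; exact: RelT0.
rewrite !(fwactD, fwactN, fwactM) !fwact_gen; exact: relT_defect.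
Qed.

(** An element of the free algebra that vanishes in the Verma module sends the
    empty word into the relations. *)
Lemma relT_verma z :
  (env_proj z : (U22 K)^o) \in submod_gen (verma_relator c h hW) -> relT (fwact z (wb [::])).
Proof.
pose P : {pred (U22 K)^o} :=
  fun x => `[< exists z, x = env_proj z /\ relT (fwact z (wb [::])) >].
have Pcl : submod_closed P.
  split; first by apply/asboolP; exists 0; rewrite fwact0 rmorph0; split=> //; exact: RelT0.
  move=> a x y /asboolP[x' [-> Nx]] /asboolP[y' [-> Ny]]; apply/asboolP.
  have [a' ->] : exists a', a = env_proj a' by exact: rproj_surj.
  exists (a' * x' + y'); split; first by rewrite rmorphD rmorphM.
  rewrite -[a' * x']scale1r fwactP scale1r fwactM; apply: relTA => //; exact: relT_fwact.
have fwactN x u : fwact (- x) u = - fwact x u.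
  by have := fwactP u (-1) x 0; rewrite addr0 fwact0 addr0 !scaleN1r.
have fwactD x y u : fwact (x + y) u = fwact x u + fwact y u.
  by rewrite -[x]scale1r fwactP !scale1r.
move=> /asboolP /(_ (Submodule Pcl)) Pz.
have /Pz/asboolP[z' [ezz' Nz']] : forall y, verma_relator c h hW y -> y \in Submodule Pcl.
  have sub0 X a : rho (w22_bas K X) (wb [::]) = a *: wb [::] ->
    ((env_in (w22_bas K X) - a%:A : U22 K) : (U22 K)^o) \in Submodule Pcl.
    move=> e; apply/asboolP; exists (fgen (w22_bas K X) - a *: 1); split.
      have -> : a%:A = env_proj (a *: 1) :> U22 K by rewrite env_projZ rmorph1.
      by rewrite env_inE -rmorphB.
    rewrite fwactD fwactN -[a *: 1]addr0 fwactP fwact0 addr0 fwact1 fwact_gen e subrr.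
    exact: RelT0.
  have pos X : rho (w22_bas K X) (wb [::]) = 0 ->
    (env_in (w22_bas K X) : (U22 K)^o) \in Submodule Pcl.
    by move=> e; have := sub0 X 0; rewrite !scale0r subr0; apply.
  move=> _ [n n0|n n0|||]; [apply: (pos (IL n))|apply: (pos (IW n))|
    apply: (sub0 IC)|apply: (sub0 (IL 0))|apply: (sub0 (IW 0))]; rewrite rho_basU //.
    by case: n n0 => //= n _; rewrite scale0r.
  by case: n n0 => //= n _; rewrite scale0r.
have -> : z = (z - z') + z' by rewrite subrK.
rewrite fwactD; apply: relTA => //; apply: relT_env.
by rewrite -rproj_eq0 raddfB subr_eq0; apply/eqP.
Qed.

End FreeVerma.

(** * Linear independence of the PBW vectors *)

Lemma seq_max (I : eqType) (s : seq I) (P : pred I) (r : I -> nat) :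
  has P s -> exists i, [/\ i \in s, P i & forall j, j \in s -> P j -> (r j <= r i)%N].
Proof.
move=> /hasP[i0 si0 Pi0]; pose B := (\max_(i <- s) r i)%N.
have rB i : i \in s -> (r i <= B)%N by move=> si; exact: leq_bigmax_seq.
have ex : exists k, has (fun i => P i && (r i == k)) s.
  exists (r i0); by apply/hasP; exists i0; rewrite ?Pi0 ?eqxx.
have ub k : has (fun i => P i && (r i == k)) s -> (k <= B)%N.
  by move=> /hasP[i si /andP[_ /eqP<-]]; exact: rB.
case: (ex_maxnP ex ub) => k /hasP[i si /andP[Pi /eqP ri]] mk.
exists i; split=> // j sj Pj; rewrite ri; apply: mk.
by apply/hasP; exists j; rewrite ?Pj ?eqxx.
Qed.

Section VermaFree.
Variables (K : fieldType) (c h hW : K).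
Local Notation g := (w22 K).
Local Notation T := {malg K[seq letter]}.

Definition wbas (w : seq letter) : T := locked << w >>.

Fact T_ind (P : T -> Prop) :
  P 0 -> (forall a w t, P t -> P (a *: wbas w + t)) -> forall t, P t.
Proof.
by move=> P0 PD; apply: malg_lin_ind => // a i y; have := PD a i y; rewrite /wbas -lock.
Qed.

Fact ext_wbas (M : lmodType K) (f : seq letter -> M) w : lext f (wbas w) = f w.
Proof. by rewrite /wbas -lock lextU. Qed.

Definition idx_word (i : pbw_idx) : seq letter :=
  [seq (true, m.-1) | m <- i.1] ++ [seq (false, n.-1) | n <- i.2].

Definition lift_mon (i : pbw_idx) : {malg K[{fmonom g}]} :=
  \prod_(z <- idx_word i) fgen (w22_bas K (lidx z)).

Lemma lift_monE i : is_pbw i -> env_proj (lift_mon i) = pbw_mon K i.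
Proof.
case: i => ms ns /andP[/andP[_ /allP pm] /andP[_ /allP pn]]; rewrite /lift_mon big_cat !big_map.
rewrite rmorphM !rmorph_prod; congr (_ * _).
  rewrite !big_seq; apply: eq_bigr => m /pm; case: m => // m _.
  exact/esym/(env_inE (bW K (Negz m))).
rewrite !big_seq; apply: eq_bigr => m /pn; case: m => // m _.
exact/esym/(env_inE (bL K (Negz m))).
Qed.

Lemma idx_word_perm i j : is_pbw i -> is_pbw j -> perm_eq (idx_word i) (idx_word j) -> i = j.
Proof.
have fW b (l : seq nat) b' : [seq z <- [seq (b, m.-1) | m <- l] | z.1 == b'] =
    if b == b' then [seq (b, m.-1) | m <- l] else [::] :> seq letter.
  by elim: l => [|m l /= ->]; case: (b == b').
have inj (b : bool) (l l' : seq nat) : part l -> part l' ->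
    perm_eq [seq (b, m.-1) | m <- l] [seq (b, m.-1) | m <- l'] -> l = l'.
  move=> /andP[sl /allP pl] /andP[sl' /allP pl'] /(perm_map snd).
  rewrite -!map_comp => /(perm_map S); rewrite -!map_comp => e.
  apply: (sorted_eq _ _ sl sl').
  - by move=> x y z; rewrite /geq /= => xy yz; exact: leq_trans yz xy.
  - by move=> x y /andP[xy yx]; apply/eqP; rewrite eqn_leq; apply/andP.
  have mS k : all (leq 1) k -> map (S \o (snd \o (fun m : nat => (b, m.-1)))) k = k.
    by move=> /allP pk; apply: map_id_in => -[|m] // /pk.
  by move: e; rewrite !mS //; apply/allP.
case: i j => ms ns [ms' ns'] /andP[pm pn] /andP[pm' pn'] e /=.
have eb b := perm_filter (fun z : letter => z.1 == b) e.
have := eb true; have := eb false; rewrite /idx_word !filter_cat !fW /= !cats0.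
by move=> /inj -> // /inj ->.
Qed.

(** Lift a vanishing combination to the free algebra and apply it to the empty
    word: this gives a combination of sorted words that lies in the relations.
    The indicator function of the multiset of a longest word with nonzero
    coefficient is symmetric, so it kills the relations; but on the combination
    it reads off exactly that coefficient. *)
Lemma pbw_free (s : seq pbw_idx) (a : pbw_idx -> K) : uniq s -> all is_pbw s ->
  lin_comb s a (fun i => pbw_mon K i *: vac c h hW) = 0 -> {in s, forall i, a i = 0}.
Proof.
move=> us /allP ps e0 i0 si0; apply/eqP; apply/negPn/negP => a0.
have /(seq_max (fun i => size (idx_word i)))[i [si ai0 mi]] : has (fun i => a i != 0) s.
  by apply/hasP; exists i0.
pose z : {malg K[{fmonom g}]} := \sum_(i <- s) a i *: lift_mon i.
have zE : env_proj z = \sum_(i <- s) a i *: pbw_mon K i.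
  rewrite /z rmorph_sum big_seq [RHS]big_seq; apply: eq_bigr => j js.
  by rewrite -lift_monE ?ps // -env_projZ.
have : (env_proj z : (U22 K)^o) \in submod_gen (verma_relator c h hW).
  rewrite -qproj_eq0 -e0 zE raddf_sum; apply/eqP; apply: eq_bigr => j _.
  rewrite /kscale scalerA mulr_algl /vac -linearZ; congr (qproj _ _).
  by rewrite [RHS]mulr1.
move=> /(relT_verma (fun M f => @lext_linear K _ M f) ext_wbas T_ind) Nz.
pose f (l : seq letter) : K := (perm_eq l (idx_word i))%:R.
have sf : symf f by move=> l l' ll'; rewrite /f (permPl ll').
have := tfun_rel (fun M f => @lext_linear K _ M f) ext_wbas T_ind sf Nz.
have -> : fwact c h hW wbas (fun M f => @lext K _ M f) z (wbas [::]) =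
          \sum_(j <- s) a j *: wbas (idx_word j).
  rewrite fwact_sum; apply: eq_bigr => j _; rewrite fwact_word //.
  - exact: lext_linear.
  - exact: ext_wbas.
  exact: T_ind.
have lin_tfun (r : seq pbw_idx) : tfun (fun M f => @lext K _ M f) f
    (\sum_(j <- r) a j *: wbas (idx_word j)) = \sum_(j <- r) a j * wfun (idx_word j) f.
  elim: r => [|j r IH]; first by rewrite !big_nil tfun0 //; exact: lext_linear.
  rewrite !big_cons tfunP; last exact: lext_linear.
  rewrite IH tfunU //; exact: ext_wbas.
rewrite lin_tfun (bigD1_seq i) //= big_seq_cond big1 => [|j /andP[js ji]].
  rewrite addr0 wfun_top; last first.
    by move=> l; rewrite /f; case: (boolP (perm_eq _ _)) => // /perm_size->; rewrite ltnn.
  by rewrite /f perm_refl mulr1 => /eqP; rewrite (negPf ai0).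
have [->|aj0] := eqVneq (a j) 0; first by rewrite mul0r.
rewrite wfun_top; last first.
  move=> l lj; rewrite /f; case: (boolP (perm_eq _ _)) => // /perm_size e.
  by move: lj; rewrite e ltnNge mi.
rewrite /f; case: (boolP (perm_eq _ _)) => [/idx_word_perm|]; last by rewrite mulr0.
by move=> e; move: ji; rewrite e ?eqxx // ps.
Qed.

End VermaFree.

(** * Enveloping algebra, scalars and words *)

Section KScale.
Variables (K : fieldType) (U : algType K) (M : lmodType U).
Implicit Types (a b : K) (x y : M) (u : U).

Definition ksc a x : M := (a%:A : U) *: x.
Local Notation "a •: x" := (ksc a x) (at level 40, left associativity).

Lemma kscale0l x : (0 : K) •: x = 0. Proof. by rewrite /ksc scale0r scale0r. Qed.
Lemma kscale0r a : a •: (0 : M) = 0. Proof. exact: scaler0. Qed.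
Lemma kscale1 x : (1 : K) •: x = x. Proof. by rewrite /ksc scale1r scale1r. Qed.
Lemma kscaleDr a x y : a •: (x + y) = a •: x + a •: y. Proof. exact: scalerDr. Qed.
Lemma kscaleDl a b x : (a + b) •: x = a •: x + b •: x.
Proof. by rewrite /ksc scalerDl scalerDl. Qed.
Lemma kscaleNl a x : (- a) •: x = - (a •: x).
Proof. by rewrite /ksc scaleNr scaleNr. Qed.
Lemma kscaleBr a x y : a •: (x - y) = a •: x - a •: y. Proof. exact: scalerBr. Qed.
Lemma kscaleA a b x : a •: (b •: x) = (a * b) •: x.
Proof. by rewrite /ksc scalerA -scalerAl mul1r scalerA. Qed.
Lemma kscale_act a u x : u *: (a •: x) = a •: (u *: x).
Proof. by rewrite /ksc !scalerA mulr_algl mulr_algr. Qed.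
Lemma kscale_algl a u x : (a *: u) *: x = a •: (u *: x).
Proof. by rewrite /ksc scalerA mulr_algl. Qed.
Lemma kscale_sum a (I : Type) (s : seq I) (F : I -> M) :
  a •: (\sum_(i <- s) F i) = \sum_(i <- s) a •: F i.
Proof. exact: scaler_sumr. Qed.

End KScale.

Notation "a •: x" := (ksc a x) (at level 40, left associativity) : ring_scope.

Section KSpan.
Variables (K : fieldType) (U : algType K) (M : lmodType U).

Inductive kspan (E : M -> Prop) : M -> Prop :=
| Kspan0 : kspan E 0
| KspanD a x y of E x & kspan E y : kspan E (a •: x + y).

Lemma kspan_in (E : M -> Prop) x : E x -> kspan E x.
Proof. by move=> Ex; rewrite -[x]kscale1 -[_ •: _]addr0; apply: KspanD => //; exact: Kspan0. Qed.

Lemma kspanP (E : M -> Prop) a x y : kspan E x -> kspan E y -> kspan E (a •: x + y).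
Proof.
move=> Ex Ey; elim: Ex => {x} [|b x z Ex _ IH]; first by rewrite kscale0r add0r.
by rewrite kscaleDr kscaleA -addrA; exact: KspanD.
Qed.
Lemma kspanA (E : M -> Prop) x y : kspan E x -> kspan E y -> kspan E (x + y).
Proof. by move=> Ex Ey; rewrite -[x]kscale1; exact: kspanP. Qed.
Lemma kspanZ (E : M -> Prop) a x : kspan E x -> kspan E (a •: x).
Proof. by move=> Ex; rewrite -[_ •: _]addr0; apply: kspanP => //; exact: Kspan0. Qed.

Lemma kspan_ind2 (E S : M -> Prop) : S 0 ->
  (forall a x y, S x -> S y -> S (a •: x + y)) -> (forall x, E x -> S x) ->
  forall x, kspan E x -> S x.
Proof. by move=> S0 SD ES x; elim=> {x} [//|a x y Ex _ Sy]; apply: SD => //; exact: ES. Qed.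

Lemma kspan_sub (E E' : M -> Prop) : (forall x, E x -> kspan E' x) ->
  forall x, kspan E x -> kspan E' x.
Proof. by apply: kspan_ind2 => [|a x y]; [exact: Kspan0|exact: kspanP]. Qed.

Lemma kspan_act (E E' : M -> Prop) u : (forall x, E x -> kspan E' (u *: x)) ->
  forall x, kspan E x -> kspan E' (u *: x).
Proof.
move=> EE'; apply: kspan_ind2 => [|a x y Sx Sy|//]; first by rewrite scaler0; exact: Kspan0.
by rewrite scalerDr kscale_act; exact: kspanP.
Qed.

End KSpan.

(** What is used of the enveloping algebra: generators, their commutation rules
    and the induction principle saying that they generate. *)
Record w22_alg (K : fieldType) := W22Alg {
  w22U :> algType K;
  gL : int -> w22U;
  gW : int -> w22U;
  gC : w22U;
  gLL : forall n m, gL n * gL m - gL m * gL n = (n - m)%:~R *: gL (n + m) + cocycle K n m *: gC;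
  gLW : forall n m, gL n * gW m - gW m * gL n = (n - m)%:~R *: gW (n + m) + cocycle K n m *: gC;
  gWW : forall n m, gW n * gW m = gW m * gW n;
  gLC : forall n, gL n * gC = gC * gL n;
  gWC : forall n, gW n * gC = gC * gW n;
  g_ind : forall P : w22U -> Prop, P 1 -> (forall a x y, P x -> P y -> P (a *: x + y)) ->
    (forall n x, P x -> P (gL n * x)) -> (forall n x, P x -> P (gW n * x)) ->
    (forall x, P x -> P (gC * x)) -> forall x, P x
}.
Arguments gL {K w}.
Arguments gW {K w}.
Arguments gC {K w}.

Section EnvInd.
Variable K : fieldType.
Local Notation g := (w22 K).
Local Notation U := (U22 K).

Definition ugen (X : w22_idx) : U := env_in (w22_bas K X).

Lemma env_genP (P : U -> Prop) :
  P 1 -> (forall a x y, P x -> P y -> P (a *: x + y)) ->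
  (forall X x, P x -> P (ugen X * x)) -> forall x, P x.
Proof.
move=> P1 PD PX.
have P0 : P 0 by have := PD (-1) 1 1 P1 P1; rewrite scaleN1r addNr.
have Pg (y : g) x : P x -> P (env_in y * x).
  move=> Px; elim/w22_ind: y => [|a i y IH]; first by rewrite linear0 mul0r.
  by rewrite linearP mulrDl -scalerAl; apply: PD => //; exact: PX.
have Pm (s : seq g) : P (env_proj << FMonom s >>).
  elim: s => [|y s IH].
    by have -> : << FMonom [::] >> = 1 :> {malg K[{fmonom g}]}; rewrite ?rmorph1 // -fmoneE.
  have -> : << FMonom (y :: s) >> = fgen y * << FMonom s >> :> {malg K[{fmonom g}]}.
    by rewrite malgM_def fgmulUU mul1r /mmul /= fmmulE fmuE.
  set A := << FMonom s >> in IH *.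
  have -> : env_proj (fgen y * A) = env_in y * env_proj A by rewrite env_inE -rmorphM.
  exact: Pg.
move=> x; have [z ->] : exists z, x = env_proj z by exact: rproj_surj.
elim/malg_lin_ind: z => [|a m z IH]; first by rewrite rmorph0.
have -> : env_proj (a *: << m >> + z) = a *: env_proj << m >> + env_proj z.
  by rewrite -env_projZ -rmorphD.
by apply: PD => //; rewrite -(fmK m).
Qed.

Lemma ugen_lie X Y : ugen X * ugen Y - ugen Y * ugen X = env_in (w22_brk K X Y).
Proof. by rewrite /ugen env_in_lie [lie _ _]w22_lie_basis. Qed.

Fact u22_WW n m : uW K n * uW K m = uW K m * uW K n.
Proof. by apply/eqP; rewrite -subr_eq0 uWW. Qed.
Fact u22_LC n : uL K n * uC K = uC K * uL K n.
Proof. by apply/eqP; rewrite -subr_eq0; apply/eqP; have := ugen_lie (IL n) IC; rewrite /= linear0. Qed.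
Fact u22_WC n : uW K n * uC K = uC K * uW K n.
Proof. by apply/eqP; rewrite -subr_eq0; apply/eqP; have := ugen_lie (IW n) IC; rewrite /= linear0. Qed.
Fact u22_ind (P : U -> Prop) : P 1 -> (forall a x y, P x -> P y -> P (a *: x + y)) ->
    (forall n x, P x -> P (uL K n * x)) -> (forall n x, P x -> P (uW K n * x)) ->
    (forall x, P x -> P (uC K * x)) -> forall x, P x.
Proof. by move=> P1 PD PL PW PC; apply: env_genP => // -[n|n|]; [exact: PL|exact: PW|exact: PC]. Qed.

Definition u22_alg : w22_alg K :=
  W22Alg (@uLL K) (@uLW K) u22_WW u22_LC u22_WC u22_ind.

End EnvInd.

Section Words.

(** From now on [(true, n)] stands for [W_{-n}] and [(false, n)] for [L_{-n}]; a
    word is meaningful if all its indices are positive ([okw]). *)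
Definition pword (i : pbw_idx) : seq letter := [seq (true, m) | m <- i.1] ++ [seq (false, n) | n <- i.2].
Definition okw (w : seq letter) := all (fun z => 0 < z.2)%N w.
Definition wW (w : seq letter) := count (fun z => z.1) w.
Definition wL (w : seq letter) := count (fun z => ~~ z.1) w.
Definition wt (w : seq letter) := sumn [seq z.2 | z <- w].
Definition wcanon (w : seq letter) : pbw_idx :=
  (sort geq [seq z.2 | z <- w & z.1], sort geq [seq z.2 | z <- w & ~~ z.1]).
Definition Ldeg (i : pbw_idx) := size i.2.
Definition iwt (i : pbw_idx) := (sumn i.1 + sumn i.2)%N.

Lemma wW_pword i : wW (pword i) = Wdeg i.
Proof.
case: i => ms ns; rewrite /wW /pword count_cat !count_map /Wdeg /=.
by rewrite (eq_count (a2 := xpredT)) // count_predT (eq_count (a2 := xpred0)) // count_pred0 addn0.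
Qed.
Lemma wL_pword i : wL (pword i) = Ldeg i.
Proof.
case: i => ms ns; rewrite /wL /pword count_cat !count_map /Ldeg /=.
by rewrite (eq_count (a2 := xpred0)) // count_pred0 (eq_count (a2 := xpredT)) // count_predT.
Qed.
Lemma wt_pword i : wt (pword i) = iwt i.
Proof. by rewrite /wt /pword map_cat sumn_cat -!map_comp /iwt; congr (sumn _ + sumn _)%N; exact: map_id. Qed.
Lemma okw_pword i : is_pbw i -> okw (pword i).
Proof.
case: i => ms ns /andP[/andP[_ pm] /andP[_ pn]].
by rewrite /okw /pword all_cat !all_map; apply/andP; split.
Qed.

Lemma pword_wcanon w : perm_eq (pword (wcanon w)) w.
Proof.
rewrite /pword /wcanon /=.
have e b : perm_eq [seq (b, m) | m <- sort geq [seq z.2 | z <- w & z.1 == b]] [seq z <- w | z.1 == b].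
  apply: (perm_trans (y := [seq (b, m) | m <- [seq z.2 | z <- w & z.1 == b]])).
    by apply: perm_map; rewrite perm_sort.
  rewrite -map_comp map_id_in // => z; rewrite mem_filter => /andP[/eqP<- _].
  by case: z.
apply: (perm_trans (y := [seq z <- w | z.1] ++ [seq z <- w | ~~ z.1])); last first.
  by apply: permEl; exact: perm_filterC.
apply: perm_cat.
  by have := e true; rewrite !(eq_filter (a2 := fun z => z.1)) // => -[[] n].
by have := e false; rewrite !(eq_filter (a2 := fun z => ~~ z.1)) // => -[[] n].
Qed.

Lemma okw_perm w w' : perm_eq w w' -> okw w = okw w'. Proof. exact: perm_all. Qed.
Lemma wW_perm w w' : perm_eq w w' -> wW w = wW w'. Proof. by move/permP; apply. Qed.
Lemma wL_perm w w' : perm_eq w w' -> wL w = wL w'. Proof. by move/permP; apply. Qed.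
Lemma wt_perm w w' : perm_eq w w' -> wt w = wt w'.
Proof. by move=> e; apply: perm_sumn; exact: perm_map. Qed.
Lemma Wdeg_wcanon w : Wdeg (wcanon w) = wW w.
Proof. by rewrite -wW_pword; apply: wW_perm; exact: pword_wcanon. Qed.
Lemma Ldeg_wcanon w : Ldeg (wcanon w) = wL w.
Proof. by rewrite -wL_pword; apply: wL_perm; exact: pword_wcanon. Qed.
Lemma iwt_wcanon w : iwt (wcanon w) = wt w.
Proof. by rewrite -wt_pword; apply: wt_perm; exact: pword_wcanon. Qed.

Lemma is_pbw_wcanon w : okw w -> is_pbw (wcanon w).
Proof.
have tot : total geq by move=> x y; exact: leq_total.
move=> okw_w; rewrite /is_pbw /part !sort_sorted //= !all_sort !all_map.
by apply/andP; split; apply/allP => z; rewrite mem_filter => /andP[_ /(allP okw_w)].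
Qed.

Lemma geq_sorted_eq (s t : seq nat) : sorted geq s -> sorted geq t -> perm_eq s t -> s = t.
Proof.
apply: sorted_eq => [x y z xy yz|x y /andP[xy yx]].
  exact: leq_trans yz xy.
by apply/eqP; rewrite eqn_leq; apply/andP.
Qed.

Lemma wcanon_perm w w' : perm_eq w w' -> wcanon w = wcanon w'.
Proof.
have tot : total geq by move=> x y; exact: leq_total.
move=> e; congr (_, _); apply: geq_sorted_eq; rewrite ?sort_sorted // perm_sort;
  by rewrite perm_sym perm_sort perm_sym; apply: perm_map; apply: perm_filter.
Qed.

Lemma wcanon_pword i : is_pbw i -> wcanon (pword i) = i.
Proof.
have tot : total geq by move=> x y; exact: leq_total.
case: i => ms ns /andP[/andP[sm _] /andP[sn _]]; rewrite /wcanon /pword !filter_cat !map_cat.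
have fE b (p : pred letter) (s : seq nat) : (forall n, p (b, n) = true) ->
    [seq z.2 | z <- [seq (b, n) | n <- s] & p z] = s.
  by move=> pb; elim: s => [//|x s /= IH]; rewrite pb /= IH.
have fE0 b (p : pred letter) (s : seq nat) : (forall n, p (b, n) = false) ->
    [seq z.2 | z <- [seq (b, n) | n <- s] & p z] = [::].
  by move=> pb; elim: s => [//|x s /= IH]; rewrite pb /= IH.
rewrite fE // fE0 // fE0 // fE // cats0.
by congr (_, _); apply: geq_sorted_eq; rewrite ?sort_sorted // perm_sort.
Qed.

End Words.

Section WordElements.
Variables (K : fieldType) (U : w22_alg K).

Definition ltr (z : letter) : U := if z.1 then gW (- z.2%:Z) else gL (- z.2%:Z).
Definition wd (w : seq letter) : U := \prod_(z <- w) ltr z.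
Definition pmon (i : pbw_idx) : U := wd (pword i).

Lemma wd_cons z w : wd (z :: w) = ltr z * wd w. Proof. exact: big_cons. Qed.
Lemma wd_cat w w' : wd (w ++ w') = wd w * wd w'. Proof. exact: big_cat. Qed.
Lemma wd_nil : wd [::] = 1. Proof. exact: big_nil. Qed.

End WordElements.
Arguments ltr {K U}.
Arguments wd {K U}.
Arguments pmon {K U}.

(** * Sorting words *)

Section Sorting.
Variable K : fieldType.
Variable U : w22_alg K.

Lemma cocycle_pos (n m : nat) : (0 < n)%N -> cocycle K (- n%:Z) (- m%:Z) = 0.
Proof. by rewrite /cocycle; case: eqP => //; lia. Qed.

(** Exchanging two letters costs one letter, which is a W-letter as soon as one of
    the two is. Two W-letters commute. So a correction keeps the number of
    W-letters and loses one L-letter. *)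
Lemma ltrC (a b : letter) : (0 < a.2)%N -> (0 < b.2)%N ->
  exists2 k : K, (ltr a : U) * ltr b = ltr b * ltr a + k *: ltr (a.1 || b.1, a.2 + b.2)%N
  & a.1 && b.1 -> k = 0.
Proof.
case: a b => [[] n] [[] m] /= n0 m0; rewrite /ltr /=.
- by exists 0 => //; rewrite scale0r addr0 gWW.
- exists (- (- m%:Z - - n%:Z)%:~R) => //; apply/eqP; rewrite addrC -subr_eq; apply/eqP.
  rewrite scaleNr -opprB (gLW U (- m%:Z)) cocycle_pos // scale0r addr0.
  by have -> : (- m%:Z + - n%:Z) = - (n + m)%N%:Z by lia.
- exists ((- n%:Z - - m%:Z)%:~R) => //; apply/eqP; rewrite addrC -subr_eq; apply/eqP.
  rewrite (gLW U (- n%:Z)) cocycle_pos // scale0r addr0.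
  by have -> : (- n%:Z + - m%:Z) = - (n + m)%N%:Z by lia.
exists ((- n%:Z - - m%:Z)%:~R) => //; apply/eqP; rewrite addrC -subr_eq; apply/eqP.
rewrite (gLL U (- n%:Z)) cocycle_pos // scale0r addr0.
by have -> : (- n%:Z + - m%:Z) = - (n + m)%N%:Z by lia.
Qed.

Variables (M : lmodType U) (m : M).

Definition sp (P : pred pbw_idx) : M -> Prop :=
  kspan (fun x => exists2 i, is_pbw i && P i & x = pmon i *: m).

Lemma spS (P Q : pred pbw_idx) x : (forall i, P i -> Q i) -> sp P x -> sp Q x.
Proof.
move=> PQ; apply: kspan_sub => {}x [i /andP[pi Pi] ->]; apply: kspan_in.
by exists i; rewrite ?pi ?PQ.
Qed.

Definition same w (i : pbw_idx) := (Wdeg i == wW w) && (iwt i == wt w).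
(** The indices of the corrections that sorting the word [w] may create. *)
Definition lows w (i : pbw_idx) := same w i && (Ldeg i < wL w)%N.

Lemma wd_perm_adj (n : nat) :
  (forall w, okw w -> (wL w < n)%N -> sp (fun i => same w i && (Ldeg i <= wL w)%N) (wd w *: m)) ->
  forall w w', perm_eq w w' -> okw w -> wL w = n -> sp (lows w) (wd w *: m - wd w' *: m).
Proof.
move=> IH.
have swap u a b t : okw (u ++ [:: a, b & t]) -> wL (u ++ [:: a, b & t]) = n ->
    sp (lows (u ++ [:: a, b & t])) (wd (u ++ [:: a, b & t]) *: m - wd (u ++ [:: b, a & t]) *: m).
  move=> okx wLx; have : okw (u ++ [:: a, b & t]) by [].
  rewrite /okw all_cat /= => /and4P[oku a0 b0 okt].
  have [k ek k0] := ltrC a0 b0.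
  have -> : wd (u ++ [:: a, b & t]) *: m - wd (u ++ [:: b, a & t]) *: m =
            k •: (wd (u ++ (a.1 || b.1, a.2 + b.2)%N :: t) *: m).
    rewrite -scalerBl -kscale_algl; congr (_ *: _).
    rewrite !wd_cat -mulrBr !wd_cons [ltr a * (_ * _)]mulrA ek mulrDl [ltr b * (_ * _)]mulrA.
    by rewrite addrC addKr -scalerAl -scalerAr.
  have [ab|nab] := boolP (a.1 && b.1); first by rewrite k0 // kscale0l; exact: Kspan0.
  apply: kspanZ; set y := u ++ _ :: t.
  have wLy : (wL y).+1 = n.
    rewrite -wLx /y /wL !count_cat /=; case: (a.1) nab => /=; case: (b.1) => //= _; lia.
  apply: spS (IH y _ _).
  - move=> i; rewrite /lows /same wLx -wLy ltnS => /andP[/andP[/eqP-> /eqP->] ->].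
    rewrite andbT /y /wW /wt !count_cat !map_cat !sumn_cat /=.
    by apply/andP; split; apply/eqP; case: (a.1) nab => /=; case: (b.1) => //= _; lia.
  - by rewrite /y /okw all_cat /= addn_gt0 a0 /=; apply/andP.
  by rewrite -wLy.
have spT w w' x : perm_eq w w' -> sp (lows w) x -> sp (lows w') x.
  move=> e; apply: spS => i; rewrite /lows /same.
  by rewrite (wW_perm e) (wt_perm e) (wL_perm e).
have move_elt s u a t : okw (u ++ a :: s ++ t) -> wL (u ++ a :: s ++ t) = n ->
    sp (lows (u ++ a :: s ++ t)) (wd (u ++ a :: s ++ t) *: m - wd (u ++ s ++ a :: t) *: m).
  elim: s u => [|b s IHs] u okx wLx; first by rewrite subrr; exact: Kspan0.
  have e1 : perm_eq (u ++ [:: a, b & s ++ t]) (rcons u b ++ a :: s ++ t).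
    by rewrite cat_rcons perm_cat2l; exact: permEl (perm_catCA [:: a] [:: b] _).
  have h1 := swap u a b (s ++ t) okx wLx.
  have := IHs (rcons u b); rewrite -(okw_perm e1) -(wL_perm e1) => /(_ okx wLx) h2.
  rewrite perm_sym in e1; have := kspanA h1 (spT _ _ _ e1 h2).
  by rewrite !cat_rcons addrA subrK.
move=> w w' e okx wLx; suff : forall u, okw (u ++ w) -> wL (u ++ w) = n ->
    sp (lows (u ++ w)) (wd (u ++ w) *: m - wd (u ++ w') *: m).
  by move=> /(_ [::] okx wLx).
elim: w w' e {okx wLx} => [|a w IHw] w' e u okx wLx.
  have /perm_size/size0nil -> : perm_eq w' [::] by rewrite perm_sym.
  by rewrite subrr; exact: Kspan0.
have aw' : a \in w' by rewrite -(perm_mem e) inE eqxx.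
case/splitPr: aw' e => s t e.
have e1 : perm_eq w (s ++ t).
  rewrite -(perm_cons a); apply: (perm_trans e); exact: permEl (perm_catCA s [:: a] t).
have h1 := IHw _ e1 (rcons u a).
rewrite !cat_rcons in h1; have {}h1 := h1 okx wLx.
have e2 : perm_eq (u ++ a :: w) (u ++ a :: s ++ t) by rewrite perm_cat2l perm_cons.
have := move_elt s u a t; rewrite -(okw_perm e2) -(wL_perm e2) => /(_ okx wLx) h2.
rewrite perm_sym in e2; have := kspanA h1 (spT _ _ _ e2 h2).
by rewrite addrA subrK.
Qed.

(** Triangularity of sorting: induction on the number of L-letters, since each
    exchange of neighbours only creates words with fewer of them. *)
Lemma wd_sort w : okw w -> sp (lows w) (wd w *: m - pmon (wcanon w) *: m).
Proof.
move: {-1}(wL w) (leqnn (wL w)) => n; elim/ltn_ind: n w => n IH w wLn okx.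
have ex := pword_wcanon w; rewrite perm_sym in ex.
rewrite /pmon; apply: (@wd_perm_adj (wL w)) => // x okx' wLx.
rewrite -[wd x *: m](subrK (pmon (wcanon x) *: m)); apply: kspanA.
  apply: spS (IH (wL x) (leq_trans wLx wLn) x (leqnn _) okx') => i /andP[-> /ltnW ->] //.
apply: kspan_in; exists (wcanon x) => //.
by rewrite is_pbw_wcanon // /same Wdeg_wcanon iwt_wcanon Ldeg_wcanon !eqxx leqnn.
Qed.

Lemma wd_span w : okw w -> sp (fun i => same w i && (Ldeg i <= wL w)%N) (wd w *: m).
Proof.
move=> okx; rewrite -[wd w *: m](subrK (pmon (wcanon w) *: m)); apply: kspanA.
  by apply: spS (wd_sort okx) => i /andP[-> /ltnW ->].
apply: kspan_in; exists (wcanon w) => //.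
by rewrite is_pbw_wcanon // /same Wdeg_wcanon iwt_wcanon Ldeg_wcanon !eqxx leqnn.
Qed.

End Sorting.

(** * Highest weight vectors and coordinates *)

Section HighestWeight.
Variables (K : fieldType) (U : w22_alg K) (c h hW : K).

Definition hwvec (M : lmodType U) (m : M) : Prop :=
  [/\ forall n : nat, (0 < n)%N -> gL n%:Z *: m = 0 /\ gW n%:Z *: m = 0,
      gC *: m = c •: m, gL 0 *: m = h •: m & gW 0 *: m = hW •: m].

Lemma gC_wd w : gC * wd w = wd w * gC :> U.
Proof.
elim: w => [|z w IH]; first by rewrite wd_nil mulr1 mul1r.
rewrite wd_cons mulrA; have -> : gC * ltr z = ltr z * gC :> U.
  by rewrite /ltr; case: ifP => _; rewrite ?gLC ?gWC.
by rewrite -mulrA IH mulrA.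
Qed.

Variables (M : lmodType U) (m : M).
Hypothesis hm : hwvec m.

Lemma gC_wdm w : gC *: (wd w *: m) = c •: (wd w *: m).
Proof. by have [_ Cm _ _] := hm; rewrite scalerA gC_wd -scalerA Cm kscale_act. Qed.

Lemma sp_ltr (P Q : pred pbw_idx) z : (0 < z.2)%N ->
  (forall i, P i -> forall j, same (z :: pword i) j -> (Ldeg j <= wL (z :: pword i))%N -> Q j) ->
  forall x, sp m P x -> sp m Q (ltr z *: x).
Proof.
move=> z0 PQ; apply: kspan_act => x [i /andP[pi Pi] ->].
rewrite scalerA -wd_cons; apply: spS (wd_span _ _) => [j /andP[]|]; first exact: PQ.
by apply/andP; split => //; exact: okw_pword.
Qed.

Lemma gL_wd n z w : gL n *: (wd (z :: w) *: m) =
  ltr z *: (gL n *: (wd w *: m)) +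
  ((n + z.2%:Z)%:~R •: ((if z.1 then gW (n - z.2%:Z) else gL (n - z.2%:Z)) *: (wd w *: m))
   + cocycle K n (- z.2%:Z) •: (gC *: (wd w *: m))).
Proof.
rewrite !scalerA wd_cons mulrA -[gL n * ltr z](subrK (ltr z * gL n)).
have -> : gL n * ltr z - ltr z * gL n = (n + z.2%:Z)%:~R *: (if z.1 then gW (n - z.2%:Z) else gL (n - z.2%:Z))
   + cocycle K n (- z.2%:Z) *: gC :> U.
  by rewrite /ltr; case: ifP => _; rewrite ?gLL ?gLW opprK.
by rewrite addrC !mulrDl !scalerDl -!scalerAl !kscale_algl.
Qed.


Lemma gW_wd n z w : gW n *: (wd (z :: w) *: m) =
  ltr z *: (gW n *: (wd w *: m)) +
  (if z.1 then 0 else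
   (n + z.2%:Z)%:~R •: (gW (n - z.2%:Z) *: (wd w *: m))
   + cocycle K n (- z.2%:Z) •: (gC *: (wd w *: m))).
Proof.
rewrite !scalerA wd_cons mulrA /ltr; case: ifP => _.
  by rewrite addr0 gWW.
rewrite -[gW n * gL _](subrK (gL (- z.2%:Z) * gW n)).
have -> : gW n * gL (- z.2%:Z) - gL (- z.2%:Z) * gW n = (n + z.2%:Z)%:~R *: gW (n - z.2%:Z)
   + cocycle K n (- z.2%:Z) *: gC :> U.
  rewrite -[LHS]opprB gLW opprD -!scaleNr cocycleN opprK [- _ + n]addrC; congr (_ *: _ + _).
  by rewrite -rmorphN; congr (_%:~R); ring.
by rewrite addrC !mulrDl !scalerDl -!scalerAl !kscale_algl.
Qed.

(** The span of the PBW monomials applied to a highest weight vector is stable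
    under every generator, since a nonnegative mode can be commuted to the right
    through the word. *)
Lemma hw_span u : sp m predT (u *: m).
Proof.
have [Xm Cm L0 W0] := hm.
have spC x : sp m predT x -> sp m predT (gC *: x).
  by apply: kspan_act => {}x [i pi ->]; rewrite gC_wdm; apply: kspanZ; apply: kspan_in; exists i.
have spz z x : (0 < z.2)%N -> sp m predT x -> sp m predT (ltr z *: x).
  by move=> z0; apply: sp_ltr.
have sp1 : sp m predT m.
  by apply: kspan_in; exists ([::], [::]) => //; rewrite /pmon wd_nil scale1r.
have pos n w : okw w -> sp m predT (gL n *: (wd w *: m)) /\ sp m predT (gW n *: (wd w *: m)).
  elim: w n => [|z w IH] n.
    move=> _; rewrite wd_nil scale1r; case: n => [[|n]|n].
    - by rewrite L0 W0; split; exact: kspanZ.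
    - by have [-> ->] := Xm n.+1 isT; split; exact: Kspan0.
    have e b : ltr (b, n.+1) = if b then gW (Negz n) else gL (Negz n) :> U by [].
    by rewrite -(e false) -(e true); split; apply: spz.
  move=> /andP[z0 okx]; rewrite gL_wd gW_wd.
  have spw : sp m predT (wd w *: m) by apply: spS (wd_span m okx).
  have [h1 h2] := IH n okx; have [h3 h4] := IH (n - z.2%:Z) okx.
  split; apply: kspanA; try exact: spz.
    by apply: kspanP; [case: (z.1)|apply: kspanZ; exact: spC].
  case: (z.1); first exact: Kspan0.
  by apply: kspanP => //; apply: kspanZ; exact: spC.
have posL n x : sp m predT x -> sp m predT (gL n *: x).
  by apply: kspan_act => {}x [i /andP[pi _] ->]; have [] := pos n _ (okw_pword pi).
have posW n x : sp m predT x -> sp m predT (gW n *: x).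
  by apply: kspan_act => {}x [i /andP[pi _] ->]; have [] := pos n _ (okw_pword pi).
elim/g_ind: u => [|a x y Sx Sy|n x Sx|n x Sx|x Sx].
- by rewrite scale1r.
- by rewrite scalerDl kscale_algl; exact: kspanP.
- by rewrite -scalerA; exact: posL.
- by rewrite -scalerA; exact: posW.
by rewrite -scalerA; exact: spC.
Qed.

End HighestWeight.

Section Coordinates.
Variables (K : fieldType) (U : algType K) (V : lmodType U).
Variables (I : eqType) (B : pred I) (e : I -> V).
Hypothesis e_span : forall x, kspan (fun y => exists2 i, B i & y = e i) x.
Hypothesis e_free : forall (s : seq I) (a : I -> K), uniq s -> all B s ->
  \sum_(i <- s) a i •: e i = 0 -> {in s, forall i, a i = 0}.

(** Coordinates in a basis given by a spanning and a freeness hypothesis; the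
    basis is indexed by the elements of [I] that satisfy [B]. *)
Definition is_crd (x : V) (f : I -> K) : Prop :=
  exists s, [/\ uniq s, all B s, forall i, i \notin s -> f i = 0 & x = \sum_(i <- s) f i •: e i].

Lemma sum_incl (s s' : seq I) (F : I -> V) : uniq s -> uniq s' -> {subset s <= s'} ->
  (forall i, i \notin s -> F i = 0) -> \sum_(i <- s') F i = \sum_(i <- s) F i.
Proof.
move=> us us' ss' F0; rewrite (bigID (mem s)) /= [X in _ + X]big1; last exact: F0.
rewrite addr0 -big_filter; apply: perm_big; apply: uniq_perm => //; first exact: filter_uniq.
by move=> i; rewrite mem_filter /=; case: (boolP (i \in s)) => // /ss'.
Qed.

Lemma is_crdP a x y f f' : is_crd x f -> is_crd y f' -> is_crd (a •: x + y) (fun i => a * f i + f' i).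
Proof.
move=> [s [us Bs s0 ->]] [s' [us' Bs' s0' ->]]; exists (undup (s ++ s')).
have sub1 : {subset s <= undup (s ++ s')} by move=> i; rewrite mem_undup mem_cat => ->.
have sub2 : {subset s' <= undup (s ++ s')}.
  by move=> i; rewrite mem_undup mem_cat => ->; rewrite orbT.
split; first exact: undup_uniq.
- by apply/allP => i; rewrite mem_undup mem_cat => /orP[/(allP Bs)|/(allP Bs')].
- by move=> i; rewrite mem_undup mem_cat negb_or => /andP[/s0-> /s0'->]; rewrite mulr0 addr0.
rewrite -(sum_incl us (undup_uniq _) sub1); last by move=> i /s0->; rewrite kscale0l.
rewrite -(sum_incl us' (undup_uniq _) sub2); last by move=> i /s0'->; rewrite kscale0l.
by rewrite kscale_sum -big_split; apply: eq_bigr => i _; rewrite kscaleDl kscaleA.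
Qed.

Lemma is_crd0 : is_crd 0 (fun=> 0).
Proof. by exists [::]; split=> //; rewrite big_nil. Qed.

Lemma is_crd_e i : B i -> is_crd (e i) (fun j => (i == j)%:R).
Proof.
move=> Bi; exists [:: i]; split=> //=; first by rewrite Bi.
  by move=> j; rewrite inE eq_sym => /negPf->.
by rewrite big_seq1 eqxx kscale1.
Qed.

Lemma is_crd_ex x : exists f, is_crd x f.
Proof.
elim: (e_span x) => [|a y {}x [i Bi ->] _ [f Hf]]; first by exists (fun=> 0); exact: is_crd0.
by exists (fun j => a * (i == j)%:R + f j); apply: is_crdP => //; exact: is_crd_e.
Qed.

Lemma is_crd_uniq x f f' : is_crd x f -> is_crd x f' -> f =1 f'.
Proof.
move=> Hf Hf' i; have := is_crdP (-1) Hf Hf'; rewrite kscaleNl kscale1 addNr.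
move=> [s [us Bs s0 /esym/e_free f0]]; apply/eqP; rewrite -subr_eq0 -oppr_eq0 opprB.
have [si|/s0] := boolP (i \in s); last by rewrite mulN1r addrC => ->.
by have := f0 us Bs i si; rewrite mulN1r addrC => ->.
Qed.

Definition crd (x : V) : I -> K := projT1 (cid (is_crd_ex x)).
Lemma crdP x : is_crd x (crd x). Proof. exact: projT2 (cid (is_crd_ex x)). Qed.

Lemma crdDl a x y i : crd (a •: x + y) i = a * crd x i + crd y i.
Proof. by have := is_crd_uniq (crdP _) (is_crdP a (crdP x) (crdP y)) i. Qed.
Lemma crd0 i : crd 0 i = 0.
Proof. exact: is_crd_uniq (crdP _) is_crd0 i. Qed.
Lemma crd_e i j : B i -> crd (e i) j = (i == j)%:R.
Proof. by move=> Bi; exact: is_crd_uniq (crdP _) (is_crd_e Bi) j. Qed.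
Lemma crdZ a x i : crd (a •: x) i = a * crd x i.
Proof. by have := crdDl a x 0 i; rewrite addr0 crd0 addr0. Qed.
Lemma crdD x y i : crd (x + y) i = crd x i + crd y i.
Proof. by have := crdDl 1 x y i; rewrite kscale1 mul1r. Qed.
Lemma crdN x i : crd (- x) i = - crd x i.
Proof. by have := crdZ (-1) x i; rewrite kscaleNl kscale1 mulN1r. Qed.
Lemma crdB x y i : crd (x - y) i = crd x i - crd y i.
Proof. by rewrite crdD crdN. Qed.
Lemma crd_sum (J : Type) (s : seq J) (F : J -> V) i :
  crd (\sum_(j <- s) F j) i = \sum_(j <- s) crd (F j) i.
Proof. by elim: s => [|j s IH]; rewrite ?big_nil ?crd0 // !big_cons crdD IH. Qed.

Definition csupp (x : V) : seq I := [seq i <- projT1 (cid (crdP x)) | crd x i != 0].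

Lemma csupp_uniq x : uniq (csupp x).
Proof. by rewrite /csupp; case: cid => s [us /= _ _ _]; exact: filter_uniq. Qed.
Lemma mem_csupp x i : (i \in csupp x) = (crd x i != 0).
Proof.
rewrite /csupp; case: cid => s [_ _ /= s0 _]; rewrite mem_filter.
case: (boolP (i \in s)) => [|/s0->]; by rewrite ?andbT // eqxx.
Qed.
Lemma csuppE x : x = \sum_(i <- csupp x) crd x i •: e i.
Proof.
rewrite /csupp; case: cid => s [us /= _ _ ex]; rewrite {1}ex big_filter [RHS]big_mkcond.
by apply: eq_bigr => i _; case: eqP => //= ->; rewrite kscale0l.
Qed.
Lemma crd_B x i : crd x i != 0 -> B i.
Proof.
case: (crdP x) => s [_ /allP Bs s0 _]; apply: contraR => nBi; apply/eqP/s0.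
by apply: contra nBi => /Bs.
Qed.

Lemma crd_inj x y : crd x =1 crd y -> x = y.
Proof.
move=> exy; apply/eqP; rewrite -subr_eq0 (csuppE (x - y)) big1 // => i _.
by rewrite crdB exy subrr kscale0l.
Qed.

Definition insupp (P : pred I) x : Prop := forall i, crd x i != 0 -> P i.

Lemma insupp0 P : insupp P 0. Proof. by move=> i; rewrite crd0 eqxx. Qed.
Lemma insuppP P a x y : insupp P x -> insupp P y -> insupp P (a •: x + y).
Proof.
move=> Px Py i; rewrite crdDl; have [->|/Px->//] := eqVneq (crd x i) 0.
by rewrite mulr0 add0r; exact: Py.
Qed.
Lemma insuppA P x y : insupp P x -> insupp P y -> insupp P (x + y).
Proof. by move=> Px; rewrite -[x]kscale1; exact: insuppP. Qed.
Lemma insuppZ P a x : insupp P x -> insupp P (a •: x).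
Proof. by move=> Px; rewrite -[_ •: _]addr0; apply: insuppP => //; exact: insupp0. Qed.
Lemma insuppN P x : insupp P x -> insupp P (- x).
Proof. by move=> Px; rewrite -[x]kscale1 -kscaleNl; exact: insuppZ. Qed.
Lemma insuppB P x y : insupp P x -> insupp P y -> insupp P (x - y).
Proof. by move=> Px Py; apply: insuppA => //; exact: insuppN. Qed.
Lemma insuppS (P Q : pred I) x : (forall i, P i -> Q i) -> insupp P x -> insupp Q x.
Proof. by move=> PQ Px i /Px/PQ. Qed.
Lemma insupp_e (P : pred I) i : B i -> P i -> insupp P (e i).
Proof. by move=> Bi Pi j; rewrite crd_e //; case: (eqVneq i j) => [<- //|_]; rewrite eqxx. Qed.
Lemma insupp_span (P : pred I) x :
  kspan (fun y => exists2 i, B i && P i & y = e i) x -> insupp P x.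
Proof.
apply: kspan_ind2 => [|a y z|y [i /andP[Bi Pi] ->]]; [exact: insupp0|exact: insuppP|].
exact: insupp_e.
Qed.

Definition restr (P : pred I) (x : V) : V := \sum_(i <- csupp x | P i) crd x i •: e i.

Lemma crd_restr P x i : crd (restr P x) i = if P i then crd x i else 0.
Proof.
rewrite /restr -big_filter crd_sum.
have E j : j \in [seq j <- csupp x | P j] -> crd (crd x j •: e j) i = crd x j * (j == i)%:R.
  by rewrite mem_filter mem_csupp => /andP[_ /crd_B Bj]; rewrite crdZ crd_e.
rewrite (eq_big_seq _ E) {E}.
have [il|il] := boolP (i \in [seq j <- csupp x | P j]).
  rewrite (bigD1_seq i il (filter_uniq _ (csupp_uniq _))) /= eqxx mulr1 big1 => [|j /negPf->].
    by move: il; rewrite addr0 mem_filter => /andP[->].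
  by rewrite mulr0.
rewrite big_seq big1 => [|j jl]; last first.
  by case: eqP => [ji|]; rewrite ?mulr0 //; move: il; rewrite -ji jl.
by move: il; rewrite mem_filter mem_csupp; case: ifP => //= _; rewrite negbK => /eqP.
Qed.

Lemma insupp_restr P x : insupp P (restr P x).
Proof. by move=> i; rewrite crd_restr; case: ifP => //; rewrite eqxx. Qed.
Lemma restr_id (P : pred I) x : insupp P x -> restr P x = x.
Proof.
move=> Px; apply: crd_inj => i; rewrite crd_restr; case: ifP => // /negP nPi.
by apply/esym/eqP/negPn/negP => /Px.
Qed.

End Coordinates.

(** * Leading terms of the positive modes *)

(** The properties that characterise the Verma module. The last one is its
    universal property, in the form that the annihilator of the vacuum kills every
    highest weight vector of the same weight. *)
Record vermaT (K : fieldType) (U : w22_alg K) (c h hW : K) := VermaT {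
  vmod :> lmodType U;
  vvac : vmod;
  vhw : hwvec c h hW vvac;
  vgen : forall x, exists u, x = u *: vvac;
  vfree : forall (s : seq pbw_idx) (a : pbw_idx -> K), uniq s -> all is_pbw s ->
    \sum_(i <- s) a i •: (pmon i *: vvac) = 0 -> {in s, forall i, a i = 0};
  vuniv : forall (M : lmodType U) (m : M) u, hwvec c h hW m -> u *: vvac = 0 -> u *: m = 0
}.
Arguments vvac {K U c h hW}.

Section Estimates.
Variables (K : fieldType) (U : w22_alg K) (c h hW : K) (V : vermaT U c h hW).
Local Notation v := (vvac V).

Definition pbwv (i : pbw_idx) : V := pmon i *: v.

Lemma ev_span (x : V) : kspan (fun y => exists2 i, is_pbw i & y = pbwv i) x.
Proof.
have [u ->] := vgen x; apply: kspan_sub (hw_span (vhw V) u) => y [i /andP[pi _] ->].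
by apply: kspan_in; exists i.
Qed.

Definition crdv : V -> pbw_idx -> K := crd ev_span.
Let ev_free := @vfree _ _ _ _ _ V.
(** The language in which all estimates below are expressed. *)
Definition supv (P : pred pbw_idx) (x : V) : Prop := forall i, crdv x i != 0 -> P i.

Lemma supv_sp P x : supv P x -> sp v P x.
Proof.
move=> Px; rewrite (csuppE ev_span x).
have : all (fun i => is_pbw i && P i) (csupp ev_span x).
  by apply/allP => i; rewrite mem_csupp => ci; rewrite (crd_B ci) Px.
elim: (csupp _ _) => [|i s IH] /=; first by rewrite big_nil => _; exact: Kspan0.
by rewrite big_cons => /andP[Pi /IH]; apply: KspanD; exists i.
Qed.

Lemma sp_supv P x : sp v P x -> supv P x.
Proof. exact: (insupp_span (e_span := ev_span) ev_free). Qed.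

Lemma supv0 P : supv P 0. Proof. exact: (insupp0 ev_free). Qed.
Lemma supvP P a x y : supv P x -> supv P y -> supv P (a •: x + y). Proof. exact: (insuppP ev_free). Qed.
Lemma supvA P x y : supv P x -> supv P y -> supv P (x + y). Proof. exact: (insuppA ev_free). Qed.
Lemma supvB P x y : supv P x -> supv P y -> supv P (x - y). Proof. exact: (insuppB ev_free). Qed.
Lemma supvZ P a x : supv P x -> supv P (a •: x). Proof. exact: (insuppZ ev_free). Qed.
Lemma supvN P x : supv P x -> supv P (- x). Proof. exact: (insuppN ev_free). Qed.
Lemma supvS (P Q : pred pbw_idx) x : (forall i, P i -> Q i) -> supv P x -> supv Q x.
Proof. exact: insuppS. Qed.
Lemma supv_ev (P : pred pbw_idx) i : is_pbw i -> P i -> supv P (pbwv i).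
Proof. exact: (insupp_e ev_free). Qed.

Lemma supv_act (P Q : pred pbw_idx) u x :
  (forall i, is_pbw i -> P i -> supv Q (u *: pbwv i)) -> supv P x -> supv Q (u *: x).
Proof.
move=> PQ /supv_sp; elim => {x} [|a x y [i /andP[pi Pi] ->] _ IH].
  by rewrite scaler0; exact: supv0.
by rewrite scalerDr kscale_act; apply: supvP => //; exact: PQ.
Qed.

Lemma wd_lows w : okw w -> supv (lows w) (wd w *: v - pbwv (wcanon w)).
Proof. by move=> okx; apply: sp_supv; exact: wd_sort. Qed.
Lemma wd_supv w : okw w -> supv (fun i => same w i && (Ldeg i <= wL w)%N) (wd w *: v).
Proof. by move=> okx; apply: sp_supv; exact: wd_span. Qed.

Lemma supv_wd (P Q : pred pbw_idx) w x : okw w ->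
  (forall i, P i -> forall j, same (w ++ pword i) j -> (Ldeg j <= wL w + Ldeg i)%N -> Q j) ->
  supv P x -> supv Q (wd w *: x).
Proof.
move=> okx PQ; apply: supv_act => i pi Pi; rewrite /pbwv scalerA -wd_cat.
apply: supvS (wd_supv _) => [j /andP[sj]|].
  rewrite /wL count_cat -/(wL w) -/(wL (pword i)) wL_pword; exact: PQ Pi j sj.
by rewrite /okw all_cat; apply/andP; split=> //; exact: okw_pword.
Qed.

Lemma same_cat w i j : same (w ++ pword i) j ->
  Wdeg j = (wW w + Wdeg i)%N /\ iwt j = (wt w + iwt i)%N.
Proof.
rewrite /same /wW /wt count_cat map_cat sumn_cat -/(wW _) -/(wt _) -/(wW (pword i)) -/(wt (pword i)).
by rewrite wW_pword wt_pword => /andP[/eqP-> /eqP->].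
Qed.

(** PBW vectors are ordered by W-degree, a lower one being more significant, and
    within a W-degree by the number of L-factors, a higher one being more
    significant. [lowp d l] collects what is strictly less significant than
    W-degree [d] with [l] L-factors. [lowq] is the same notion one W-degree
    lower, adapted to the modes [L_n], which can remove a W-factor. *)
Definition lowp d l (j : pbw_idx) := (d < Wdeg j)%N || ((Wdeg j == d) && (Ldeg j < l)%N).
Definition lowq d l (j : pbw_idx) := (d <= Wdeg j)%N || (((Wdeg j).+1 == d) && (Ldeg j < l)%N).

Lemma lowp_wd d l w x : okw w -> supv (lowp d l) x -> supv (lowp (wW w + d) (wL w + l)) (wd w *: x).
Proof.
move=> okx; apply: supv_wd => // i + j /same_cat[ej _] lj; rewrite /lowp ej.
by case/orP=> [di|/andP[/eqP di li]]; apply/orP; [left|right]; lia.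
Qed.
Lemma lowq_wd d l w x : okw w -> supv (lowq d l) x -> supv (lowq (wW w + d) (wL w + l)) (wd w *: x).
Proof.
move=> okx; apply: supv_wd => // i + j /same_cat[ej _] lj; rewrite /lowq ej.
by case/orP=> [di|/andP[/eqP di li]]; apply/orP; [left|right]; lia.
Qed.
Lemma Wge_wd d w x : okw w -> supv (fun i => d <= Wdeg i)%N x ->
  supv (fun i => wW w + d <= Wdeg i)%N (wd w *: x).
Proof.
by move=> okx; apply: supv_wd => // i + j /same_cat[ej _] lj; rewrite ej leq_add2l.
Qed.

(** [n * phi n] is the coefficient that appears when [W_n] meets [L_{-n}], or
    [L_n] meets [W_{-n}], on vectors where [W_0] acts by [hW]: it is
    [2 n hW + (n^3 - n) c / 12]. *)
Definition phi (n : nat) : K := 2 * hW + (n%:R ^+ 2 - 1) / 12 * c.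

Lemma cocycle_diag (n : nat) : cocycle K n%:Z (- n%:Z) = (n%:R ^+ 3 - n%:R) / 12.
Proof. by rewrite /cocycle opprK eqxx rmorphB rmorphXn. Qed.
Lemma cocycle_off (n : int) (a : nat) : n != a%:Z -> cocycle K n (- a%:Z) = 0.
Proof. by rewrite /cocycle opprK => /negPf->. Qed.

Lemma phi_eq (n : nat) : (n%:R + n%:R) * hW + (n%:R ^+ 3 - n%:R) / 12 * c = n%:R * phi n.
Proof. rewrite /phi; ring. Qed.

Lemma gC_v w : gC *: (wd w *: v) = c •: (wd w *: v).
Proof. exact: gC_wdm (vhw V) w. Qed.

Lemma gL0_wd w : gL 0 *: (wd w *: v) = (h + (wt w)%:R) •: (wd w *: v).
Proof.
elim: w => [|z w IH].
  by rewrite wd_nil scale1r addr0; have [] := vhw V.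
rewrite gL_wd IH kscale_act scalerA -wd_cons.
have -> : (if z.1 then gW (0 - z.2%:Z) else gL (0 - z.2%:Z)) = ltr z :> U by rewrite /ltr sub0r.
rewrite scalerA -wd_cons add0r /wt /= -/(wt w).
have -> : cocycle K 0 (- z.2%:Z) = 0.
  by rewrite /cocycle opprK; case: eqP => // _; rewrite expr0n subrr mulr0z mul0r.
rewrite kscale0l addr0 -kscaleDl natrD; congr (_ •: _).
by rewrite -addrA [(wt w)%:R + _]addrC.
Qed.

Lemma gL0_ev i : gL 0 *: pbwv i = (h + (iwt i)%:R) •: pbwv i.
Proof. by rewrite /pbwv gL0_wd wt_pword. Qed.

(** [W_0] is [hW] up to terms of higher W-degree, because commuting it through
    an L-letter turns that letter into a W-letter. *)
Lemma gW0_wd w : okw w -> supv (fun i => wW w < Wdeg i)%N (gW 0 *: (wd w *: v) - hW •: (wd w *: v)).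
Proof.
elim: w => [|z w IH].
  by move=> _; rewrite wd_nil scale1r; have [_ _ _ ->] := vhw V; rewrite subrr; exact: supv0.
move=> /andP[z0 okx]; rewrite gW_wd.
have -> : cocycle K 0 (- z.2%:Z) = 0 by rewrite cocycle_off //; lia.
rewrite kscale0l addr0 wd_cons -(scalerA (ltr z)) -(kscale_act hW (ltr z)) addrAC -scalerBr.
apply: supvA.
  have := @Wge_wd _ [:: z] _ _ (IH okx); rewrite wd_cons wd_nil mulr1 => H.
  apply: supvS (H _) => [i|]; first by rewrite /wW /=; lia.
  by rewrite /okw /= z0.
case ez : z.1; first exact: supv0.
apply: supvZ; have -> : gW (0 - z.2%:Z) = ltr (true, z.2) :> U by rewrite /ltr sub0r.
rewrite scalerA -wd_cons; apply: supvS (wd_supv _) => [i /andP[/andP[/eqP-> _] _]|].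
  by rewrite /wW /= ez.
by apply/andP.
Qed.

Definition pureL (w : seq letter) := all (fun z => ~~ z.1) w.
Definition pureW (w : seq letter) := all (fun z => z.1) w.

Lemma wW_pureL w : pureL w -> wW w = 0%N.
Proof. by elim: w => [//|z w IH] /= /andP[/negPf-> /IH]; rewrite /wW /= => ->. Qed.

Lemma lowp_ltr (a l : nat) x : (0 < a)%N -> supv (lowp 0 l.-1) x -> supv (lowp 0 l) (ltr (false, a) *: x).
Proof.
move=> a0; have -> : ltr (false, a) = wd [:: (false, a)] :> U by rewrite wd_cons wd_nil mulr1.
apply: supv_wd; first by rewrite /okw /= a0.
move=> i + j /same_cat[ej _]; rewrite /lowp ej /wW /wL /=; case/orP=> [->//|/andP[/eqP-> li]] lj.
apply/orP; right; lia.
Qed.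

Lemma supv_lead (w : seq letter) (P : pred pbw_idx) k x :
  okw w -> (forall i, lows w i -> P i) -> supv P (x - k •: (wd w *: v)) ->
  supv P (x - k •: pbwv (wcanon w)).
Proof.
move=> okx wP Px.
have -> : x - k •: pbwv (wcanon w) = (x - k •: (wd w *: v)) + k •: (wd w *: v - pbwv (wcanon w)).
  by rewrite kscaleBr; zmod.
by apply: supvA => //; apply: supvZ; apply: supvS (wd_lows okx).
Qed.

Lemma okw_rem z w : okw w -> okw (rem z w).
Proof. by move/allP=> okx; apply/allP => y /mem_rem/okx. Qed.

(** Moving [W_n] to the right through [L_{-a}] gives [W_{n-a}]. It creates a
    W-letter if [a > n], is again a positive mode acting on a shorter word if
    [a < n], and produces the scalar [n phi n] if [a = n]. Only the last case
    contributes to the leading term. *)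
Lemma gW_pureL (n : nat) w : (0 < n)%N -> okw w -> pureL w ->
  supv (lowp 0 (wL w).-1)
    (gW n%:Z *: (wd w *: v) - (n%:R * phi n * (count_mem (false, n) w)%:R) •: pbwv (wcanon (rem (false, n) w))).
Proof.
elim: w n => [|z w IH] n n0.
  move=> _ _; rewrite /= mulr0 kscale0l subr0 wd_nil scale1r.
  by have [/(_ n n0)[_ ->] _ _ _] := vhw V; exact: supv0.
move: z => [b a] okzw puzw; have /andP[/= a0 okx] := okzw; have /andP[/= bF puw] := puzw.
case: b okzw puzw bF => // _ _ _.
have wLz : (wL ((false, a) :: w)).-1 = wL w by rewrite /wL /=.
rewrite wLz gW_wd /=.
set k := n%:R * phi n; set r := rem (false, n) w.
have IHn := IH n n0 okx puw; set y := gW n%:Z *: _ in IHn *.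
(* the terms in which [W_n] passes through the first letter *)
have wLr : (0 < count_mem (false, n) w)%N -> (wL r).+1 = wL w.
  rewrite -has_count => /hasP[x xw /eqP ex]; rewrite ex in xw.
  by rewrite (wL_perm (perm_to_rem xw)).
have T1 : supv (lowp 0 (wL w)) (ltr (false, a) *: y
     - (k * (count_mem (false, n) w)%:R) •: pbwv (wcanon ((false, a) :: r))).
  have := lowp_ltr a0 IHn; rewrite scalerBr kscale_act /pbwv scalerA -wd_cons => H.
  have [c0|c0] := posnP (count_mem (false, n) w).
    by move: H; rewrite c0 mulr0 !kscale0l !subr0; apply: supvS => j; rewrite /lowp.
  set x1 := ltr _ *: y in H *.
  have okr : okw ((false, a) :: pword (wcanon r)).
    rewrite /okw /= a0; apply: okw_pword; apply: is_pbw_wcanon; exact: okw_rem.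
  have e1 : wcanon ((false, a) :: pword (wcanon r)) = wcanon ((false, a) :: r).
    by apply: wcanon_perm; rewrite perm_cons pword_wcanon.
  have := supv_lead okr _ H; rewrite e1; apply => j.
  rewrite /lows /lowp => /andP[/andP[/eqP-> _]].
  rewrite /wL /wW /= -/(wL _) -/(wW _) wL_pword wW_pword Ldeg_wcanon Wdeg_wcanon.
  have -> : wW r = 0%N.
    by apply: wW_pureL; apply/allP => y' /mem_rem; exact: (allP puw).
  by rewrite add1n wLr // => lj; apply/orP; right.
have lows_w j : lows w j -> lowp 0 (wL w) j.
  by rewrite /lows /lowp => /andP[/andP[/eqP-> _] ->]; rewrite wW_pureL // orbT.
have [an|an] := eqVneq a n.
  rewrite an !eqxx add1n -natr1 mulrDr mulr1 kscaleDl.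
  rewrite gC_v kscaleA cocycle_diag.
  have -> : n%:Z - n%:Z = 0 by rewrite subrr.
  set x0 := wd w *: v.
  have T2 : supv (lowp 0 (wL w)) ((n%:Z + n%:Z)%:~R •: (gW 0 *: x0) + ((n%:R ^+ 3 - n%:R) / 12 * c) •: x0
     - k •: pbwv (wcanon w)).
    apply: supv_lead => //; rewrite -/x0 /k -phi_eq.
    have -> : (n%:Z + n%:Z)%:~R = n%:R + n%:R :> K by rewrite rmorphD.
    rewrite [X in _ - X]kscaleDl opprD addrACA subrr addr0 -kscaleA -kscaleBr; apply: supvZ.
    by apply: supvS (gW0_wd okx) => j; rewrite wW_pureL // /lowp => ->.
  have T1' : supv (lowp 0 (wL w)) (ltr (false, n) *: y - (k * (count_mem (false, n) w)%:R) •: pbwv (wcanon w)).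
    rewrite an in T1; have [c0|c0] := posnP (count_mem (false, n) w).
      by move: T1; rewrite c0 mulr0 !kscale0l.
    rewrite -has_count in c0; have /hasP[x xw /eqP ex] := c0; rewrite ex in xw.
    by have := perm_to_rem xw; rewrite perm_sym => /wcanon_perm <-.
  have := supvA T1' T2; set X1 := _ •: pbwv _; set X2 := k •: pbwv _.
  congr supv; zmod.
have -> : (false, a) == (false, n) = false by rewrite xpair_eqE (negPf an).
rewrite add0n cocycle_off ?kscale0l ?addr0; last by apply: contra an => /eqP[->].
rewrite addrAC; apply: supvA => //; apply: supvZ.
have [lan|lna] := ltnP a n.
  have -> : n%:Z - a%:Z = (n - a)%N%:Z by lia.
  have n1 : (0 < n - a)%N by rewrite subn_gt0.
  have := IH _ n1 okx puw; set x1 := gW _ *: _ => H1.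
  rewrite -[x1](subrK (((n - a)%:R * phi (n - a) * (count_mem (false, (n - a)%N) w)%:R)
                      •: pbwv (wcanon (rem (false, (n - a)%N) w)))).
  apply: supvA; first by apply: supvS H1 => j; rewrite /lowp; lia.
  have [c0|c0] := posnP (count_mem (false, (n - a)%N) w).
    by rewrite c0 mulr0 kscale0l; exact: supv0.
  apply: supvZ; apply: supv_ev; first by apply: is_pbw_wcanon; exact: okw_rem.
  rewrite -has_count in c0; have /hasP[x xw /eqP ex] := c0; rewrite ex in xw.
  rewrite /lowp Wdeg_wcanon Ldeg_wcanon (wL_perm (perm_to_rem xw)).
  apply/orP; right; rewrite [X in (_ < X)%N]/wL /= add1n ltnSn andbT.
  by rewrite wW_pureL //; apply/allP => y' /mem_rem; exact: (allP puw).
have {}an : (n < a)%N by rewrite ltn_neqAle eq_sym an.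
have -> : gW (n%:Z - a%:Z) = ltr (true, (a - n)%N) :> U.
  by rewrite /ltr /=; congr gW; lia.
rewrite scalerA -wd_cons; apply: supvS (wd_supv _) => [j /andP[/andP[/eqP ej _] _]|].
  by rewrite /lowp ej /wW /=.
by apply/andP; rewrite /= subn_gt0.
Qed.

Definition Wl (s : seq nat) : seq letter := [seq (true, m) | m <- s].
Definition Ll (s : seq nat) : seq letter := [seq (false, m) | m <- s].

Lemma pureW_Wl s : pureW (Wl s). Proof. by rewrite /pureW all_map; apply/allP. Qed.
Lemma pureL_Ll s : pureL (Ll s). Proof. by rewrite /pureL all_map; apply/allP. Qed.

Lemma rem_letter b n (s : seq nat) : rem ((b, n) : letter) [seq (b, m) | m <- s] = [seq (b, m) | m <- rem n s].
Proof.
elim: s => [//|m s IH] /=; rewrite xpair_eqE eqxx /=; case: eqP => //= _.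
by rewrite IH.
Qed.
Lemma count_letter b n (s : seq nat) : count_mem ((b, n) : letter) [seq (b, m) | m <- s] = count_mem n s.
Proof. by rewrite count_map; apply: eq_count => m /=; rewrite xpair_eqE eqxx. Qed.

Lemma part_subseq (s t : seq nat) : subseq s t -> part t -> part s.
Proof.
move=> st /andP[sot /allP pt]; apply/andP; split; last first.
  by apply/allP => x /(mem_subseq st)/pt.
apply: (subseq_sorted _ st sot) => x y z xy yz; exact: leq_trans yz xy.
Qed.
Lemma is_pbw_remL i n : is_pbw i -> is_pbw (i.1, rem n i.2).
Proof. by move=> /andP[p1 p2]; apply/andP; split=> //=; apply: part_subseq p2; exact: rem_subseq. Qed.
Lemma is_pbw_remW i n : is_pbw i -> is_pbw (rem n i.1, i.2).
Proof. by move=> /andP[p1 p2]; apply/andP; split=> //=; apply: part_subseq p1; exact: rem_subseq. Qed.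
Lemma is_pbw_L i : is_pbw i -> is_pbw ([::], i.2).
Proof. by case/andP. Qed.
Lemma okw_Wl i : is_pbw i -> okw (Wl i.1).
Proof. by move=> /andP[/andP[_ p1] _]; rewrite /okw all_map. Qed.
Lemma okw_Ll i : is_pbw i -> okw (Ll i.2).
Proof. by move=> /andP[_ /andP[_ p1]]; rewrite /okw all_map. Qed.

Lemma ev_split i : pbwv i = wd (Wl i.1) *: pbwv ([::], i.2).
Proof. by rewrite /pbwv /pmon scalerA -wd_cat. Qed.

Lemma gW_pureW n w : pureW w -> gW n * wd w = wd w * gW n :> U.
Proof.
elim: w => [|z w IH]; first by rewrite wd_nil mulr1 mul1r.
by case/andP=> z1 /IH e; rewrite wd_cons mulrA /ltr z1 gWW -!mulrA e.
Qed.

(** First leading-term formula: [W_n] removes a factor [L_{-n}]. *)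
Lemma gW_ev (n : nat) i : (0 < n)%N -> is_pbw i ->
  supv (lowp (Wdeg i) (Ldeg i).-1)
    (gW n%:Z *: pbwv i - (n%:R * phi n * (count_mem n i.2)%:R) •: pbwv (i.1, rem n i.2)).
Proof.
move=> n0 pi; rewrite (ev_split i) (ev_split (_, rem n i.2)) /= scalerA gW_pureW ?pureW_Wl // -scalerA.
rewrite -kscale_act -scalerBr.
have := gW_pureL n0 (okw_Ll pi) (pureL_Ll _).
rewrite rem_letter count_letter; have -> : [seq (false, m) | m <- rem n i.2] = pword ([::], rem n i.2) by [].
rewrite wcanon_pword; last by apply: is_pbw_L (is_pbw_remL n pi).
move=> /(lowp_wd (okw_Wl pi)); apply: supvS => j; rewrite /lowp.
have -> : wW (Wl i.1) = Wdeg i by rewrite /wW count_map (eq_count (a2 := xpredT)) // count_predT.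
have -> : wL (Wl i.1) = 0%N by rewrite /wL count_map (eq_count (a2 := xpred0)) // count_pred0.
have -> : wL (Ll i.2) = Ldeg i by rewrite /wL count_map (eq_count (a2 := xpredT)) // count_predT.
by rewrite addn0.
Qed.

Lemma gL_pureL (n : nat) w : okw w -> pureL w ->
  supv (fun j => (Wdeg j == 0%N) && (Ldeg j <= wL w)%N) (gL n%:Z *: (wd w *: v)).
Proof.
elim: w n => [|z w IH] n.
  move=> _ _; rewrite wd_nil scale1r; have [Xv _ Lv _] := vhw V; case: n => [|n].
    rewrite Lv; apply: supvZ; have -> : v = pbwv ([::], [::]) by rewrite /pbwv /pmon wd_nil scale1r.
    exact: supv_ev.
  by have [-> _] := Xv n.+1 isT; exact: supv0.
move: z => [b a] okzw puzw; have /andP[/= a0 okx] := okzw; have /andP[/= bF puw] := puzw.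
case: b okzw puzw bF => // okzw puzw _.
rewrite -[(~~ false + wL w)%N]/((wL w).+1) gL_wd /= gC_v.
have spw u : okw u -> pureL u -> (wL u <= (wL w).+1)%N ->
    supv (fun j => (Wdeg j == 0%N) && (Ldeg j <= (wL w).+1)%N) (wd u *: v).
  move=> oku puu lu; apply: supvS (wd_supv oku) => j /andP[/andP[/eqP-> _] lj].
  by rewrite wW_pureL //= (leq_trans lj lu).
apply: supvA.
  have -> : ltr (false, a) = wd [:: (false, a)] :> U by rewrite wd_cons wd_nil mulr1.
  apply: supv_wd (IH n okx puw) => [|i /andP[/eqP i0 li] j /same_cat[-> _]].
    by rewrite /okw /= a0.
  by rewrite i0 /wL /wW /= => lj; rewrite (leq_trans lj) // addn0 add1n ltnS.
apply: supvA; last by apply: supvZ; apply: supvZ; apply: spw.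
apply: supvZ; have [la|la] := leqP a n.
  have -> : n%:Z - a%:Z = (n - a)%N%:Z by lia.
  by apply: supvS (IH (n - a)%N okx puw) => j /andP[-> /leqW ->].
have -> : gL (n%:Z - a%:Z) = ltr (false, (a - n)%N) :> U.
  by rewrite /ltr /=; congr gL; lia.
rewrite scalerA -wd_cons; apply: spw; first by apply/andP; rewrite /= subn_gt0.
  exact: puw.
by rewrite /wL /= add1n.
Qed.

(** Hence [W_n] either creates a W-factor or loses an L-factor. *)
Lemma gW_pureL_lowq (n : nat) w : (0 < n)%N -> okw w -> pureL w ->
  supv (lowq 1 (wL w)) (gW n%:Z *: (wd w *: v)).
Proof.
move=> n0 okx puw; have H := gW_pureL n0 okx puw.
set x := gW _ *: _ in H *; set k := _ * _ * _ in H.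
rewrite -[x](subrK (k •: pbwv (wcanon (rem (false, n) w)))); apply: supvA.
  by apply: supvS H => j; rewrite /lowp /lowq; lia.
have [c0|c0] := posnP (count_mem (false, n) w).
  by rewrite /k c0 mulr0 kscale0l; exact: supv0.
apply: supvZ; apply: supv_ev; first by apply: is_pbw_wcanon; exact: okw_rem.
rewrite -has_count in c0; have /hasP[y yw /eqP ey] := c0; rewrite ey in yw.
rewrite /lowq Wdeg_wcanon Ldeg_wcanon (wL_perm (perm_to_rem yw)).
apply/orP; right; rewrite [X in (_ < X)%N]/wL /= add1n ltnSn andbT.
by rewrite wW_pureL //; apply/allP => y' /mem_rem; exact: (allP puw).
Qed.

(** Symmetrically, [L_n] meeting the W-letter [W_{-a}] leaves [W_{n-a}], hence
    keeps the W-degree if [a > n], and lowers it by one otherwise; then a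
    positive mode [W_{n-a}] loses an L-letter by [gW_pureL], so that only [a = n]
    keeps the number of L-letters. *)
Lemma gL_cat (n : nat) w t : (0 < n)%N -> okw (w ++ t) -> pureW w -> pureL t ->
  supv (lowq (wW w) (wL t))
    (gL n%:Z *: (wd (w ++ t) *: v)
     - (n%:R * phi n * (count_mem (true, n) w)%:R) •: pbwv (wcanon (rem (true, n) w ++ t))).
Proof.
move=> n0; elim: w => [|z w IH] okzw puzw put.
  rewrite /= mulr0 kscale0l subr0. 
  have H := @gL_pureL n t okzw put; apply: (supvS _ H) => j _.
  by rewrite /lowq.
move: z okzw puzw => [b a] okzw puzw; have /andP[/= a0 okx] := okzw; have /andP[/= bF puw] := puzw.
have bT : b = true by case: (b) bF.
rewrite bT {bF bT} in okzw puzw *.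
rewrite gL_wd; have := IH okx puw put.
set k := n%:R * phi n; set r := rem (true, n) w; set y := gL n%:Z *: _ => IHn.
have wWwt : wW (w ++ t) = wW w by rewrite /wW count_cat -!/(wW _) (wW_pureL put) addn0.
have wLw : wL w = 0%N by rewrite /wL; elim: (w) puw => [//|x w' IH'] /andP[] /= -> /IH' ->.
have wLwt : wL (w ++ t) = wL t by rewrite /wL count_cat -!/(wL _) wLw.
have /andP[okw_w okt] : okw w && okw t by rewrite /okw -all_cat.
have T1 : supv (lowq (wW w).+1 (wL t)) (ltr (true, a) *: y
     - (k * (count_mem (true, n) w)%:R) •: pbwv (wcanon ((true, a) :: r ++ t))).
  have ok1 : okw [:: (true, a)] by rewrite /okw /= a0.
  have := lowq_wd ok1 IHn; rewrite wd_cons wd_nil mulr1 scalerBr kscale_act /pbwv scalerA -wd_cons => H.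
  have {}H : supv (lowq (wW w).+1 (wL t)) (ltr (true, a) *: y - k * (count_mem (true, n) w)%:R •:
         (wd ((true, a) :: pword (wcanon (r ++ t))) *: v)).
    by apply: supvS H => j; rewrite /lowq.
  have [c0|c0] := posnP (count_mem (true, n) w).
    by move: H; rewrite c0 mulr0 !kscale0l.
  have okr : okw ((true, a) :: pword (wcanon (r ++ t))).
    apply/andP; split=> //; apply: okw_pword; apply: is_pbw_wcanon.
    by rewrite /okw all_cat; apply/andP; split=> //; exact: okw_rem.
  have e1 : wcanon ((true, a) :: pword (wcanon (r ++ t))) = wcanon ((true, a) :: r ++ t).
    by apply: wcanon_perm; rewrite perm_cons pword_wcanon.
  have := supv_lead okr _ H; rewrite e1; apply => j.
  rewrite -has_count in c0; have /hasP[x xw /eqP ex] := c0; rewrite ex in xw.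
  have pr := perm_to_rem xw.
  rewrite /lows /lowq => /andP[/andP[/eqP-> _]].
  rewrite /wL /wW /= -!/(wL _) -!/(wW _) wL_pword wW_pword Ldeg_wcanon Wdeg_wcanon.
  rewrite (wW_perm pr) /wL /wW /= !count_cat -!/(wL _) -!/(wW _) (wW_pureL put).
  have -> : wL r = 0%N by move: wLw; rewrite (wL_perm pr).
  by rewrite !add1n !add0n addn0 => lj; apply/orP; right; rewrite eqxx.
rewrite -[(true + wW w)%N]/((wW w).+1); have [an|an] := eqVneq a n.
  rewrite an /= !eqxx add1n -natr1 mulrDr mulr1 kscaleDl gC_v kscaleA cocycle_diag.
  have -> : n%:Z - n%:Z = 0 by rewrite subrr.
  set x0 := wd (w ++ t) *: v.
  have T2 : supv (lowq (wW w).+1 (wL t)) ((n%:Z + n%:Z)%:~R •: (gW 0 *: x0) + ((n%:R ^+ 3 - n%:R) / 12 * c) •: x0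
     - k •: pbwv (wcanon (w ++ t))).
    apply: supv_lead => //; rewrite -/x0.
      by move=> j; rewrite /lows /lowq => /andP[/andP[/eqP-> _]]; rewrite wWwt wLwt eqxx orbC => ->.
    rewrite /k -phi_eq; have -> : (n%:Z + n%:Z)%:~R = n%:R + n%:R :> K by rewrite rmorphD.
    rewrite [X in _ - X]kscaleDl opprD addrACA subrr addr0 -kscaleA -kscaleBr; apply: supvZ.
    by apply: supvS (gW0_wd okx) => j; rewrite wWwt /lowq => ->.
  have T1' : supv (lowq (wW w).+1 (wL t)) (ltr (true, n) *: y
       - (k * (count_mem (true, n) w)%:R) •: pbwv (wcanon (w ++ t))).
    rewrite an in T1; have [c0|c0] := posnP (count_mem (true, n) w).
      by move: T1; rewrite c0 mulr0 !kscale0l.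
    rewrite -has_count in c0; have /hasP[x xw /eqP ex] := c0; rewrite ex in xw.
    have pr := perm_to_rem xw.
    have -> // : wcanon (w ++ t) = wcanon ((true, n) :: r ++ t).
    by apply: wcanon_perm; rewrite -cat_cons perm_cat2r.
  have := supvA T1' T2; set X1 := _ •: pbwv _; set X2 := k •: pbwv _.
  by congr supv; zmod.
have anF : (true, a) == (true, n) = false by rewrite xpair_eqE (negPf an).
rewrite /= anF add0n cocycle_off ?kscale0l ?addr0; last by apply: contra an => /eqP[->].
rewrite addrAC; apply: supvA => //; apply: supvZ.
have [lan|lna] := ltnP a n.
  have -> : n%:Z - a%:Z = (n - a)%N%:Z by rewrite subzn // ltnW.
  have n1 : (0 < n - a)%N by rewrite subn_gt0.
  rewrite wd_cat -scalerA scalerA gW_pureW // -scalerA.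
  have := lowq_wd okw_w (gW_pureL_lowq n1 okt put).
  by apply: supvS => j; rewrite /lowq wLw addn1 add0n.
have {}an : (n < a)%N by rewrite ltn_neqAle eq_sym an.
have -> : gW (n%:Z - a%:Z) = ltr (true, (a - n)%N) :> U.
  by rewrite /ltr /= -subzn ?opprB // ltnW.
rewrite scalerA -wd_cons; apply: supvS (wd_supv _) => [j /andP[/andP[/eqP ej _] _]|].
  rewrite /lowq ej -wWwt.
  by rewrite ltnSn.
by apply/andP; rewrite /= subn_gt0.
Qed.

(** Second leading-term formula: [L_n] removes a factor [W_{-n}]. *)
Lemma gL_ev (n : nat) i : (0 < n)%N -> is_pbw i ->
  supv (lowq (Wdeg i) (Ldeg i))
    (gL n%:Z *: pbwv i - (n%:R * phi n * (count_mem n i.1)%:R) •: pbwv (rem n i.1, i.2)).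
Proof.
move=> n0 pi; have := gL_cat n0 (w := Wl i.1) (t := Ll i.2) _ (pureW_Wl _) (pureL_Ll _).
rewrite rem_letter count_letter.
have -> : [seq (true, m) | m <- rem n i.1] ++ Ll i.2 = pword (rem n i.1, i.2) by [].
rewrite wcanon_pword; last exact: (is_pbw_remW n pi).
have -> : wW (Wl i.1) = Wdeg i by rewrite /wW count_map (eq_count (a2 := xpredT)) // count_predT.
have -> : wL (Ll i.2) = Ldeg i by rewrite /wL count_map (eq_count (a2 := xpredT)) // count_predT.
by apply; rewrite /okw all_cat; apply/andP; split; [exact: okw_Wl|exact: okw_Ll].
Qed.

End Estimates.

(** * Singular vectors modulo a submodule *)

Section Leading.
Variables (K : fieldType) (U : w22_alg K) (c h hW : K) (V : vermaT U c h hW).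
Local Notation v := (vvac V).
Local Notation ev := (pbwv V).
Local Notation phi := (phi c hW).

Let ev_free := @vfree _ _ _ _ _ V.
Let spanV := @ev_span _ _ _ _ _ V.
Lemma crdvDl a (x y : V) i : crdv (a •: x + y) i = a * crdv x i + crdv y i.
Proof. exact: (crdDl spanV ev_free). Qed.
Lemma crdv0 i : crdv (0 : V) i = 0. Proof. exact: (crd0 spanV ev_free). Qed.
Lemma crdvZ a (x : V) i : crdv (a •: x) i = a * crdv x i. Proof. exact: (crdZ spanV ev_free). Qed.
Lemma crdvD (x y : V) i : crdv (x + y) i = crdv x i + crdv y i. Proof. exact: (crdD spanV ev_free). Qed.
Lemma crdvB (x y : V) i : crdv (x - y) i = crdv x i - crdv y i. Proof. exact: (crdB spanV ev_free). Qed.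
Lemma crdv_ev i j : is_pbw i -> crdv (ev i) j = (i == j)%:R. Proof. exact: (crd_e spanV ev_free). Qed.
Lemma crdv_pbw (x : V) i : crdv x i != 0 -> is_pbw i. Proof. exact: crd_B. Qed.
Lemma crdv_inj (x y : V) : crdv x =1 crdv y -> x = y. Proof. exact: (crd_inj ev_free). Qed.
Lemma supv_crd0 P (x : V) i : supv P x -> ~~ P i -> crdv x i = 0.
Proof. by move=> Px nPi; apply/eqP; apply: contraR nPi; exact: Px. Qed.

(** Linear properties may be checked on the basis. *)
Lemma supv_ind (P : pred pbw_idx) (S : V -> Prop) : S 0 ->
  (forall a x y, S x -> S y -> S (a •: x + y)) ->
  (forall i, is_pbw i -> P i -> S (ev i)) -> forall x, supv P x -> S x.
Proof.
move=> S0 SD Se x /supv_sp; elim => {x} [//|a x y [i /andP[pi Pi] ->] _ Sy].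
by apply: SD => //; exact: Se.
Qed.

(** A most significant coordinate, for the order of [lowp]. *)
Lemma top_index (x : V) : x != 0 ->
  exists i0, crdv x i0 != 0 /\ supv (lowp (Wdeg i0) (Ldeg i0).+1) x.
Proof.
move=> z0; have [i1 ci1] : exists i, crdv x i != 0.
  apply: contrapT => H; case/eqP: z0; apply: crdv_inj => i; rewrite crdv0.
  by apply/eqP/negPn/negP => ci; apply: H; exists i.
pose s := csupp spanV x; have ms i : (i \in s) = (crdv x i != 0) by exact: mem_csupp.
pose D := (\max_(i <- s) Wdeg i)%N.
have DW i : i \in s -> (Wdeg i <= D)%N by move=> si; exact: leq_bigmax_seq.
have [i2 [si2 _ m2]] := @seq_max _ s xpredT (fun i => D - Wdeg i)%N
  ltac:(by apply/hasP; exists i1; rewrite ?ms).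
have dmin i : i \in s -> (Wdeg i2 <= Wdeg i)%N.
  by move=> si; have := m2 i si isT; have := DW i si; have := DW i2 si2; lia.
have [i0 [si0 /eqP di0 m0]] := @seq_max _ s (fun i => Wdeg i == Wdeg i2) Ldeg
   ltac:(by apply/hasP; exists i2; rewrite ?eqxx).
exists i0; rewrite -ms; split=> // i ci; have := dmin i; rewrite ms => /(_ ci).
rewrite leq_eqVlt /lowp di0 => /predU1P[di|->//]; rewrite -di eqxx ltnS /=; apply/orP; right.
by apply: m0; rewrite ?ms // -di.
Qed.

Definition ins (n : nat) (s : seq nat) := sort geq (n :: s).

Lemma total_geq : total geq. Proof. by move=> x y; exact: leq_total. Qed.

Lemma ins_rem n s : part s -> n \in s -> ins n (rem n s) = s.
Proof.
move=> /andP[ss _] ns; apply: geq_sorted_eq => //; first exact: (sort_sorted total_geq).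
by rewrite perm_sort perm_sym; exact: perm_to_rem.
Qed.
Lemma rem_ins n s : part s -> rem n (ins n s) = s.
Proof.
move=> /andP[ss _]; have ps : perm_eq (ins n s) (n :: s) by rewrite perm_sort.
have nins : n \in ins n s by rewrite (perm_mem ps) inE eqxx.
apply: geq_sorted_eq => //.
  apply: (subseq_sorted _ (rem_subseq _ _) (sort_sorted total_geq _)).
  by move=> x y z xy yz; exact: leq_trans yz xy.
rewrite -(perm_cons n); apply: perm_trans ps.
by rewrite perm_sym; exact: perm_to_rem.
Qed.
Lemma mem_ins n s : n \in ins n s.
Proof. by rewrite mem_sort inE eqxx. Qed.

Lemma supvW_lowp d l (x : V) n : (0 < n)%N -> supv (lowp d l) x -> supv (lowp d l.-1) (gW n%:Z *: x).
Proof.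
move=> n0; apply: supv_act => i pi Pi; have H := gW_ev (V := V) n0 pi.
set y := gW _ *: _ in H *; set k := _ * _ * _ in H.
rewrite -[y](subrK (k •: ev (i.1, rem n i.2))); apply: supvA.
  apply: supvS H => j; move: Pi; rewrite /lowp; lia.
have [c0|c0] := posnP (count_mem n i.2); first by rewrite /k c0 mulr0 kscale0l; exact: supv0.
apply: supvZ; apply: supv_ev; first exact: is_pbw_remL.
have s0 : (0 < size i.2)%N by case: (i.2) c0.
move: Pi; rewrite /lowp /Wdeg /Ldeg /= size_rem.
  move: (size i.1) (size i.2) s0 {H} => a b; clear; lia.
by rewrite -has_pred1 has_count.
Qed.

(** On the leading part of [x], taking the coordinate of [W_n x] at [j] is
    reading the coordinate of [x] with [L_{-n}] inserted in [j]. *)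
Lemma crd_gW n d l (x : V) j : (0 < n)%N -> supv (lowp d l.+1) x -> is_pbw j -> Wdeg j = d ->
  (Ldeg j).+1 = l ->
  crdv (gW n%:Z *: x) j = n%:R * phi n * (count_mem n (ins n j.2))%:R * crdv x (j.1, ins n j.2).
Proof.
move=> n0 Hx pj dj lj; move: x Hx; apply: supv_ind => [|a x y ex ey|i pi Pi].
- by rewrite scaler0 !crdv0 mulr0.
- by rewrite scalerDr kscale_act !crdvDl ex ey; ring.
have H := gW_ev (V := V) n0 pi; set y := gW _ *: _ in H *; set k := _ * _ * _ in H.
have nlow : ~~ lowp (Wdeg i) (Ldeg i).-1 j by move: Pi; rewrite /lowp; lia.
have -> : crdv y j = k * crdv (ev (i.1, rem n i.2)) j.
  by rewrite -crdvZ -[y in LHS](subrK (k •: ev (i.1, rem n i.2))) crdvD (supv_crd0 H) // add0r.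
rewrite !crdv_ev ?is_pbw_remL //.
have [c0|c0] := posnP (count_mem n i.2).
  rewrite /k c0 mulr0 mul0r; case: eqP => [ei|]; last by rewrite mulr0.
  by move: c0; rewrite ei /= => /eqP; rewrite -leqn0 leqNgt -has_count has_pred1 mem_ins.
rewrite -has_count has_pred1 in c0.
case: eqP => [<- /=|ne].
  have /andP[pi1 pi2] := pi.
  by rewrite !ins_rem // -surjective_pairing eqxx !mulr1.
rewrite mulr0; case: eqP => [ei|]; last by rewrite mulr0.
case: ne; rewrite ei /= rem_ins; first by case: (j).
by case/andP: pj.
Qed.

Lemma supvL_lowp d l (x : V) n : (0 < n)%N -> supv (lowp d.+1 l) x -> supv (lowp d l) (gL n%:Z *: x).
Proof.
move=> n0; apply: supv_act => i pi Pi; have H := gL_ev (V := V) n0 pi.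
set y := gL _ *: _ in H *; set k := _ * _ * _ in H.
rewrite -[y](subrK (k •: ev (rem n i.1, i.2))); apply: supvA.
  apply: supvS H => j; move: Pi; rewrite /lowp /lowq; lia.
have [c0|c0] := posnP (count_mem n i.1); first by rewrite /k c0 mulr0 kscale0l; exact: supv0.
apply: supvZ; apply: supv_ev; first exact: is_pbw_remW.
have s0 : (0 < size i.1)%N by case: (i.1) c0.
move: Pi; rewrite /lowp /Wdeg /Ldeg /= size_rem.
  move: (size i.1) (size i.2) s0 {H} => a b; clear; lia.
by rewrite -has_pred1 has_count.
Qed.

Lemma crd_gL n d l (x : V) j : (0 < n)%N -> supv (lowp d.+1 l.+1) x -> is_pbw j -> Wdeg j = d ->
  Ldeg j = l ->
  crdv (gL n%:Z *: x) j = n%:R * phi n * (count_mem n (ins n j.1))%:R * crdv x (ins n j.1, j.2).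
Proof.
move=> n0 Hx pj dj lj; move: x Hx; apply: supv_ind => [|a x y ex ey|i pi Pi].
- by rewrite scaler0 !crdv0 mulr0.
- by rewrite scalerDr kscale_act !crdvDl ex ey; ring.
have H := gL_ev (V := V) n0 pi; set y := gL _ *: _ in H *; set k := _ * _ * _ in H.
have nlow : ~~ lowq (Wdeg i) (Ldeg i) j by move: Pi; rewrite /lowp /lowq; lia.
have -> : crdv y j = k * crdv (ev (rem n i.1, i.2)) j.
  by rewrite -crdvZ -[y in LHS](subrK (k •: ev (rem n i.1, i.2))) crdvD (supv_crd0 H) // add0r.
rewrite !crdv_ev ?is_pbw_remW //.
have [c0|c0] := posnP (count_mem n i.1).
  rewrite /k c0 mulr0 mul0r; case: eqP => [ei|]; last by rewrite mulr0.
  by move: c0; rewrite ei /= => /eqP; rewrite -leqn0 leqNgt -has_count has_pred1 mem_ins.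
rewrite -has_count has_pred1 in c0.
case: eqP => [<- /=|ne].
  have /andP[pi1 pi2] := pi.
  by rewrite !ins_rem // -surjective_pairing eqxx !mulr1.
rewrite mulr0; case: eqP => [ei|]; last by rewrite mulr0.
case: ne; rewrite ei /= rem_ins; first by case: (j).
by case/andP: pj.
Qed.

Variable p : nat.
Hypothesis p0 : (0 < p)%N.
Hypothesis phi_neq0 : forall n, (0 < n)%N -> n != p -> n%:R * phi n != 0.
Hypothesis char0 : forall n, n.+1%:R != 0 :> K.

Lemma char0P n : (0 < n)%N -> n%:R != 0 :> K. Proof. by case: n. Qed.

(** Equivalently, no nonzero element of [N] has its leading part supported in
    [B]; the present form is the one to which [crd_gW] and [crd_gL] apply. *)
Definition leadfree (N : V -> Prop) (B : pred pbw_idx) := forall y d l, N y ->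
  supv (lowp d l.+1) y ->
  (forall j, Wdeg j = d -> Ldeg j = l -> crdv y j != 0 -> B j) -> supv (lowp d l) y.

(** A vector [z] that is singular modulo [N], reduced so as to be supported in
    [B], has leading part [L_{-p}^r]. Otherwise its leading part contains a factor
    [L_{-n}] or [W_{-n}] with [n != p]. Then [W_n], respectively [L_n], removes
    this factor with a nonzero coefficient, because [phi n != 0], and yields
    an element of [N] whose leading part lies in [B]. The factor [W_{-p}] is
    excluded by the hypothesis on [B]. *)
Lemma lead_sing (N : V -> Prop) (B : pred pbw_idx) (z : V) :
  leadfree N B -> (forall i n, B i -> B (i.1, rem n i.2) /\ B (rem n i.1, i.2)) ->
  (forall i, B i -> p \notin i.1) -> z != 0 -> supv B z ->
  (forall n, (0 < n)%N -> N (gL n%:Z *: z) /\ N (gW n%:Z *: z)) ->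
  exists r, crdv z ([::], nseq r p) != 0 /\
    forall i, crdv z i != 0 -> i <> ([::], nseq r p) -> (0 < Wdeg i)%N || (Ldeg i < r)%N.
Proof.
move=> NB Brem Bp z0 Bz Nz.
have [i0 [ci0 top0]] := top_index z0; pose d := Wdeg i0; pose l := Ldeg i0.
have zlow : supv (lowp d l.+1) z by [].
have di0 : Wdeg i0 = d by [].
pose s := csupp spanV z; have ms i : (i \in s) = (crdv z i != 0) by exact: mem_csupp.
have si0 : i0 \in s by rewrite ms.
have pbw i : i \in s -> is_pbw i by rewrite ms; exact: crdv_pbw.
have all_p i : i \in s -> Wdeg i = d -> Ldeg i = l -> i.2 = nseq l p.
  move=> si di li; suff H n : n \in i.2 -> n = p.
    by rewrite -li /Ldeg; apply/all_pred1P/allP => n /H ->; rewrite /= eqxx.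
  move=> ni; apply/eqP/negPn/negP => np.
  have n0 : (0 < n)%N by have /andP[_ /andP[_ /allP/(_ _ ni)]] := pbw i si.
  have l0 : (l.-1).+1 = l by rewrite -li /Ldeg; case: (i.2) ni.
  pose j : pbw_idx := (i.1, rem n i.2).
  have pj : is_pbw j by exact: is_pbw_remL (pbw i si).
  have ej : (j.1, ins n j.2) = i.
    by rewrite /j /= ins_rem //; [case: (i)|case/andP: (pbw i si)].
  have lj : Ldeg j = l.-1 by rewrite /Ldeg /j /= size_rem // -/(Ldeg i) li.
  have Hlow : supv (lowp d l.-1) (gW n%:Z *: z).
    have [_ Nn] := Nz n n0; apply: NB Nn _ _; rewrite ?l0.
      exact: supvW_lowp (n0) zlow.
    move=> j' dj' lj' cj'; have pj' := crdv_pbw cj'.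
    rewrite (crd_gW n0 zlow pj') ?lj' // in cj'.
    have Bj : B (j'.1, ins n j'.2).
      by apply: Bz; apply: contraNneq cj' => ->; rewrite mulr0.
    have := (Brem _ n Bj).1; rewrite /= rem_ins; first by case: (j').
    by case/andP: pj'.
  have : crdv (gW n%:Z *: z) j != 0.
    rewrite (crd_gW n0 zlow pj) ?lj // ej; apply: mulf_neq0; last by rewrite -ms.
    apply: mulf_neq0; first exact: phi_neq0.
    by apply: char0P; rewrite -has_count has_pred1 mem_ins.
  by move=> /Hlow; rewrite /lowp lj ltnn andbF orbF -di ltnn.
have d0 : d = 0%N.
  apply/eqP/negPn/negP; rewrite -lt0n => d0.
  have [m mi] : exists m, m \in i0.1.
    by move: d0; rewrite -di0 /Wdeg; case: (i0.1) => // m t _; exists m; rewrite inE eqxx.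
  have Bi0 : B i0 by apply: Bz; rewrite -ms.
  have mp : m != p by apply: contraNneq (Bp _ Bi0) => <-.
  have m00 : (0 < m)%N by have /andP[/andP[_ /allP/(_ _ mi)]] := pbw i0 si0.
  pose j : pbw_idx := (rem m i0.1, i0.2).
  have pj : is_pbw j by exact: is_pbw_remW (pbw i0 si0).
  have ej : (ins m j.1, j.2) = i0.
    by rewrite /j /= ins_rem //; [case: (i0)|case/andP: (pbw i0 si0)].
  have dj : Wdeg j = d.-1 by rewrite /Wdeg /j /= size_rem // -/(Wdeg i0) di0.
  have dd : (d.-1).+1 = d by case: (d) d0.
  rewrite -dd in zlow.
  have Hlow : supv (lowp d.-1 l) (gL m%:Z *: z).
    have [Nn _] := Nz m m00; apply: NB Nn _ _; first exact: supvL_lowp (m00) zlow.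
    move=> j' dj' lj' cj'; have pj' := crdv_pbw cj'.
    rewrite (crd_gL m00 zlow pj') ?lj' // in cj'.
    have Bj : B (ins m j'.1, j'.2).
      by apply: Bz; apply: contraNneq cj' => ->; rewrite mulr0.
    have := (Brem _ m Bj).2; rewrite /= rem_ins; first by case: (j').
    by case/andP: pj'.
  have : crdv (gL m%:Z *: z) j != 0.
    rewrite (crd_gL m00 zlow pj) // ej; apply: mulf_neq0; last by rewrite -ms.
    apply: mulf_neq0; first exact: phi_neq0.
    by apply: char0P; rewrite -has_count has_pred1 mem_ins.
  by move=> /Hlow; rewrite /lowp dj ltnn eqxx /= ltnn.
have W0 i : Wdeg i = 0%N -> i.1 = [::] by rewrite /Wdeg => /size0nil.
exists l; split.
  rewrite -ms; have -> // : ([::], nseq l p) = i0.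
  by rewrite [RHS]surjective_pairing (W0 i0) ?(all_p i0) // -?d0.
move=> i ci ne; have := zlow i ci; rewrite /lowp d0 => /orP[->//|/andP[/eqP di]].
rewrite ltnS leq_eqVlt => /predU1P[li|->]; last by rewrite orbT.
case: ne; rewrite [LHS]surjective_pairing (W0 i di) (all_p i) // ?ms //.
by rewrite di d0.
Qed.

Lemma ev_pword i (w : seq letter) : w = pword i -> ev i = wd w *: v.
Proof. by move=> ->. Qed.

Lemma ev_Lp r : ev ([::], nseq r p) = wd (nseq r (false, p)) *: v.
Proof. by apply: ev_pword; rewrite /pword /= map_nseq. Qed.

Lemma is_pbw_Lp r : is_pbw ([::], nseq r p).
Proof.
apply/andP; split=> //; apply/andP; split; last by apply/allP => x /nseqP[->].
by apply/(sortedP 0%N) => i; rewrite size_nseq => ir; rewrite !nth_nseq ir (ltnW ir) /geq /=.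
Qed.

Lemma okw_Lp r : okw (nseq r (false, p)).
Proof. by apply/allP => z /nseqP[-> _]. Qed.

Hypothesis phi_p : phi p = 0.

(** No term of W-degree zero appears: if [n != p] there is no factor [L_{-n}] to
    be removed, and if [n = p] the coefficient is [p phi p = 0]. *)
Lemma gW_Lp r n : (0 < n)%N -> supv (fun i => 0 < Wdeg i)%N (gW n%:Z *: (wd (nseq r (false, p)) *: v)).
Proof.
elim: r n => [|r IH] n n0.
  by rewrite wd_nil scale1r; have [/(_ n n0)[_ ->] _ _ _] := vhw V; exact: supv0.
rewrite -[nseq r.+1 _]/((false, p) :: nseq r (false, p)) gW_wd /= gC_v.
apply: supvA.
  have := @supv_wd _ _ _ _ _ V _ (fun i => 0 < Wdeg i)%N [:: (false, p)] _ _ _ (IH n n0).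
  rewrite wd_cons wd_nil mulr1; apply; first by rewrite /okw /= p0.
  by move=> i i0 j /same_cat[-> _] _.
have W1 (w : seq letter) : okw w -> (0 < wW w)%N -> supv (fun i => 0 < Wdeg i)%N (wd w *: v).
  by move=> okx w0; apply: supvS (wd_supv okx) => j /andP[/andP[/eqP-> _] _].
have [np|pn|->] := ltngtP n p.
- rewrite cocycle_off ?kscale0l ?addr0; last by apply/eqP; lia.
  have -> : gW (n%:Z - p%:Z) = ltr (true, (p - n)%N) :> U by rewrite /ltr /=; congr gW; lia.
  apply: supvZ; rewrite scalerA -wd_cons; apply: W1.
    by apply/andP; split; [rewrite /= subn_gt0|exact: okw_Lp].
  by rewrite /wW.
- rewrite cocycle_off ?kscale0l ?addr0; last by apply/eqP; lia.
  apply: supvZ; have -> : n%:Z - p%:Z = (n - p)%N%:Z by lia.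
  by apply: IH; rewrite subn_gt0.
have -> : p%:Z - p%:Z = 0 by rewrite subrr.
set x := wd _ *: v; rewrite cocycle_diag kscaleA.
have -> : (p%:Z + p%:Z)%:~R = p%:R + p%:R :> K by rewrite rmorphD.
have -> : (p%:R + p%:R) •: (gW 0 *: x) + ((p%:R ^+ 3 - p%:R) / 12 * c) •: x
   = (p%:R + p%:R) •: (gW 0 *: x - hW •: x).
  have := phi_eq c hW p; rewrite phi_p mulr0 => e.
  rewrite kscaleBr kscaleA -kscaleNl; congr (_ + _ •: x).
  by apply/eqP; rewrite -addr_eq0 addrC e.
apply: supvZ; apply: supvS (gW0_wd (okw_Lp r)) => j; exact: leq_ltn_trans.
Qed.

Lemma Wge_gW d (x : V) n : (0 < n)%N ->
  supv (fun i => d < Wdeg i)%N x -> supv (fun i => d < Wdeg i)%N (gW n%:Z *: x).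
Proof.
move=> n0 Hx; have := @supvW_lowp d 0 x n n0; move=> H.
apply: (supvS _ (H _)) => [i|]; first by rewrite /lowp ltn0 andbF orbF.
by apply: supvS Hx => i di; rewrite /lowp di.
Qed.

(** For a homogeneous [z], the whole part of W-degree zero is [L_{-p}^r]: another
    monomial of W-degree zero and the same weight has a factor [L_{-n}] with
    [n != p], which [W_n] would turn into a nonzero term of W-degree zero,
    while [L_{-p}^r] itself contributes nothing there by [gW_Lp]. *)
Lemma lead_exact (N : V -> Prop) (z : V) r :
  (forall y, N y -> supv (fun i => 0 < Wdeg i)%N y) ->
  (forall n, (0 < n)%N -> N (gW n%:Z *: z)) ->
  (forall i, crdv z i != 0 -> iwt i = (r * p)%N) ->
  forall i, crdv z i != 0 -> Wdeg i = 0%N -> i = ([::], nseq r p).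
Proof.
move=> N1 Nz wz i ci di.
pose s := csupp spanV z; have ms k : (k \in s) = (crdv z k != 0) by exact: mem_csupp.
apply: contrapT => /eqP ne.
have [i0 [si0 /andP[/eqP di0 ne0] m0]] :=
  @seq_max _ s (fun k => (Wdeg k == 0%N) && (k != ([::], nseq r p))) Ldeg
   ltac:(by apply/hasP; exists i; rewrite ?ms // di eqxx).
have ci0 : crdv z i0 != 0 by rewrite -ms.
have pi0 := crdv_pbw ci0.
have i01 : i0.1 = [::] by move: di0; rewrite /Wdeg => /size0nil.
have [n ni np] : exists2 n, n \in i0.2 & n != p.
  apply: contrapT => H; case/negP: ne0; apply/eqP.
  have e2 : i0.2 = nseq (size i0.2) p.
    apply/all_pred1P/allP => n ni /=; apply/negPn/negP => np; apply: H; exists n => //.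
  have : iwt i0 = (size i0.2 * p)%N by rewrite /iwt i01 {1}e2 sumn_nseq mulnC.
  rewrite wz // => /eqP; rewrite eqn_pmul2r // => /eqP er.
  by rewrite [LHS]surjective_pairing i01 e2 er.
have n0 : (0 < n)%N by have /andP[_ /andP[_ /allP/(_ _ ni)]] := pi0.
pose a := crdv z ([::], nseq r p); pose x := z - a •: ev ([::], nseq r p).
have cx k : crdv x k = if k == ([::], nseq r p) then 0 else crdv z k.
  rewrite /x crdvB crdvZ crdv_ev ?is_pbw_Lp // eq_sym.
  by case: eqP => [->|_]; rewrite ?mulr1 ?subrr // mulr0 subr0.
have xlow : supv (lowp 0 (Ldeg i0).+1) x.
  move=> k; rewrite cx; case: (eqVneq k) => [_|nk ck]; first by rewrite eqxx.
  have [dk|dk] := posnP (Wdeg k); last by apply/orP; left.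
  by apply/orP; right; rewrite dk eqxx ltnS m0 ?ms // dk eqxx nk.
have gx : supv (fun i => 0 < Wdeg i)%N (gW n%:Z *: x).
  rewrite /x scalerBr kscale_act; apply: supvB; first by apply: N1; exact: Nz.
  by apply: supvZ; rewrite ev_Lp; exact: gW_Lp.
pose j : pbw_idx := (i0.1, rem n i0.2).
have pj : is_pbw j by exact: is_pbw_remL.
have ej : (j.1, ins n j.2) = i0.
  by rewrite /j /= ins_rem //; [case: (i0)|case/andP: pi0].
have lj : (Ldeg j).+1 = Ldeg i0 by rewrite /Ldeg /j /= size_rem // prednK //; case: (i0.2) ni.
have : crdv (gW n%:Z *: x) j != 0.
  rewrite (crd_gW n0 xlow pj) // ej; apply: mulf_neq0; last by rewrite cx (negPf ne0).
  apply: mulf_neq0; first exact: phi_neq0.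
  by apply: char0P; rewrite -has_count has_pred1 mem_ins.
by move/gx; rewrite /j /Wdeg /= i01.
Qed.

(** A subspace, stable under the negative modes, that contains the submodule
    generated by the singular vector: it has no terms of W-degree zero, and none
    whose only W-factor is [W_{-m}] with [m < p]. It serves to name coordinates
    at which elements of the submodule vanish. *)
Definition inS (i : pbw_idx) := (1 < Wdeg i)%N || ((Wdeg i == 1%N) && (p <= head 0%N i.1)%N).

Lemma Wdeg1 i : Wdeg i = 1%N -> i = ([:: head 0%N i.1], i.2).
Proof. by case: i => [[|m [|]] mu]. Qed.

Lemma ev_W1 m mu : is_pbw ([:: m], mu) -> ev ([:: m], mu) = ltr (true, m) *: ev ([::], mu).
Proof. by move=> _; rewrite /pbwv scalerA -wd_cons. Qed.

Lemma crd_Wm m (x : V) m' nu : (0 < m)%N -> is_pbw ([::], nu) -> (0 < m')%N ->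
  crdv (ltr (true, m) *: x) ([:: m'], nu) = (m == m')%:R * crdv x ([::], nu).
Proof.
move=> m0 pnu m'0; have : supv xpredT x by []; move: x; apply: supv_ind => [|a x y ex ey|i pi _].
- by rewrite scaler0 !crdv0 mulr0.
- by rewrite scalerDr kscale_act !crdvDl ex ey; ring.
have [di|di] := posnP (Wdeg i).
  have i1 : i.1 = [::] by move: di; rewrite /Wdeg => /size0nil.
  have ei : i = ([::], i.2) by rewrite [LHS]surjective_pairing i1.
  have pi' : is_pbw ([:: m], i.2) by case/andP: pi => _ p2; apply/andP; rewrite /= /part /= m0.
  rewrite ei -ev_W1 // !crdv_ev //; last by rewrite -ei.
  by rewrite !xpair_eqE eqseq_cons eqxx !andbT; case: (m == m'); rewrite ?mul1r ?mul0r.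
rewrite crdv_ev // (_ : (i == _) = false) ?mulr0; last by apply/negP => /eqP ei; rewrite ei in di.
rewrite /pbwv scalerA -wd_cons; apply: supv_crd0 (wd_supv _) _.
  by apply/andP; split=> //; exact: okw_pword.
apply/negP => /andP[/andP[/eqP + _] _]; rewrite /Wdeg /= /wW /= -/(wW _) wW_pword.
by move: di; case: (Wdeg i).
Qed.

Lemma inS_W m (x : V) : (p <= m)%N -> supv inS (ltr (true, m) *: x).
Proof.
move=> pm; have m0 : (0 < m)%N by exact: leq_trans pm.
apply: (@supv_act _ _ _ _ _ V xpredT) => // i pi _.
have [di|di] := posnP (Wdeg i).
  have i1 : i.1 = [::] by move: di; rewrite /Wdeg => /size0nil.
  have pi' : is_pbw ([:: m], i.2) by case/andP: pi => _ p2; apply/andP; rewrite /= /part /= m0.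
  have ei : i = ([::], i.2) by rewrite [LHS]surjective_pairing i1.
  by rewrite ei -ev_W1 //; apply: supv_ev; rewrite // /inS /= pm.
rewrite /pbwv scalerA -wd_cons; apply: supvS (wd_supv _) => [j /andP[/andP[/eqP + _] _]|].
  by rewrite /inS => ->; rewrite /wW /= -/(wW _) wW_pword add1n ltnS di.
by apply/andP; split=> //; exact: okw_pword.
Qed.

Lemma ltr_LW a m (x : V) : (0 < a)%N ->
  ltr (false, a) *: (ltr (true, m) *: x) = ltr (true, m) *: (ltr (false, a) *: x)
    + (- a%:Z + m%:Z)%:~R •: (ltr (true, (a + m)%N) *: x).
Proof.
move=> a0; rewrite !scalerA -kscale_algl -scalerDl; congr (_ *: _).
apply/eqP; rewrite addrC -subr_eq; apply/eqP; rewrite /ltr /= gLW cocycle_pos // scale0r addr0 opprK.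
by congr (_ *: gW _); lia.
Qed.

Lemma inS_ltr z (x : V) : (0 < z.2)%N -> supv inS x -> supv inS (ltr z *: x).
Proof.
move=> z0; apply: supv_act => i pi /orP[di|/andP[/eqP/Wdeg1 ei pm]].
  rewrite /pbwv scalerA -wd_cons; apply: supvS (wd_supv _) => [j /andP[/andP[/eqP + _] _]|].
    rewrite /inS => ->; rewrite /wW /= -/(wW _) wW_pword; apply/orP; left.
    exact: leq_trans di (leq_addl _ _).
  by apply/andP; split=> //; exact: okw_pword.
have ee : ev i = ltr (true, head 0%N i.1) *: ev ([::], i.2) by rewrite {1}ei ev_W1 // -ei.
set m := head 0%N i.1 in ee pm.
case: z z0 => -[] n /= n0.
  by rewrite ee scalerA /ltr /= gWW -scalerA; exact: (@inS_W m).
rewrite ee ltr_LW //.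
apply: supvA; first exact: inS_W.
by apply: supvZ; apply: inS_W; apply: leq_trans pm _; exact: leq_addl.
Qed.

(** The usual computation in the Virasoro Verma module. *)
Lemma gL_Lp (r : nat) : gL p%:Z *: ev ([::], nseq r p) =
  (r%:R * (p%:R * (2 * h + (r%:R - 1) * p%:R + (p%:R ^+ 2 - 1) / 12 * c))) •: ev ([::], nseq r.-1 p).
Proof.
elim: r => [|r IH].
  rewrite mul0r kscale0l ev_Lp wd_nil scale1r.
  by have [/(_ p p0)[-> _] _ _ _] := vhw V.
rewrite ev_Lp -[nseq r.+1 _]/((false, p) :: nseq r (false, p)) gL_wd /= gC_v -ev_Lp IH.
have -> : p%:Z - p%:Z = 0 by rewrite subrr.
rewrite gL0_ev kscale_act cocycle_diag /iwt /= sumn_nseq.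
have -> : (p%:Z + p%:Z)%:~R = p%:R + p%:R :> K by rewrite rmorphD.
case: r IH => [|r] IH.
  rewrite /= mul0r kscale0l add0r !kscaleA -kscaleDl; congr (_ •: _); ring.
have -> : ltr (false, p) *: ev ([::], nseq r.+1.-1 p) = ev ([::], nseq r.+1 p).
  by rewrite -[nseq r.+1.-1 p]/(nseq r p) !ev_Lp scalerA -wd_cons.
rewrite !kscaleA -!kscaleDl natrM -[r.+2%:R]natr1; congr (_ •: _); ring.
Qed.

Lemma okpbw_W1 m r : (0 < m)%N -> is_pbw ([:: m], nseq r p).
Proof. by move=> m0; case/andP: (is_pbw_Lp r) => _ p2; apply/andP; rewrite /= /part /= m0. Qed.

(** For [n < p], the terms of W-degree one of [W_n L_{-p}^r v] have the single
    W-factor [W_{-m}] with [m >= p] except for one, obtained when [W_n]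
    commutes with one of the factors [L_{-p}] and nothing else happens. *)
Lemma gW_Lp_lin r n : (0 < n)%N -> (n < p)%N ->
  supv inS (gW n%:Z *: ev ([::], nseq r p) - (r%:R * (n + p)%N%:R) •: ev ([:: (p - n)%N], nseq r.-1 p)).
Proof.
move=> n0 np; have pn : (0 < p - n)%N by rewrite subn_gt0.
elim: r => [|r IH].
  rewrite mul0r kscale0l subr0 ev_Lp wd_nil scale1r.
  by have [/(_ n n0)[_ ->] _ _ _] := vhw V; exact: supv0.
rewrite ev_Lp -[nseq r.+1 _]/((false, p) :: nseq r (false, p)) gW_wd /= -ev_Lp.
rewrite cocycle_off ?kscale0l ?addr0; last by apply/eqP; lia.
have -> : gW (n%:Z - p%:Z) = ltr (true, (p - n)%N) :> U by rewrite /ltr /=; congr gW; lia.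
rewrite -ev_W1 ?okpbw_W1 // -natr1 mulrDl mul1r kscaleDl.
have -> : (n%:Z + p%:Z)%:~R = (n + p)%N%:R :> K by rewrite -PoszD.
rewrite opprD addrACA subrr addr0.
case: r IH => [|r] IH.
  rewrite mul0r kscale0l subr0 in IH *; rewrite ?subr0; exact: inS_ltr.
set y := gW _ *: _ in IH *; set k := _ * _; rewrite -/k in IH.
have e : ltr (false, p) *: ev ([:: (p - n)%N], nseq r p) =
    ev ([:: (p - n)%N], nseq r.+1 p) + (- p%:Z + (p - n)%N%:Z)%:~R •: (ltr (true, (p + (p - n))%N) *: ev ([::], nseq r p)).
  rewrite ev_W1 ?okpbw_W1 // ltr_LW // [in RHS]ev_W1 ?okpbw_W1 //; congr (_ + _).
  by rewrite !ev_Lp (scalerA (ltr (false, p))) -wd_cons.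
have -> : ltr (false, p) *: y - k •: ev ([:: (p - n)%N], nseq r.+1 p) =
    ltr (false, p) *: (y - k •: ev ([:: (p - n)%N], nseq r p)) +
    k •: ((- p%:Z + (p - n)%N%:Z)%:~R •: (ltr (true, (p + (p - n))%N) *: ev ([::], nseq r p))).
  by rewrite scalerBr kscale_act e kscaleDr; zmod.
apply: supvA; first exact: inS_ltr.
by do 2!apply: supvZ; apply: inS_W; exact: leq_addr.
Qed.

(** A term of W-degree one [W_{-m} y] contributes to the W-degree zero part of
    [L_p x] only through the commutator [(p + m) W_{p-m}] of [L_p] and [W_{-m}],
    with [m < p]. The same vector [W_{p-m} y] is seen in [W_n x] for [n = p - m],
    at the coordinates whose W-factor is [W_{-m}]. So the action of [L_p] on
    the terms of W-degree one is determined by that of the [W_n]. *)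
Lemma crd_gLp (x : V) nu : is_pbw ([::], nu) ->
  supv (fun i => (0 < Wdeg i)%N && (p \notin i.1)) x ->
  crdv (gL p%:Z *: x) ([::], nu) =
  \sum_(1 <= n < p) (p + (p - n))%N%:R * crdv (gW n%:Z *: x) ([:: (p - n)%N], nu).
Proof.
move=> pnu; move: x; apply: supv_ind => [|a x y ex ey|i pi /andP[di pi1]].
- rewrite scaler0 crdv0 big1_seq // => n _; by rewrite scaler0 crdv0 mulr0.
- rewrite scalerDr kscale_act crdvDl ex ey big_distrr -big_split; apply: eq_bigr => n _ /=.
  by rewrite scalerDr kscale_act crdvDl; ring.
have [d2|d1] := ltnP 1 (Wdeg i).
  rewrite (@supv_crd0 (lowp 0 0)) //; last first.
    by apply: supvL_lowp => //; apply: supv_ev => //; rewrite /lowp d2.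
  rewrite big_seq big1 // => n; rewrite mem_index_iota => /andP[n1 np].
  rewrite (@supv_crd0 (fun i => 1 < Wdeg i)%N) ?mulr0 //.
  by apply: Wge_gW => //; exact: supv_ev.
have /Wdeg1 ei : Wdeg i = 1%N by apply/eqP; rewrite eqn_leq d1.
set m := head 0%N i.1 in ei; set mu := i.2 in ei.
have m0 : (0 < m)%N by move: pi; rewrite ei => /andP[/andP[_ /=]]; rewrite andbT.
have pmu : is_pbw ([::], mu) by move: pi; rewrite ei => /andP[_ p2]; apply/andP.
have mp : m != p by apply: contraNneq pi1 => <-; rewrite ei inE.
have eE : ev i = ltr (true, m) *: ev ([::], mu) by rewrite {1}ei ev_W1 // -ei.
set y := ev ([::], mu) in eE.
have RHS n : (0 < n)%N -> (n < p)%N -> crdv (gW n%:Z *: ev i) ([:: (p - n)%N], nu) =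
    (m == p - n)%N%:R * crdv (gW n%:Z *: y) ([::], nu).
  move=> n0 np; rewrite eE scalerA {1}/ltr /= gWW -scalerA -[gW (- m%:Z)]/(ltr (true, m)).
  by rewrite crd_Wm // subn_gt0.
have LHS : crdv (gL p%:Z *: ev i) ([::], nu) =
    (p%:Z + m%:Z)%:~R * crdv (gW (p%:Z - m%:Z) *: y) ([::], nu).
  rewrite eE /y /pbwv (scalerA (ltr _)) -wd_cons gL_wd /= cocycle_off ?kscale0l ?addr0; last first.
    by apply: contra mp => /eqP[->].
  rewrite crdvD crdvZ (@supv_crd0 (fun i => 0 < Wdeg i)%N _ _) ?add0r //.
  have -> : ltr (true, m) = wd [:: (true, m)] :> U by rewrite wd_cons wd_nil mulr1.
  apply: (@Wge_wd _ _ _ _ _ V 0); first by rewrite /okw /= m0.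
  by [].
rewrite LHS; have [lmp|lpm] := ltnP m p; last first.
  have {}lpm : (p < m)%N by rewrite ltn_neqAle eq_sym mp.
  rewrite big_seq big1 => [|n]; last first.
    rewrite mem_index_iota => /andP[n1 np]; rewrite RHS //.
    by case: eqP => [e|_]; [lia|rewrite mul0r mulr0].
  have -> : gW (p%:Z - m%:Z) = ltr (true, (m - p)%N) :> U by rewrite /ltr /=; congr gW; lia.
  rewrite (@supv_crd0 (fun i => 0 < Wdeg i)%N _ _) ?mulr0 //.
  rewrite /y /pbwv scalerA -wd_cons; apply: supvS (wd_supv _) => [j /andP[/andP[/eqP -> _] _]//|].
  by apply/andP; split; [rewrite /= subn_gt0|exact: (okw_pword pmu)].
rewrite (bigD1_seq (p - m)%N) ?iota_uniq //=; last by rewrite mem_index_iota; lia.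
rewrite RHS ?subn_gt0 //; last by rewrite -[X in (_ < X)%N]subn0 ltn_sub2l.
have -> : (p - (p - m))%N = m by lia.
rewrite eqxx mul1r big_seq_cond big1 => [|n /andP[]]; last first.
  rewrite mem_index_iota => /andP[n1 np] nm; rewrite RHS //.
  by case: eqP => [e|_]; [case/eqP: nm; lia|rewrite mul0r mulr0].
have -> : p%:Z - m%:Z = (p - m)%N%:Z by lia.
by rewrite addr0 -PoszD.
Qed.

Lemma sum_quadratic (q : K) N : 6 * (\sum_(0 <= n < N) (q + (q - n%:R)) * (n%:R + q)) =
  12 * q ^+ 2 * N%:R + 3 * q * N%:R * (N%:R - 1) - (N%:R - 1) * N%:R * (2 * N%:R - 1).
Proof.
elim: N => [|N IH]; first by rewrite big_geq //; ring.
by rewrite big_nat_recr //= mulrDr IH -natr1; ring.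
Qed.

(** The value of [h] forced by a singular vector [z = a L_{-p}^r v + x] of the
    quotient, with [x] of positive W-degree. The coordinates of [W_n z], for
    [n < p], at [W_{n-p} L_{-p}^{r-1}] vanish, hence those of [W_n x] are known
    by [gW_Lp_lin]. The coordinate of [L_p z] at [L_{-p}^{r-1}] vanishes too;
    by [crd_gLp] it is the sum of the known contribution of [x] and of the
    Virasoro coefficient [gL_Lp]. This is a linear equation for [h]. *)
Lemma sing_h (z : V) r : (0 < r)%N ->
  supv (fun i => p \notin i.1) z -> crdv z ([::], nseq r p) != 0 ->
  (forall i, crdv z i != 0 -> Wdeg i = 0%N -> i = ([::], nseq r p)) ->
  (forall n, (0 < n)%N -> supv inS (gL n%:Z *: z) /\ supv inS (gW n%:Z *: z)) ->
  h = hW + (13 * p%:R + 1) * (p%:R - 1) / 12 + (1 - r%:R) * p%:R / 2.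
Proof.
move=> r0 Bz a0 zW0 Nz; set a := crdv z _ in a0.
set nu := nseq r.-1 p; have pnu : is_pbw ([::], nu) by exact: is_pbw_Lp.
pose x := z - a •: ev ([::], nseq r p).
have cx k : crdv x k = if k == ([::], nseq r p) then 0 else crdv z k.
  rewrite /x crdvB crdvZ crdv_ev ?is_pbw_Lp // eq_sym.
  by case: eqP => [->|_]; rewrite ?mulr1 ?subrr // mulr0 subr0.
have xP : supv (fun i => (0 < Wdeg i)%N && (p \notin i.1)) x.
  move=> k; rewrite cx; case: (eqVneq k) => [_|nk ck]; first by rewrite eqxx.
  rewrite Bz // andbT lt0n; apply: contra nk => /eqP dk.
  by apply/eqP; exact: zW0.
have ez : z = x + a •: ev ([::], nseq r p) by rewrite subrK.
have t n : (0 < n)%N -> (n < p)%N ->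
    crdv (gW n%:Z *: x) ([:: (p - n)%N], nu) = - (a * (r%:R * (n + p)%N%:R)).
  move=> n0 np; have [_ Sn] := Nz n n0.
  have H := @gW_Lp_lin r n n0 np; set k := _ * _ in H *.
  have nS : ~~ inS ([:: (p - n)%N], nu) by rewrite /inS /= -ltnNge; lia.
  have := supv_crd0 Sn nS; rewrite ez scalerDr kscale_act crdvD crdvZ.
  have := supv_crd0 H nS; rewrite crdvB crdvZ crdv_ev; last by apply: okpbw_W1; rewrite subn_gt0.
  rewrite eqxx mulr1 => /eqP; rewrite subr_eq0 => /eqP -> /eqP.
  by rewrite addr_eq0 => /eqP.
have [Sp _] := Nz p p0.
have nS : ~~ inS ([::], nu) by [].
have := supv_crd0 Sp nS; rewrite ez scalerDr kscale_act crdvD crdvZ crd_gLp // gL_Lp crdvZ.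
rewrite crdv_ev // eqxx mulr1.
have -> : \sum_(1 <= n < p) (p + (p - n))%N%:R * crdv (gW n%:Z *: x) ([:: (p - n)%N], nu)
   = - (a * r%:R) * \sum_(1 <= n < p) ((p%:R + (p%:R - n%:R)) * (n%:R + p%:R)).
  rewrite big_distrr big_seq [RHS]big_seq; apply: eq_bigr => n; rewrite mem_index_iota => /andP[n1 np] /=.
  rewrite t // !natrD natrB; last exact: ltnW.
  by ring.
have := sum_quadratic p%:R p; rewrite big_ltn // subr0 add0r.
set S := \sum_(1 <= n < p) _ => eS eq0.
have c2 : 2 != 0 :> K by exact: char0P.
have c3 : 3 != 0 :> K by exact: char0P.
have p0' : p%:R != 0 :> K by exact: char0P.
have r0' : r%:R != 0 :> K by exact: char0P.
have ephi : 2 * hW + (p%:R ^+ 2 - 1) / 12 * c = 0 := phi_p.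
have e1 : p%:R * (2 * h + (r%:R - 1) * p%:R + (p%:R ^+ 2 - 1) / 12 * c) = S.
  apply: (mulfI (mulf_neq0 a0 r0')); apply/eqP; rewrite -subr_eq0 -eq0; apply/eqP; ring.
have e2 : (p%:R ^+ 2 - 1) / 12 * c = - (2 * hW).
  by apply/eqP; rewrite -addr_eq0 addrC ephi.
rewrite e2 in e1.
have e3 : 6 * S = p%:R * (p%:R - 1) * (13 * p%:R + 1).
  by apply/eqP; rewrite -subr_eq0; apply/eqP; rewrite mulrDr in eS;
     move/eqP: eS; rewrite -subr_eq0 => /eqP eS; rewrite -[RHS]eS; ring.
have e4 : 6 * (2 * h + (r%:R - 1) * p%:R - 2 * hW) = (p%:R - 1) * (13 * p%:R + 1).
  by apply: (mulfI p0'); rewrite [RHS]mulrA -e3 -e1; ring.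
have c12 : 12 != 0 :> K by exact: char0P.
rewrite [(13 * p%:R + 1) * _]mulrC -e4; field.
by rewrite c2 c12.
Qed.

End Leading.

(** * The singular vector *)

Section SingularOperator.
Variables (K : fieldType) (U : w22_alg K) (c : K) (p : nat).
Hypothesis char0 : forall n, n.+1%:R != 0 :> K.
Hypothesis c0 : c != 0.
Hypothesis p0 : (0 < p)%N.

(** The singular vector is [u' = sum_(i = 1 .. p) W_{-i} a_{p-i} v], where the
    polynomials [a_k] in the [W_{-i}] are defined by [a_0 = 1] and
    [a_k = 6 / (c k (p - k)) * sum_(i = 1 .. k) W_{-i} a_{k-i}]. The
    coefficients are chosen so that [L_n], for [n > 0], maps [a_k v] to a
    multiple of [a_{k-n} v], see [gL_aop]. *)
Definition gam : K := 6 / c.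
Definition acoef (k : nat) : K := gam / (k%:R * (p%:R - k%:R)).

(** Course-of-values recursion: [avec k j] is [a_j] for [j <= k]. *)
Fixpoint avec (k : nat) : nat -> U :=
  if k is k'.+1 then fun j => if (j <= k')%N then avec k' j else
    acoef k *: \sum_(1 <= i < k.+1) gW (- i%:Z) * avec k' (k - i)%N
  else fun _ => 1.
Definition aop (k : nat) : U := avec k k.
Definition top (k : nat) : U := \sum_(1 <= i < k.+1) gW (- i%:Z) * aop (k - i)%N.
Definition uop : U := top p.

Lemma avecE k j : (j <= k)%N -> avec k j = aop j.
Proof.
elim: k => [|k IH]; first by rewrite leqn0 => /eqP->.
rewrite leq_eqVlt => /predU1P[-> //|]; rewrite ltnS => jk.
by rewrite /= jk IH.
Qed.

Lemma aopS k : aop k.+1 = acoef k.+1 *: top k.+1.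
Proof.
rewrite /aop /= ltnn; congr (_ *: _); apply: eq_big_nat => i /andP[i1 ik].
by rewrite avecE //; lia.
Qed.
Lemma top0 : top 0 = 0. Proof. by rewrite /top big_geq. Qed.

Lemma pk_neq0 k : (k < p)%N -> p%:R - k%:R != 0 :> K.
Proof. by move=> kp; rewrite -natrB ?(ltnW kp) // -(prednK (n := (p - k)%N)) ?subn_gt0. Qed.

Lemma gam_neq0 : gam != 0.
Proof. by rewrite mulf_neq0 ?invr_eq0 //; exact: (char0 5). Qed.

Lemma topE k : (k < p)%N -> top k = (k%:R * (p%:R - k%:R) / gam) *: aop k.
Proof.
case: k => [|k] kp; first by rewrite top0 !mul0r scale0r.
rewrite aopS scalerA /acoef -[LHS]scale1r; congr (_ *: _).
have x0 : k.+1%:R * (p%:R - k.+1%:R) != 0 :> K by rewrite mulf_neq0 ?pk_neq0.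
by rewrite mulrA divfK ?gam_neq0 // mulfV.
Qed.

Lemma gW_aop n k : gW n * aop k = aop k * gW n.
Proof.
elim/ltn_ind: k => -[|k] IH; first by rewrite mulr1 mul1r.
rewrite aopS -scalerAr -scalerAl; congr (_ *: _); rewrite big_distrr big_distrl /=.
apply: eq_big_nat => i /andP[i1 ik]; rewrite mulrA gWW -!mulrA IH //; lia.
Qed.

Lemma gW_top n k : gW n * top k = top k * gW n.
Proof.
rewrite big_distrr big_distrl /=; apply: eq_bigr => i _.
by rewrite mulrA gWW -!mulrA gW_aop.
Qed.

Lemma gC_aop k : gC * aop k = aop k * gC.
Proof.
elim/ltn_ind: k => -[|k] IH; first by rewrite mulr1 mul1r.
rewrite aopS -scalerAr -scalerAl; congr (_ *: _); rewrite big_distrr big_distrl /=.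
apply: eq_big_nat => i /andP[i1 ik]; rewrite mulrA -gWC -!mulrA IH //; lia.
Qed.

Lemma gC_top k : gC * top k = top k * gC.
Proof.
rewrite big_distrr big_distrl /=; apply: eq_bigr => i _.
by rewrite mulrA -gWC -!mulrA gC_aop.
Qed.

Variables (h hW : K).
Hypothesis hcp : 2 * hW + (p%:R ^+ 2 - 1) / 12 * c = 0.
Variables (M : lmodType U) (m : M).
Hypothesis hm : hwvec c h hW m.

Lemma top_m k : top k *: m = \sum_(1 <= i < k.+1) gW (- i%:Z) *: (aop (k - i)%N *: m).
Proof. by rewrite scaler_suml; apply: eq_bigr => i _; rewrite scalerA. Qed.

Lemma gL0_top k : (forall j, (j < k)%N -> gL 0 *: (aop j *: m) = (h + j%:R) •: (aop j *: m)) ->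
  gL 0 *: (top k *: m) = (h + k%:R) •: (top k *: m).
Proof.
move=> IH; rewrite top_m scaler_sumr kscale_sum; apply: eq_big_nat => i /andP[i1 ik].
rewrite scalerA -[gL 0 * _](subrK (gW (- i%:Z) * gL 0)) gLW sub0r opprK add0r.
rewrite cocycle_off ?scale0r ?addr0; last by apply/eqP; lia.
rewrite scalerDl kscale_algl -scalerA IH; last by lia.
rewrite kscale_act -kscaleDl; congr (_ •: _).
have -> : k = (i + (k - i))%N by lia.
by rewrite natrD addnC addnK; rewrite -[i%:~R]/(i%:R); ring.
Qed.

Lemma gL0_aop k : gL 0 *: (aop k *: m) = (h + k%:R) •: (aop k *: m).
Proof.
elim/ltn_ind: k => -[|k] IH; first by rewrite scale1r addr0; case: hm.
by rewrite aopS !kscale_algl kscale_act gL0_top // !kscaleA mulrC.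
Qed.

Lemma gW_pos_aop n k : (0 < n)%N -> gW n%:Z *: (aop k *: m) = 0.
Proof.
by move=> n0; rewrite scalerA gW_aop -scalerA; have [/(_ n n0)[_ ->] _ _ _] := hm; rewrite scaler0.
Qed.

(** The coefficient in [L_n a_k v = lcoef n k * a_{k-n} v]. *)
Definition lcoef (n k : nat) : K := (2 * (k%:R - n%:R) - p%:R - n%:R) / 2.

(** Commuting [L_n] through [W_{-i}] gives [W_{n-i}], which kills the vector for
    [i < n], gives [n phi n] for [i = n], and a term of the same shape for
    [i > n]. After the shift [i = n + j], the terms of the last kind combine
    with those where [L_n] acts on [a_{k-j}] into the coefficient
    [lcoef n (k - j) + 2 n + j], which does not depend on [j], so that the
    defining sum of [a_{k-n}] comes out. *)
Lemma gL_top n k : (0 < n)%N -> (k <= p)%N ->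
  (forall j, (j < k)%N -> gL n%:Z *: (aop j *: m) =
     if (n <= j)%N then lcoef n j •: (aop (j - n)%N *: m) else 0) ->
  gL n%:Z *: (top k *: m) = if (n <= k)%N then
     (n%:R * phi c hW n + ((k - n)%N%:R + (3 * n%:R - p%:R) / 2) * ((k - n)%N%:R * (p%:R - (k - n)%N%:R) / gam))
      •: (aop (k - n)%N *: m) else 0.
Proof.
move=> n0 kp IH; rewrite top_m scaler_sumr.
have E i : (0 < i)%N -> (i <= k)%N -> gL n%:Z *: (gW (- i%:Z) *: (aop (k - i)%N *: m)) =
    gW (- i%:Z) *: (gL n%:Z *: (aop (k - i)%N *: m)) +
    ((n%:Z + i%:Z)%:~R •: (gW (n%:Z - i%:Z) *: (aop (k - i)%N *: m))
     + (cocycle K n%:Z (- i%:Z) * c) •: (aop (k - i)%N *: m)).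
  move=> i0 ik; rewrite scalerA -[gL _ * _](subrK (gW (- i%:Z) * gL n%:Z)) gLW opprK.
  rewrite addrC !scalerDl !kscale_algl -scalerA; congr (_ + (_ + _)).
  rewrite scalerA gC_aop -scalerA; have [_ -> _ _] := hm.
  by rewrite kscale_act kscaleA.
have [nk|kn] := leqP n k; last first.
  rewrite big_nat big1 // => i /andP[i1 ik]; rewrite E // IH; last by lia.
  have -> : (n <= k - i)%N = false by lia.
  have -> : n%:Z - i%:Z = (n - i)%N%:Z by lia.
  rewrite scaler0 gW_pos_aop ?kscale0r; last by lia.
  rewrite cocycle_off; last by apply/eqP; lia.
  by rewrite mul0r kscale0l !addr0.
set kk := (k - n)%N.
(* the three ranges i < n, i = n, i > n of the structure constants *)
have S1 : \sum_(1 <= i < k.+1) gW (- i%:Z) *: (gL n%:Z *: (aop (k - i)%N *: m)) =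
    \sum_(1 <= i < kk.+1) lcoef n (k - i) •: (gW (- i%:Z) *: (aop (kk - i)%N *: m)).
  rewrite (big_cat_nat (n := kk.+1)) //=; last by rewrite /kk; lia.
  rewrite [X in _ + X]big_nat [X in _ + X]big1 ?addr0 => [|i /andP[i1 ik]]; last first.
    by rewrite IH; [have -> : (n <= k - i)%N = false by rewrite /kk in i1; lia|lia]; rewrite scaler0.
  apply: eq_big_nat => i /andP[i1 ik]; rewrite IH; last by lia.
  have -> : (n <= k - i)%N by rewrite /kk in ik; lia.
  by rewrite kscale_act; congr (_ •: (_ *: (aop _ *: m))); rewrite /kk; lia.
have S2 : \sum_(1 <= i < k.+1) ((n%:Z + i%:Z)%:~R •: (gW (n%:Z - i%:Z) *: (aop (k - i)%N *: m))
     + (cocycle K n%:Z (- i%:Z) * c) •: (aop (k - i)%N *: m)) =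
    (n%:R * phi c hW n) •: (aop kk *: m) +
    \sum_(1 <= i < kk.+1) (2 * n%:R + i%:R) •: (gW (- i%:Z) *: (aop (kk - i)%N *: m)).
  rewrite (big_cat_nat (n := n)) //=; last by lia.
  rewrite [X in X + _]big_nat [X in X + _]big1 ?add0r => [|i /andP[i1 ik]]; last first.
    have -> : n%:Z - i%:Z = (n - i)%N%:Z by lia.
    rewrite gW_pos_aop ?kscale0r; last by lia.
    rewrite cocycle_off; last by apply/eqP; lia.
    by rewrite mul0r kscale0l addr0.
  rewrite big_ltn //; congr (_ + _).
    have -> : n%:Z - n%:Z = 0 by rewrite subrr.
    rewrite -phi_eq kscaleDl cocycle_diag -/kk; congr (_ + _).
    rewrite scalerA gW_aop -scalerA; have [_ _ _ ->] := hm.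
    by rewrite kscale_act kscaleA rmorphD.
  have -> : n.+1 = (1 + n)%N by [].
  rewrite big_addn; have -> : (k.+1 - n)%N = kk.+1 by rewrite /kk; lia.
  apply: eq_big_nat => i /andP[i1 ik]; rewrite cocycle_off; last by apply/eqP; lia.
  rewrite mul0r kscale0l addr0.
  have -> : n%:Z - (i + n)%N%:Z = - i%:Z by lia.
  have -> : (k - (i + n))%N = (kk - i)%N by rewrite /kk; lia.
  congr (_ •: _); rewrite -PoszD -[(_)%:~R]/(_%:R) !natrD; ring.
have -> : \sum_(1 <= i < k.+1) gL n%:Z *: (gW (- i%:Z) *: (aop (k - i)%N *: m)) =
  \sum_(1 <= i < k.+1) gW (- i%:Z) *: (gL n%:Z *: (aop (k - i)%N *: m)) +
  \sum_(1 <= i < k.+1) ((n%:Z + i%:Z)%:~R •: (gW (n%:Z - i%:Z) *: (aop (k - i)%N *: m))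
     + (cocycle K n%:Z (- i%:Z) * c) •: (aop (k - i)%N *: m)).
  by rewrite -big_split; apply: eq_big_nat => i /andP[i1 ik]; rewrite E.
rewrite S1 S2 addrCA -big_split /= kscaleDl; congr (_ + _).
rewrite -kscaleA -kscale_algl -topE; last by rewrite /kk; lia.
rewrite top_m kscale_sum; apply: eq_big_nat => i /andP[i1 ik]; rewrite -kscaleDl; congr (_ •: _).
rewrite /lcoef; have ek : k%:R = kk%:R + n%:R :> K by rewrite /kk -natrD subnK.
have c2 : 2 != 0 :> K by exact: (char0 1).
rewrite natrB; last by rewrite /kk in ik; lia.
by rewrite ek; field.
Qed.

Lemma phi_val n : phi c hW n = (n%:R ^+ 2 - p%:R ^+ 2) / 12 * c.
Proof.
rewrite /phi; have -> : 2 * hW = - ((p%:R ^+ 2 - 1) / 12 * c) by apply/eqP; rewrite -addr_eq0 hcp.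
ring.
Qed.

Lemma inv_gam : gam^-1 = c / 6.
Proof. by rewrite /gam invf_div. Qed.

Lemma gL_aop n k : (0 < n)%N -> (k < p)%N -> gL n%:Z *: (aop k *: m) =
  if (n <= k)%N then lcoef n k •: (aop (k - n)%N *: m) else 0.
Proof.
move=> n0; elim/ltn_ind: k => -[|k] IH kp.
  by rewrite leqNgt n0 scale1r; have [/(_ n n0)[-> _] _ _ _] := hm.
rewrite aopS kscale_algl kscale_act gL_top //; last 2 first.
- exact: ltnW.
- by move=> j jk; apply: IH => //; exact: ltn_trans kp.
case: ifP => nk; last by rewrite kscale0r.
rewrite kscaleA; congr (_ •: _).
have x0 : k.+1%:R * (p%:R - k.+1%:R) != 0 :> K by rewrite mulf_neq0 ?pk_neq0.
have c2 : 2 != 0 :> K by exact: (char0 1).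
have c12 : 12 != 0 :> K by exact: (char0 11).
have c6 : 6 != 0 :> K by exact: (char0 5).
rewrite phi_val /acoef mulrAC; apply: (canLR (mulfK x0)).
rewrite inv_gam /gam natrB // /lcoef; move: (k.+1%:R) => kk.
by field; rewrite c2 c6 c12 c0.
Qed.

(** At [k = p] the recursion would divide by zero; instead the right-hand side
    itself is singular, since the coefficient found in [gL_top] vanishes at
    [k = p] by the hypothesis on [hW]. *)
Lemma uop_hw : hwvec c (h + p%:R) hW (uop *: m).
Proof.
split.
- move=> n n0; split.
    rewrite gL_top // => [|j jp]; last exact: gL_aop.
    case: ifP => np //; suff -> : n%:R * phi c hW n + ((p - n)%N%:R + (3 * n%:R - p%:R) / 2) *
        ((p - n)%N%:R * (p%:R - (p - n)%N%:R) / gam) = 0 by rewrite kscale0l.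
    rewrite phi_val natrB // inv_gam.
    have c2 : 2 != 0 :> K by exact: (char0 1).
    have c12 : 12 != 0 :> K by exact: (char0 11).
    have c6 : 6 != 0 :> K by exact: (char0 5).
    by field; rewrite c6 c2 c12.
  by rewrite scalerA gW_top -scalerA; have [/(_ n n0)[_ ->] _ _ _] := hm; rewrite scaler0.
- by rewrite scalerA gC_top -scalerA; have [_ -> _ _] := hm; rewrite kscale_act.
- by apply: gL0_top => j _; exact: gL0_aop.
by rewrite scalerA gW_top -scalerA; have [_ _ _ ->] := hm; rewrite kscale_act.
Qed.

Definition Wspan (k d : nat) : M -> Prop :=
  kspan (fun y => exists2 w, [/\ okw w, pureW w, wt w = k & (d <= wW w)%N] & y = wd w *: m).

Lemma Wspan_cons i k d x : (0 < i)%N -> Wspan k d x -> Wspan (i + k) d.+1 (gW (- i%:Z) *: x).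
Proof.
move=> i0; apply: kspan_act => {}x [w [okx puw wk dw] ->]; apply: kspan_in.
exists ((true, i) :: w); last by rewrite wd_cons scalerA.
split; rewrite /okw /pureW /= ?i0 ?okx ?puw //; first by rewrite -wk.
Qed.

Lemma top_Wspan k : (forall j, (j < k)%N -> Wspan j (0 < j)%N (aop j *: m)) -> Wspan k 1 (top k *: m).
Proof.
move=> IH; rewrite top_m big_nat; apply: (big_ind (Wspan k 1)); [exact: Kspan0|exact: kspanA|].
move=> i /andP[i1 ik]; have -> : k = (i + (k - i))%N by lia.
rewrite {2}(_ : (i + (k - i))%N = k); last by lia.
have := Wspan_cons i1 (IH (k - i)%N _); move=> H; have ki : (k - i < k)%N by lia.
by apply: kspan_sub (H ki) => y [w [o1 o2 o3 o4] ->]; apply: kspan_in; exists w => //; split=> //; lia.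
Qed.

Lemma aop_Wspan k : Wspan k (0 < k)%N (aop k *: m).
Proof.
elim/ltn_ind: k => -[|k] IH.
  by rewrite scale1r; apply: kspan_in; exists [::]; rewrite ?wd_nil ?scale1r.
by rewrite aopS kscale_algl; apply: kspanZ; exact: top_Wspan.
Qed.

(** The term [i = p] of the sum is [W_{-p}]; all others have at least two
    factors. *)
Lemma uop_lead : Wspan p 2 (uop *: m - gW (- p%:Z) *: m).
Proof.
rewrite /uop top_m big_nat_recr //= subnn scale1r addrK big_nat.
apply: (big_ind (Wspan p 2)); [exact: Kspan0|exact: kspanA|] => i /andP[i1 ip].
have H := Wspan_cons i1 (aop_Wspan (p - i)%N).
have e : (i + (p - i))%N = p by lia.
by rewrite e subn_gt0 ip in H.
Qed.

End SingularOperator.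

(** * Subspaces with a triangular basis *)

Section LinearMap.
Variables (K : fieldType) (U : w22_alg K) (c h hW : K) (V : vermaT U c h hW).
Local Notation v := (vvac V).
Local Notation ev := (pbwv V).
Let ev_free := @vfree _ _ _ _ _ V.
Let spanV := @ev_span _ _ _ _ _ V.

Variables (M : lmodType U) (f : pbw_idx -> M).

Definition lmap (x : V) : M := \sum_(i <- csupp spanV x) crdv x i •: f i.

Lemma lmapE (s : seq pbw_idx) x : uniq s -> {subset csupp spanV x <= s} ->
  lmap x = \sum_(i <- s) crdv x i •: f i.
Proof.
move=> us xs; rewrite (sum_incl (csupp_uniq spanV x) us xs) // => i.
by rewrite mem_csupp negbK => /eqP; rewrite -/(crdv x i) => ->; rewrite kscale0l.
Qed.

Lemma lmapDl a x y : lmap (a •: x + y) = a •: lmap x + lmap y.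
Proof.
pose s := undup (csupp spanV x ++ csupp spanV y ++ csupp spanV (a •: x + y)).
have us : uniq s by exact: undup_uniq.
rewrite !(@lmapE s) //; try by move=> i si; rewrite mem_undup !mem_cat si ?orbT.
by rewrite kscale_sum -big_split; apply: eq_bigr => i _; rewrite crdvDl kscaleDl kscaleA.
Qed.

Lemma lmap0 : lmap 0 = 0.
Proof. by have := lmapDl (-1) 0 0; rewrite kscale0r addr0 kscaleNl kscale1 addNr. Qed.

Lemma lmap_ev i : is_pbw i -> lmap (ev i) = f i.
Proof.
move=> pi; rewrite (@lmapE [:: i]) // ?big_seq1 ?crdv_ev ?eqxx ?kscale1 //.
move=> j; rewrite mem_csupp -/(crdv (ev i) j) crdv_ev // inE [j == i]eq_sym.
by case: (i == j) => //; rewrite eqxx.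
Qed.

End LinearMap.

(** A subspace [N] spanned by vectors [f i], [F i], which agree with the PBW vectors
    up to less significant terms of the same weight, has the span of the
    remaining PBW vectors, of indices in [B], as a complement. Both submodules
    of the theorem are of this form. *)
Section Triangular.
Variables (K : fieldType) (U : w22_alg K) (c h hW : K) (V : vermaT U c h hW).
Local Notation v := (vvac V).
Local Notation ev := (pbwv V).

Definition low (i j : pbw_idx) := lowp (Wdeg i) (Ldeg i) j && (iwt j == iwt i).

Variables (F B : pred pbw_idx) (f : pbw_idx -> V) (N : V -> Prop).
Hypothesis f_low : forall i, is_pbw i -> F i -> supv (low i) (f i - ev i).
Hypothesis NF : forall y, N y -> exists2 x : V, supv F x & y = lmap f x.
Hypothesis FB : forall i, F i -> ~~ B i.

Lemma lmap_top (x : V) : supv F x -> x != 0 ->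
  exists i0, [/\ crdv x i0 != 0, crdv (lmap f x) i0 = crdv x i0
               & supv (lowp (Wdeg i0) (Ldeg i0).+1) x].
Proof.
move=> Fx x0; have [i0 [ci0 top0]] := top_index x0; exists i0; split=> //.
have {x0 ci0} : supv (fun i => F i && lowp (Wdeg i0) (Ldeg i0).+1 i) x.
  by move=> i ci; rewrite Fx // top0.
move: x {Fx top0}; apply: supv_ind => [|a x y ex ey|i pi /andP[Fi ti]].
- by rewrite lmap0.
- by rewrite lmapDl !crdvDl ex ey.
rewrite lmap_ev // -[f i](subrK (ev i)) crdvD (supv_crd0 (f_low pi Fi)) ?add0r //.
by move: ti; rewrite /low /lowp; lia.
Qed.

(** The leading part of a combination of the [f i] is that of the same
    combination of PBW vectors, so its support is in [F] and not in [B]. *)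
Lemma leadfree_tri : leadfree N B.
Proof.
move=> y d l /NF[x Fx ->] ylow yB.
have [->|x0] := eqVneq x 0; first by rewrite lmap0; exact: supv0.
have [i0 [ci0 ei0 top0]] := lmap_top Fx x0.
have li0 : lowp d l i0.
  apply: contraT => nl; have := ylow i0; rewrite ei0 => /(_ ci0) l1.
  have [di li] : Wdeg i0 = d /\ Ldeg i0 = l by move: nl l1; rewrite /lowp; lia.
  by have := yB i0 di li; rewrite ei0 => /(_ ci0); rewrite (negPf (FB (Fx _ ci0))).
have : supv (fun i => F i && lowp d l i) x.
  move=> i ci; rewrite Fx //=; have := top0 i ci; move: li0; rewrite /lowp; lia.
move: (x); apply: supv_ind => [|a z t ez et|i pi /andP[Fi ti]].
- by rewrite lmap0; exact: supv0.
- by rewrite lmapDl; exact: supvP.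
rewrite lmap_ev // -[f i](subrK (ev i)); apply: supvA; last exact: supv_ev.
by apply: supvS (f_low pi Fi) => j; move: ti; rewrite /low /lowp; lia.
Qed.

Lemma tri_inj (x : V) : supv F x -> lmap f x = 0 -> x = 0.
Proof.
move=> Fx e; apply/eqP/negPn/negP => x0; have [i0 [ci0 ei0 _]] := lmap_top Fx x0.
by move: ci0; rewrite -ei0 e crdv0 eqxx.
Qed.

Lemma leadfree_eq0 (y : V) : N y -> supv B y -> y = 0.
Proof.
move=> Ny By; apply/eqP/negPn/negP => y0; have [i0 [ci0 top0]] := top_index y0.
have := @leadfree_tri y (Wdeg i0) (Ldeg i0) Ny top0 (fun j _ _ cj => By j cj) i0 ci0.
by rewrite /lowp !ltnn andbF.
Qed.

Hypothesis FBT : forall i, is_pbw i -> F i || B i.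
Hypothesis N0 : N 0.
Hypothesis NP : forall a x y, N x -> N y -> N (a •: x + y).
Hypothesis Nf : forall i, is_pbw i -> F i -> N (f i).

Lemma size_part s : part s -> (size s <= sumn s)%N.
Proof.
by move=> /andP[_]; elim: s => [//|x s IH] /= /andP[x0 /IH H]; exact: leq_add x0 H.
Qed.

(** Subtracting [f i] replaces a PBW vector by less significant ones of the same
    weight; there are finitely many indices of a given weight, so this stops. *)
Lemma reduce_ev i : is_pbw i ->
  exists2 y, N y & supv (fun j => B j && (iwt j == iwt i)) (ev i - y).
Proof.
pose mu j := ((iwt j - Wdeg j) * (iwt j).+1 + Ldeg j)%N.
move: {-1}(mu i) (leqnn (mu i)) => n; elim/ltn_ind: n i => n IH i mi pi.
have [Bi|nBi] := boolP (B i).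
  by exists 0; rewrite ?subr0 //; apply: supv_ev; rewrite // Bi eqxx.
have Fi : F i by have := FBT pi; rewrite (negPf nBi) orbF.
suff [y Ny Hy] : exists2 y, N y & supv (fun j => B j && (iwt j == iwt i)) (f i - ev i - y).
  exists (f i - y).
    have -> : f i - y = (-1) •: y + f i by rewrite kscaleNl kscale1 addrC.
    by apply: NP => //; exact: Nf.
  have -> : ev i - (f i - y) = - (f i - ev i - y) by zmod.
  exact: supvN.
move: (f i - ev i) (f_low pi Fi); apply: supv_ind => [|a x z [y1 N1 H1] [y2 N2 H2]|j pj lij].
- by exists 0 => //; rewrite subr0; exact: supv0.
- exists (a •: y1 + y2); first exact: NP.
  have -> : a •: x + z - (a •: y1 + y2) = a •: (x - y1) + (z - y2) by rewrite kscaleBr; zmod.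
  exact: supvP.
have mj : (mu j < n)%N.
  apply: leq_trans mi; move: lij; rewrite /low /lowp /mu => /andP[+ /eqP ew].
  have /andP[pj1 pj2] := pj; have := size_part pj1; have := size_part pj2.
  have /andP[pi1 pi2] := pi; have := size_part pi1; have := size_part pi2.
  rewrite -/(Wdeg i) -/(Wdeg j) -/(Ldeg i) -/(Ldeg j).
  have : (sumn j.1 <= iwt j)%N by exact: leq_addr. have : (sumn i.1 <= iwt i)%N by exact: leq_addr.
  have : (sumn j.2 <= iwt j)%N by exact: leq_addl. have : (sumn i.2 <= iwt i)%N by exact: leq_addl.
  rewrite -ew; move: (sumn _) (sumn _) (sumn _) (sumn _) => s1 s2 s3 s4.
  move: (iwt j) (Wdeg i) (Wdeg j) (Ldeg i) (Ldeg j) => w a b d e; clear; nia.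
have [y Ny Hy] := IH (mu j) mj j (leqnn _) pj; exists y => //.
apply: supvS Hy => k /andP[-> /eqP->]; by case/andP: lij.
Qed.

Lemma reduce (x : V) : exists2 y, N y & supv B (x - y).
Proof.
have : supv xpredT x by []; move: x; apply: supv_ind => [|a x z [y1 N1 H1] [y2 N2 H2]|i pi _].
- by exists 0 => //; rewrite subr0; exact: supv0.
- exists (a •: y1 + y2); first exact: NP.
  have -> : a •: x + z - (a •: y1 + y2) = a •: (x - y1) + (z - y2) by rewrite kscaleBr; zmod.
  exact: supvP.
by have [y Ny Hy] := reduce_ev pi; exists y => //; apply: supvS Hy => j /andP[].
Qed.

Lemma reduce_wt k (x : V) : supv (fun i => iwt i == k) x ->
  exists2 y, N y & supv (fun i => B i && (iwt i == k)) (x - y).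
Proof.
move: x; apply: supv_ind => [|a x z [y1 N1 H1] [y2 N2 H2]|i pi /eqP <-].
- by exists 0 => //; rewrite subr0; exact: supv0.
- exists (a •: y1 + y2); first exact: NP.
  have -> : a •: x + z - (a •: y1 + y2) = a •: (x - y1) + (z - y2) by rewrite kscaleBr; zmod.
  exact: supvP.
exact: reduce_ev.
Qed.

End Triangular.

(** * Graded submodules and irreducible quotients *)

Section Submodules.
Variables (K : fieldType) (U : w22_alg K) (c h hW : K) (V : vermaT U c h hW).
Hypothesis char0 : forall n, n.+1%:R != 0 :> K.
Local Notation v := (vvac V).
Local Notation ev := (pbwv V).
Let ev_free := @vfree _ _ _ _ _ V.
Let spanV := @ev_span _ _ _ _ _ V.
Implicit Types (N : submodule V).

Lemma natr_inj (m n : nat) : m%:R = n%:R :> K -> m = n.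
Proof.
wlog mn : m n / (m <= n)%N => [H|].
  by have [/H|/ltnW/H H' /esym/H'] := leqP m n.
move=> e; apply/eqP; rewrite eqn_leq mn /= -subn_eq0; apply/negPn/negP => d0.
have : (n - m)%:R != 0 :> K by case: (n - m)%N d0.
by rewrite natrB // e subrr eqxx.
Qed.

Lemma sub_kscP N a (x y : V) : x \in N -> y \in N -> a •: x + y \in N.
Proof. by move=> Nx Ny; apply: rpredD => //; exact: rpredZ. Qed.
Lemma sub_ksc N a (x : V) : x \in N -> a •: x \in N.
Proof. by move=> Nx; exact: rpredZ. Qed.

Lemma crd_gL0 (x : V) i : crdv (gL 0 *: x) i = (h + (iwt i)%:R) * crdv x i.
Proof.
have : supv xpredT x by []; move: x; apply: supv_ind => [|a x y ex ey|j pj _].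
- by rewrite scaler0 !crdv0 mulr0.
- by rewrite scalerDr kscale_act !crdvDl ex ey; ring.
by rewrite gL0_ev crdvZ crdv_ev //; case: eqP => [->|]; rewrite ?mulr0.
Qed.

Lemma ev0 : ev ([::], [::]) = v.
Proof. by rewrite /pbwv /pmon wd_nil scale1r. Qed.

Lemma iwt0 i : is_pbw i -> iwt i = 0%N -> i = ([::], [::]).
Proof.
move=> /andP[p1 p2] /eqP; rewrite /iwt addn_eq0 => /andP[/eqP e1 /eqP e2].
have := size_part p1; have := size_part p2; rewrite e1 e2 !leqn0 => /nilP n2 /nilP n1.
by rewrite [LHS]surjective_pairing n1 n2.
Qed.

Definition weight_comp (k : nat) (x : V) : V := restr spanV (fun i => iwt i == k) x.

Lemma crd_weight_comp k x i : crdv (weight_comp k x) i = if iwt i == k then crdv x i else 0.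
Proof. exact: (crd_restr spanV ev_free). Qed.

(** Submodules are graded: on the finitely many weights of [x], the projection is
    a Lagrange interpolation polynomial in [L_0]. *)
Lemma sub_weight_comp N k x : x \in N -> weight_comp k x \in N.
Proof.
move=> Nx; pose s := [seq j <- undup (map iwt (csupp spanV x)) | j != k].
pose op (s : seq nat) : U := \prod_(j <- s) ((k%:R - j%:R)^-1 *: (gL 0 - (h + j%:R)%:A)).
suff -> : weight_comp k x = op s *: x by exact: rpredZ.
have E (t : seq nat) i : crdv (op t *: x) i = \prod_(j <- t) ((k%:R - j%:R)^-1 * ((iwt i)%:R - j%:R)) * crdv x i.
  elim: t => [|j t IH]; first by rewrite /op !big_nil scale1r mul1r.
  rewrite /op !big_cons -scalerA -/(op t) kscale_algl crdvZ scalerBl crdvB crd_gL0.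
  by rewrite -[_%:A *: _]/(_ •: _) crdvZ IH; ring.
apply: crdv_inj => i; rewrite crd_weight_comp E; have [ci|ci] := eqVneq (crdv x i) 0.
  by rewrite ci mulr0; case: ifP.
have [ik|ik] := eqVneq (iwt i) k.
  rewrite big1_seq ?mul1r // => j /=; rewrite mem_filter => /andP[jk _].
  by rewrite ik mulVf // subr_eq0; apply: contra jk => /eqP/natr_inj ->.
rewrite (bigD1_seq (iwt i)) /=; last by rewrite filter_uniq ?undup_uniq.
  by rewrite subrr mulr0 !mul0r.
by rewrite mem_filter ik mem_undup map_f // mem_csupp.
Qed.

Lemma sub_full N : v \in N -> forall x, x \in N.
Proof. by move=> Nv x; have [u ->] := vgen x; exact: rpredZ. Qed.

Lemma weight_comp0 x : weight_comp 0 x = crdv x ([::], [::]) •: v.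
Proof.
apply: crdv_inj => i; rewrite crd_weight_comp crdvZ -ev0 crdv_ev //.
have [->|ne] := eqVneq i ([::], [::]); first by rewrite !eqxx mulr1.
rewrite mulr0; case: eqP => // wi; apply/eqP/negPn/negP => ci.
by case/eqP: ne; apply: iwt0 wi; exact: crdv_pbw ci.
Qed.

Lemma sub_crd0 N x : v \notin N -> x \in N -> crdv x ([::], [::]) = 0.
Proof.
move=> Nv Nx; apply/eqP; apply: contraNT Nv => c0.
have := sub_ksc (crdv x ([::], [::]))^-1 (sub_weight_comp 0 Nx).
by rewrite weight_comp0 kscaleA mulVf // kscale1.
Qed.

Lemma proper_v N : proper_submod N <-> v \notin N.
Proof.
split=> [[x nx]|]; last by exists v.
by apply: contra nx => /sub_full.
Qed.

Lemma wt_gL (n k : nat) (y : V) : supv (fun i => iwt i == k) y ->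
  supv (fun i => (iwt i + n)%N == k) (gL n%:Z *: y) /\
  supv (fun i => (iwt i + n)%N == k) (gW n%:Z *: y).
Proof.
move=> ky; have L0 : gL 0 *: y = (h + k%:R) •: y.
  apply: crdv_inj => i; rewrite crd_gL0 crdvZ.
  by have [->|/ky/eqP->//] := eqVneq (crdv y i) 0; rewrite !mulr0.
have key (z : V) : gL 0 *: z = (h + k%:R - n%:R) •: z -> supv (fun i => (iwt i + n)%N == k) z.
  move=> ez i ci; have := crd_gL0 z i; rewrite ez crdvZ => /(mulIf ci) /eqP.
  rewrite -addrA (inj_eq (addrI h)) subr_eq -natrD => /eqP/natr_inj ->.
  by rewrite eqxx.
have E (X : U) : gL 0 * X - X * gL 0 = - n%:R *: X -> gL 0 *: (X *: y) = (h + k%:R - n%:R) •: (X *: y).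
  move=> eX; rewrite scalerA -[gL 0 * X](subrK (X * gL 0)) eX scalerDl kscale_algl -scalerA L0.
  by rewrite kscale_act -kscaleDl addrC.
have e0 : cocycle K 0 n%:Z = 0.
  by rewrite /cocycle; case: eqP => // _; rewrite expr0n subrr mulr0z mul0r.
split; apply: key; apply: E; rewrite ?gLL ?gLW e0 scale0r addr0 !add0r.
  by rewrite rmorphN.
by rewrite rmorphN.
Qed.

(** The degree [k] must be positive so as to exclude the highest weight vector,
    which is singular in every nonzero quotient. *)
Definition sing N (y : V) (k : nat) : Prop :=
  [/\ y \notin N, (0 < k)%N, supv (fun i => iwt i == k) y
    & forall n : nat, (0 < n)%N -> gL n%:Z *: y \in N /\ gW n%:Z *: y \in N].

(** Of the elements of [N'] outside [N], a homogeneous one of least weight is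
    singular modulo [N], because positive modes lower the weight. *)
Lemma exists_sing N N' x : v \notin N' -> x \in N' -> x \notin N -> exists y k, sing N y k.
Proof.
move=> vN' xN' xN.
have [k kx] : exists k, weight_comp k x \notin N.
  apply: contrapT => H; case/negP: xN.
  have -> : x = \sum_(k <- undup (map iwt (csupp spanV x))) weight_comp k x.
    apply: crdv_inj => i; rewrite [RHS](crd_sum spanV ev_free).
    under eq_bigr => k _ do rewrite -[crd _ _ _]/(crdv _ _) crd_weight_comp.
    have [ci|ci] := eqVneq (crdv x i) 0.
      by rewrite ci big1 // => k _; case: ifP.
    rewrite (bigD1_seq (iwt i)) ?undup_uniq //=; last by rewrite mem_undup map_f // mem_csupp.
    by rewrite eqxx big1 ?addr0 // => k; rewrite eq_sym => /negPf->.
  apply: rpred_sum => k _; apply/negPn/negP => nk; apply: H; by exists k.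
have : weight_comp k x \in N' by exact: sub_weight_comp.
have : supv (fun i => iwt i == k) (weight_comp k x) by exact: (insupp_restr ev_free).
elim/ltn_ind: k {x xN' xN} (weight_comp k x) kx => k IH y yN ky yN'.
have k0 : (0 < k)%N.
  rewrite lt0n; apply: contraNneq yN => ek.
  have e : y = weight_comp 0 y by rewrite -ek /weight_comp (restr_id ev_free).
  by move: (sub_crd0 vN' yN') => c0; rewrite e weight_comp0 c0 kscale0l rpred0.
have [H|] := pselect (forall n : nat, (0 < n)%N -> gL n%:Z *: y \in N /\ gW n%:Z *: y \in N).
  by exists y, k.
move=> /existsNP[n /not_implyP[n0 H]].
have [X [nX kX XN']] : exists X, [/\ X *: y \notin N, supv (fun i => (iwt i + n)%N == k) (X *: y) & X *: y \in N'].
  have [k1 k2] := wt_gL n ky.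
  have [L|L] := boolP (gL n%:Z *: y \in N).
    have [W|W] := boolP (gW n%:Z *: y \in N); first by case: H.
    by exists (gW n%:Z); split=> //; exact: rpredZ.
  by exists (gL n%:Z); split=> //; exact: rpredZ.
have nk : (n <= k)%N.
  rewrite leqNgt; apply: contra nX => kn.
  have -> : X *: y = 0.
    apply: crdv_inj => i; rewrite crdv0; apply/eqP/negPn/negP => /kX /eqP e.
    by move: kn; rewrite -e; lia.
  exact: rpred0.
apply: (IH (k - n)%N) nX _ XN'; first by lia.
by apply: supvS kX => i /eqP <-; rewrite addnK.
Qed.

(** A submodule of the quotient that is neither zero nor everything would come
    from a proper [N'] not contained in [N]. *)
Lemma irr_or_sing N : v \notin N -> (exists y k, sing N y k) \/ irreducible_mod (quot_mod N).
Proof.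
move=> vN; have [H|nS] := pselect (exists y k, sing N y k); [by left|right].
split; first by exists (qproj N v); rewrite qproj_eq0.
move=> N0; pose P : {pred V} := fun x => qproj N x \in N0.
have Pcl : submod_closed P.
  split; first by rewrite unfold_in /P raddf0 rpred0.
  move=> a x y Px Py; rewrite unfold_in /P raddfD /= linearZ /=.
  by apply: rpredD => //; exact: rpredZ.
pose N' := Submodule Pcl.
have [vN'|vN'] := boolP (v \in N').
  by right=> y; have [x ->] := qproj_surj y; exact: (sub_full vN').
left=> y; have [x ->] := qproj_surj y => Hx; apply/eqP; rewrite qproj_eq0.
apply/negPn/negP => xN; apply: nS; exact: (@exists_sing N N' x vN').
Qed.

(** No element of a proper submodule has a component along the highest weight
    vector, and this property passes to sums. *)
Lemma max_proper : v \notin max_submod V.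
Proof.
pose P : {pred V} := fun x => `[< forall u, crdv (u *: x) ([::], [::]) = 0 >].
have Pcl : submod_closed P.
  split; first by apply/asboolP => u; rewrite scaler0 crdv0.
  move=> a x y /asboolP Px /asboolP Py; apply/asboolP => u.
  by rewrite scalerDr crdvD scalerA Px Py addr0.
apply/negP => /asboolP /(_ (Submodule Pcl)) H.
have /asboolP/(_ 1) : v \in Submodule Pcl.
  apply: H => y [N /proper_v vN yN]; apply/asboolP => u.
  by apply: (sub_crd0 vN); exact: rpredZ.
by rewrite scale1r -ev0 crdv_ev // eqxx => /eqP; rewrite oner_eq0.
Qed.

Lemma max_submodE N : v \notin N -> irreducible_mod (quot_mod N) ->
  N = max_submod V.
Proof.
move=> vN [_ irr]; have NJ x : x \in N -> x \in max_submod V.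
  by move=> Nx; apply/asboolP => M HM; apply: HM; exists N => //; apply/proper_v.
pose P : {pred quot_mod N} := fun y => `[< exists2 x, x \in max_submod V & y = qproj N x >].
have Pcl : submod_closed P.
  split; first by apply/asboolP; exists 0; rewrite ?raddf0 ?rpred0.
  move=> a _ _ /asboolP[x Jx ->] /asboolP[y Jy ->]; apply/asboolP.
  exists (a *: x + y); first by apply: rpredD => //; exact: rpredZ.
  by rewrite raddfD /= linearZ.
apply: submod_eqP => x; apply/idP/idP; first exact: NJ.
case: (irr (Submodule Pcl)) => [H Jx|H _].
  by rewrite -qproj_eq0; apply/eqP/H/asboolP; exists x.
have /asboolP[y Jy e] := H (qproj N v).
case/negP: max_proper; rewrite -(subrK y v); apply: rpredD => //; apply: NJ.
by rewrite -qproj_eq0 raddfB /= e subrr.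
Qed.

End Submodules.

(** * The quotient by the singular vector *)

Section Helpers.
Variables (K : fieldType) (U : w22_alg K) (c h hW : K) (V : vermaT U c h hW).
Local Notation v := (vvac V).
Local Notation ev := (pbwv V).

Lemma cyclicP (N : lmodType U) (x y : N) : y \in cyclic x <-> exists a, y = a *: x.
Proof. by split=> [/asboolP//|H]; apply/asboolP. Qed.

(** If [x] has leading term the word [w'], then applying the word [w] gives the
    leading term [w ++ w']. This produces the triangular families. *)
Lemma lead_act w w' (x : V) i : okw w -> okw w' ->
  supv (fun j => (wW w' < Wdeg j)%N && (iwt j == wt w')) (x - wd w' *: v) ->
  is_pbw i -> perm_eq (w ++ w') (pword i) -> supv (low i) (wd w *: x - ev i).
Proof.
move=> ow ow' Hx pi e; have wc : wcanon (w ++ w') = i.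
  by rewrite (wcanon_perm e) wcanon_pword.
have -> : wd w *: x - ev i = wd w *: (x - wd w' *: v) + (wd (w ++ w') *: v - ev i).
  by rewrite scalerBr scalerA -wd_cat; zmod.
have eW : Wdeg i = (wW w + wW w')%N by rewrite -wW_pword -(wW_perm e) /wW count_cat.
have et : iwt i = (wt w + wt w')%N by rewrite -wt_pword -(wt_perm e) /wt map_cat sumn_cat.
apply: supvA.
  apply: supv_wd Hx => // j /andP[dj /eqP tj] k /same_cat[dk tk] _.
  by rewrite /low /lowp dk tk tj et eqxx andbT eW ltn_add2l dj.
rewrite -wc; apply: supvS (wd_lows _) => [j|]; last by rewrite /okw all_cat; apply/andP.
rewrite /lows /same /low /lowp Wdeg_wcanon Ldeg_wcanon iwt_wcanon.
by move=> /andP[/andP[-> ->] ->]; rewrite orbT.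
Qed.

Lemma Wspan_supv k d q (x y : V) : supv (fun i => iwt i == k) x -> Wspan x q d y ->
  supv (fun i => iwt i == (k + q)%N) y.
Proof.
move=> kx; elim=> {y} [|a y z [w [ow _ tw _] ->] _ IH]; first exact: supv0.
apply: supvP => //; apply: supv_wd kx => // i /eqP <- j /same_cat[_ ->] _.
by rewrite tw addnC.
Qed.

Lemma iwt_Lp p r : iwt ([::], nseq r p) = (r * p)%N.
Proof. by rewrite /iwt /= sumn_nseq mulnC. Qed.

Lemma part_ins n s : (0 < n)%N -> part s -> part (ins n s).
Proof.
move=> n0 /andP[_ ps]; apply/andP; split; first exact: (sort_sorted total_geq).
by rewrite all_sort /= n0.
Qed.

(** A highest weight vector on which the PBW monomials act freely generates a
    Verma module. *)
Lemma free_ann (M : lmodType U) (m : M) u : hwvec c h hW m ->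
  (forall (s : seq pbw_idx) (a : pbw_idx -> K), uniq s -> all is_pbw s ->
    \sum_(i <- s) a i •: (pmon i *: m) = 0 -> {in s, forall i, a i = 0}) ->
  u *: m = 0 -> u *: v = 0.
Proof.
move=> hm mfree um; pose s := csupp (@ev_span _ _ _ _ _ V) (u *: v).
have E : u *: v = \sum_(i <- s) crdv (u *: v) i •: ev i by exact: csuppE.
have e0 : (u - \sum_(i <- s) crdv (u *: v) i *: pmon i) *: v = 0.
  by rewrite scalerBl scaler_suml {1}E -sumrB big1 // => i _; rewrite kscale_algl subrr.
have := vuniv hm e0; rewrite scalerBl um sub0r => /eqP; rewrite oppr_eq0 scaler_suml => /eqP H.
rewrite E big1_seq // => i /andP[_ si]; rewrite (mfree s (crdv (u *: v))) ?kscale0l //.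
- exact: csupp_uniq.
- by apply/allP => j; rewrite mem_csupp => /crdv_pbw.
by rewrite -[RHS]H; apply: eq_bigr => j _; rewrite kscale_algl.
Qed.

End Helpers.

Section SingularVector.
Variables (K : fieldType) (U : w22_alg K) (c h hW : K) (V : vermaT U c h hW) (p : nat).
Hypothesis char0 : forall n, n.+1%:R != 0 :> K.
Hypothesis c0 : c != 0.
Hypothesis p0 : (0 < p)%N.
Hypothesis hcp : 2 * hW + (p%:R ^+ 2 - 1) / 12 * c = 0.
Local Notation v := (vvac V).
Local Notation ev := (pbwv V).

Lemma phi_p : phi c hW p = 0. Proof. exact: hcp. Qed.

Lemma phi_neq0 n : (0 < n)%N -> n != p -> n%:R * phi c hW n != 0.
Proof.
move=> n0 np; rewrite (phi_val hcp) !mulf_neq0 ?invr_eq0 ?(char0P char0) //.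
  rewrite subr_sqr mulf_neq0 ?subr_eq0 // -?natrD ?(char0P char0) ?addn_gt0 ?n0 //.
  by apply: contra np => /eqP/(natr_inj char0)->.
Qed.

Definition uprime : V := uop U c p *: v.
Definition Nprime : submodule V := cyclic uprime.

Lemma u1_hw : hwvec c (h + p%:R) hW uprime.
Proof. exact: (uop_hw char0 c0 p0 hcp (vhw V)). Qed.

Lemma u1_lead : supv (fun i => (1 < Wdeg i)%N && (iwt i == p)) (uprime - wd [:: (true, p)] *: v).
Proof.
rewrite wd_cons wd_nil mulr1; have := uop_lead (U := U) c0 p0 v; rewrite -/uprime.
rewrite -/(ltr (true, p)); move: (_ - _) => y; elim=> {y} [|a y z [w [ow _ tw dw] ->] _ IH].
  exact: supv0.
apply: supvP => //; apply: supvS (wd_supv ow) => j /andP[/andP[/eqP-> /eqP->] _].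
by rewrite dw tw /=.
Qed.


(** The triangular basis of the submodule generated by the singular vector: its
    leading term being [W_{-p}], the vector of index [i] that contains [W_{-p}]
    is obtained by applying the monomial without this factor. *)
Definition f1 (i : pbw_idx) : V := pmon (rem p i.1, i.2) *: uprime.

Lemma f1_low i : is_pbw i -> p \in i.1 -> supv (low i) (f1 i - ev i).
Proof.
move=> pi ip; apply: (@lead_act _ _ _ _ _ _ _ [:: (true, p)]) => //.
- exact: okw_pword (is_pbw_remW p pi).
- by rewrite /okw /= p0.
- by apply: supvS u1_lead => j /andP[dj ej]; rewrite dj /wt /= [(p + 0)%N]addn0.
apply/permP => a; rewrite /pword !count_cat /= !count_map.
have /permP/(_ (preim (pair true) a)) /= -> := perm_to_rem ip; rewrite addn0.
by rewrite addnC addnA.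
Qed.

Lemma f1_ins j : is_pbw j -> is_pbw (ins p j.1, j.2) /\ f1 (ins p j.1, j.2) = pmon j *: uprime.
Proof.
by move=> /andP[p1 p2]; rewrite /f1 /= rem_ins // -surjective_pairing /is_pbw /= part_ins.
Qed.

Lemma N1_sp y : y \in Nprime -> sp uprime predT y.
Proof. by move=> /cyclicP[a ->]; exact: hw_span u1_hw a. Qed.

Lemma N1_f1 y : y \in Nprime -> exists2 x : V, supv (fun i => p \in i.1) x & y = lmap f1 x.
Proof.
move=> /N1_sp; elim=> {y} [|a y z [i /andP[pi _] ->] _ [x Hx ->]].
  by exists 0; [exact: supv0|rewrite lmap0].
have [q e] := f1_ins pi; exists (a •: ev (ins p i.1, i.2) + x); last by rewrite lmapDl lmap_ev // e.
by apply: supvP => //; apply: supv_ev => //; exact: mem_ins.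
Qed.

Lemma f1_N1 i : is_pbw i -> p \in i.1 -> f1 i \in Nprime.
Proof. by move=> _ _; apply/cyclicP; exists (pmon (rem p i.1, i.2)). Qed.

Lemma lead1 : leadfree (fun y => y \in Nprime) (fun i => p \notin i.1).
Proof. by apply: leadfree_tri f1_low N1_f1 _ => i ->. Qed.

Lemma N1_eq0 y : y \in Nprime -> supv (fun i => p \notin i.1) y -> y = 0.
Proof.
have FB (i : pbw_idx) : p \in i.1 -> ~~ (p \notin i.1) by move=> ->.
exact: (leadfree_eq0 (N := fun y => y \in Nprime) (B := fun i => p \notin i.1) f1_low N1_f1 FB).
Qed.

Lemma N1P (a : K) (x y : V) : x \in Nprime -> y \in Nprime -> a •: x + y \in Nprime.
Proof. exact: sub_kscP. Qed.

Lemma reduce1 x : exists2 y, y \in Nprime & supv (fun i => p \notin i.1) (x - y).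
Proof.
apply: (reduce (N := fun y => y \in Nprime)) f1_low _ (rpred0 _) N1P f1_N1 x.
by move=> i _; case: (p \in i.1).
Qed.

Lemma reduce1_wt k x : supv (fun i => iwt i == k) x ->
  exists2 y, y \in Nprime & supv (fun i => (p \notin i.1) && (iwt i == k)) (x - y).
Proof.
have FB (i : pbw_idx) : is_pbw i -> (p \in i.1) || (p \notin i.1) by case: (p \in i.1).
exact: (reduce_wt (N := fun y => y \in Nprime) (B := fun i => p \notin i.1) f1_low FB (rpred0 _) N1P f1_N1).
Qed.

Lemma N1_inS y : y \in Nprime -> supv (inS p) y.
Proof.
move=> /N1_sp; elim=> {y} [|a y z [i /andP[pi _] ->] _ IH]; first exact: supv0.
apply: supvP => //; rewrite /pmon; elim: (pword i) (okw_pword pi) => [_|l w IHw /andP[l0 /IHw H]].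
  rewrite wd_nil scale1r -[uprime](subrK (wd [:: (true, p)] *: v)); apply: supvA.
    by apply: supvS u1_lead => j /andP[dj _]; rewrite /inS dj.
  rewrite -(ev_pword V (i := ([:: p], [::]))) //; apply: supv_ev.
    by rewrite /is_pbw /part /= p0.
  by rewrite /inS /= leqnn.
by rewrite wd_cons -scalerA; exact: inS_ltr.
Qed.

Lemma inS_W0 i : inS p i -> (0 < Wdeg i)%N.
Proof. by rewrite /inS; case: (Wdeg i). Qed.

Lemma N1_W0 y : y \in Nprime -> supv (fun i => 0 < Wdeg i)%N y.
Proof. by move=> /N1_inS; apply: supvS; exact: inS_W0. Qed.

Lemma v_N1 : v \notin Nprime.
Proof.
apply/negP => /N1_W0 /(_ ([::], [::])).
by rewrite -ev0 crdv_ev // eqxx oner_eq0 => /(_ isT).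
Qed.

Lemma u1_free (s : seq pbw_idx) (a : pbw_idx -> K) : uniq s -> all is_pbw s ->
  \sum_(i <- s) a i •: (pmon i *: uprime) = 0 -> {in s, forall i, a i = 0}.
Proof.
move=> us /allP ps e0; pose g j : pbw_idx := (ins p j.1, j.2).
pose g' j : pbw_idx := (rem p j.1, j.2).
have gK : {in s, cancel g g'}.
  by move=> j /ps /andP[p1 _]; rewrite /g /g' /= rem_ins // -surjective_pairing.
have [Fx ex] : supv (fun i => p \in i.1) (\sum_(i <- s) a i •: ev (g i)) /\
    lmap f1 (\sum_(i <- s) a i •: ev (g i)) = \sum_(i <- s) a i •: (pmon i *: uprime).
  elim: (s) ps => [_|i t IH pt]; first by rewrite !big_nil lmap0; split=> //; exact: supv0.
  have [H e] := IH (fun j jt => pt j (mem_behead (s := i :: t) jt)).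
  have [q eq] := f1_ins (pt i (mem_head i t)); rewrite !big_cons lmapDl e lmap_ev // eq.
  by split=> //; apply: supvP => //; apply: supv_ev => //; exact: mem_ins.
have := tri_inj f1_low Fx; rewrite ex => /(_ e0) z0 i si.
have := @vfree _ _ _ _ _ V (map g s) (a \o g'); rewrite big_map.
under eq_big_seq => j sj do rewrite /= gK //.
rewrite map_inj_in_uniq ?us; last exact: can_in_inj gK.
move=> /(_ isT _ z0 (g i) (map_f g si)); rewrite /= gK //; apply.
by apply/allP => _ /mapP[j sj ->]; have [] := f1_ins (ps j sj).
Qed.

(** A singular vector of the quotient by the singular vector: after reduction
    modulo the submodule, [lead_sing], [lead_exact] and [sing_h] apply. *)
Lemma sing1 y k : sing Nprime y k -> exists r z, [/\ (0 < r)%N, k = (r * p)%N,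
  h = hW + (13 * p%:R + 1) * (p%:R - 1) / 12 + (1 - r%:R) * p%:R / 2,
  y - z \in Nprime & [/\ crdv z ([::], nseq r p) != 0,
    supv (fun i => ((Wdeg i == 0%N) ==> (i == ([::], nseq r p))) && (iwt i == k) && (p \notin i.1)) z &
    forall n : nat, (0 < n)%N -> gL n%:Z *: z \in Nprime /\ gW n%:Z *: z \in Nprime]].
Proof.
case=> yN k0 ky sy; have [x xN Hz] := reduce1_wt ky.
set z := y - x in Hz; have zB : supv (fun i => p \notin i.1) z by apply: supvS Hz => i /andP[].
have zk i : crdv z i != 0 -> iwt i = k by move=> /Hz /andP[_ /eqP].
have sz n : (0 < n)%N -> gL n%:Z *: z \in Nprime /\ gW n%:Z *: z \in Nprime.
  by move=> /sy[s1 s2]; rewrite /z !scalerBr; split; apply: rpredB => //; exact: rpredZ.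
have z0 : z != 0 by apply: contraNneq yN => e; rewrite -(subrK x y) -/z e add0r.
have [|//|r [cr _]] := lead_sing phi_neq0 char0 lead1 _ _ z0 zB sz.
  by move=> i n nip; split=> //=; apply: contra nip => /mem_rem.
have kr : k = (r * p)%N by rewrite -(zk _ cr) iwt_Lp.
have r0 : (0 < r)%N by move: k0; rewrite kr muln_gt0 => /andP[].
have zex i : crdv z i != 0 -> Wdeg i = 0%N -> i = ([::], nseq r p).
  move=> ci; apply: (lead_exact p0 phi_neq0 char0 phi_p N1_W0 _ _ ci) => [n /sz[]//|j /zk->//].
have eh := sing_h p0 char0 phi_p r0 zB cr zex.
exists r, z; split=> //; first by apply: eh => n /sz[/N1_inS s1 /N1_inS s2].
  by rewrite /z subKr.
split=> // i ci; rewrite zB // zk // eqxx !andbT; apply/implyP => /eqP di.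
by apply/eqP; exact: zex.
Qed.

(** The value of [h] determines [r], hence the weight of a singular vector of
    the quotient. *)
Lemma weight_inj r r' : h = hW + (13 * p%:R + 1) * (p%:R - 1) / 12 + (1 - r%:R) * p%:R / 2 ->
  h = hW + (13 * p%:R + 1) * (p%:R - 1) / 12 + (1 - r'%:R) * p%:R / 2 -> r = r'.
Proof.
move=> -> /addrI /(congr1 ( *%R^~ 2)); have n2 : 2%:R != 0 :> K by exact: (char0 1).
rewrite !divfK // => /(mulIf (char0P char0 p0)) /addrI /oppr_inj.
exact: natr_inj.
Qed.

End SingularVector.

(** * The subsingular vector *)

(** Here [u2] plays the role of the subsingular vector, and [V3] is the Verma
    module whose highest weight is the weight of [u2]. *)
Section Subsingular.
Variables (K : fieldType) (U : w22_alg K) (c h hW : K) (V : vermaT U c h hW) (p : nat).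
Hypothesis char0 : forall n, n.+1%:R != 0 :> K.
Hypothesis c0 : c != 0.
Hypothesis p0 : (0 < p)%N.
Hypothesis hcp : 2 * hW + (p%:R ^+ 2 - 1) / 12 * c = 0.
Variables (r : nat) (V3 : vermaT U c (h + (r * p)%:R) hW) (u2 : V).
Hypothesis r0 : (0 < r)%N.
Hypothesis hr : h = hW + (13 * p%:R + 1) * (p%:R - 1) / 12 + (1 - r%:R) * p%:R / 2.
Hypothesis u2_lead : supv (fun i => (0 < Wdeg i)%N && (iwt i == (r * p)%N))
  (u2 - pbwv V ([::], nseq r p)).
Hypothesis u2_sing : forall n : nat, (0 < n)%N ->
  gL n%:Z *: u2 \in Nprime V p /\ gW n%:Z *: u2 \in Nprime V p.
Local Notation v := (vvac V).
Local Notation ev := (pbwv V).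
Local Notation N1 := (Nprime V p).
Local Notation u1 := (uprime V p).
Local Notation q := (qproj N1).

Lemma u2_wt : supv (fun i => iwt i == (r * p)%N) u2.
Proof.
rewrite -[u2](subrK (ev ([::], nseq r p))); apply: supvA.
  by apply: supvS u2_lead => i /andP[].
by apply: supv_ev; rewrite ?is_pbw_Lp // iwt_Lp.
Qed.

Lemma u2_gL0 : gL 0 *: u2 = (h + (r * p)%:R) •: u2.
Proof.
apply: crdv_inj => i; rewrite crd_gL0 crdvZ.
by have [->|/u2_wt/eqP->//] := eqVneq (crdv u2 i) 0; rewrite !mulr0.
Qed.

(** By [weight_inj], a singular vector of the quotient has weight [r p] and a
    nonzero component on [L_{-p}^r]. The next lemmas use this to show that
    vectors which are singular by construction, but have no such component or
    another weight, vanish in the quotient. *)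
Lemma sing1_wt y k : sing N1 y k -> k = (r * p)%N /\ crdv y ([::], nseq r p) != 0.
Proof.
move=> /(sing1 char0 c0 p0 hcp)[r' [z [r'0 -> hr' yz [cz _ _]]]].
have er : r' = r by exact: (weight_inj char0 p0 hr' hr).
subst r'; split=> //; rewrite -(subrK z y) crdvD (supv_crd0 (N1_W0 char0 c0 p0 hcp yz)) ?add0r //.
Qed.

Lemma gW0_Wpos (x : V) : supv (fun i => 0 < Wdeg i)%N (gW 0 *: x - hW •: x).
Proof.
have : supv xpredT x by []; move: x; apply: supv_ind => [|a x y Hx Hy|i pi _].
- by rewrite scaler0 kscale0r subrr; exact: supv0.
- have -> : gW 0 *: (a •: x + y) - hW •: (a •: x + y) =
    a •: (gW 0 *: x - hW •: x) + (gW 0 *: y - hW •: y).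
    rewrite scalerDr kscaleDr kscale_act kscaleBr !kscaleA [a * hW]mulrC; zmod.
  exact: supvP.
by apply: supvS (gW0_wd (V := V) (okw_pword pi)) => j; apply: leq_ltn_trans.
Qed.

(** Otherwise [(W_0 - hW) u2] would be singular modulo [N1], but it has no
    component of W-degree zero. *)
Lemma u2_gW0 : gW 0 *: u2 - hW •: u2 \in N1.
Proof.
apply/negPn/negP => yN; suff /sing1_wt[_] : sing N1 (gW 0 *: u2 - hW •: u2) (r * p).
  by rewrite (supv_crd0 (@gW0_Wpos u2)) ?eqxx.
split=> // [||n n0]; first by rewrite muln_gt0 r0.
  apply: supvB; last by apply: supvZ; exact: u2_wt.
  by have [_] := wt_gL char0 0 u2_wt; apply: supvS => i; rewrite addn0.
have [s1 s2] := u2_sing n0.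
have e0 : cocycle K n%:Z 0 = 0 by rewrite /cocycle oppr0; case: eqP => //; lia.
have eL : gL n%:Z * gW 0 = gW 0 * gL n%:Z + (n%:Z)%:~R *: gW n%:Z :> U.
  by have := gLW U n%:Z 0; rewrite e0 scale0r subr0 !addr0 => <-; rewrite addrC subrK.
have eW : gW n%:Z * gW 0 = gW 0 * gW n%:Z :> U by exact: gWW.
rewrite !scalerBr !scalerA eL eW scalerDl kscale_algl -!scalerA !kscale_act.
split; first by apply: rpredB; [apply: rpredD|]; exact: rpredZ.
by apply: rpredB; exact: rpredZ.
Qed.

Lemma qu2_hw : hwvec c (h + (r * p)%:R) hW (q u2).
Proof.
have qE (a : K) (X : U) x : X *: x - a •: x \in N1 -> X *: q x = a •: q x.
  move=> Hx; apply/eqP; rewrite -subr_eq0 /ksc -!linearZ -linearB.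
  by rewrite qproj_eq0.
split.
- by move=> n /u2_sing[s1 s2]; split; rewrite -linearZ; apply/eqP; rewrite qproj_eq0.
- apply: qE; suff -> : gC *: u2 = c •: u2 by rewrite subrr rpred0.
  have : supv xpredT u2 by []; move: u2; apply: supv_ind => [|a x y Hx Hy|i pi _].
  + by rewrite scaler0 kscale0r.
  + by rewrite scalerDr kscaleDr kscale_act Hx Hy !kscaleA mulrC.
  exact: gC_v.
- by apply: qE; rewrite u2_gL0 subrr rpred0.
by apply: qE; exact: u2_gW0.
Qed.

(** The operator of the singular vector, applied to the highest weight vector
    [u2] of the quotient, gives a singular vector of weight [(r + 1) p] or zero,
    and the first case is excluded by [sing1_wt]. *)
Lemma uop_u2 : uop U c p *: u2 \in N1.
Proof.
apply/negPn/negP => yN; suff /sing1_wt[e _] : sing N1 (uop U c p *: u2) (r * p + p).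
  by move: p0; lia.
split=> // [||n n0]; first by rewrite addn_gt0 p0 orbT.
  rewrite -[uop U c p *: u2](subrK (gW (- p%:Z) *: u2)); apply: supvA.
    exact: Wspan_supv u2_wt (uop_lead c0 p0 u2).
  have -> : gW (- p%:Z) = wd [:: (true, p)] :> U by rewrite wd_cons wd_nil mulr1.
  have ow : okw [:: (true, p)] by rewrite /okw /= p0.
  apply: (supv_wd ow _ u2_wt) => i /eqP <- j /same_cat[_ ->] _.
  by rewrite /wt /= addn0 addnC.
have [Hn _ _ _] := uop_hw char0 c0 p0 hcp qu2_hw; have [e1 e2] := Hn n n0.
by split; rewrite -qproj_eq0 !linearZ /= ?e1 ?e2.
Qed.

(** In the quotient, [u2] generates an image of the Verma module [V3] in which
    the singular vector of [V3] vanishes. So it is spanned by the monomials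
    without [W_{-p}], by the basis found for the quotient of [V3]. *)
Lemma act_u2 a : exists2 y, y \in N1 & kspan
  (fun x => exists2 j, is_pbw j && (p \notin j.1) & x = pmon j *: u2) (a *: u2 - y).
Proof.
have [y3 /cyclicP[b ey] Hy] := reduce1 c0 p0 (a *: vvac V3).
set x3 := _ - _ in Hy; pose s := csupp (@ev_span _ _ _ _ _ V3) x3.
pose S := \sum_(i <- s) crdv x3 i *: (pmon i : U).
have Sm (M : lmodType U) (m : M) : S *: m = \sum_(i <- s) crdv x3 i •: (pmon i *: m).
  by rewrite scaler_suml; apply: eq_bigr => i _; rewrite kscale_algl.
have e3 : S *: vvac V3 = x3 by rewrite Sm; exact/esym/csuppE.
have : (a - b * uop U c p - S) *: vvac V3 = 0.
  by rewrite !scalerBl e3 -scalerA /x3 ey /uprime; zmod.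
move=> /(vuniv qu2_hw)/eqP; rewrite -linearZ qproj_eq0 => Hn.
exists ((a - b * uop U c p - S) *: u2 + b *: (uop U c p *: u2)).
  by apply: rpredD => //; apply: rpredZ; exact: uop_u2.
have -> : a *: u2 - ((a - b * uop U c p - S) *: u2 + b *: (uop U c p *: u2)) = S *: u2.
  by rewrite !scalerBl -scalerA; zmod.
have {e3} Hs : all (fun i => is_pbw i && (p \notin i.1)) s.
  by apply/allP => i; rewrite mem_csupp => ci; rewrite (crdv_pbw ci) Hy.
rewrite Sm; elim: (s) Hs => [|i t IH]; first by rewrite big_nil => _; exact: Kspan0.
by rewrite big_cons => /andP[Hi /IH]; apply: KspanD; exists i.
Qed.

Definition N2 : submodule V := submod_gen (fun x => x = u2 \/ x = u1).

Lemma u2_N2 : u2 \in N2. Proof. by apply/asboolP => N; apply; left. Qed.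
Lemma N1_N2 y : y \in N1 -> y \in N2.
Proof.
by move=> /cyclicP[a ->]; apply: rpredZ; apply/asboolP => N; apply; right.
Qed.

Lemma N2P y : y \in N2 -> exists a, y - a *: u2 \in N1.
Proof.
pose P : {pred V} := fun y => `[< exists a, y - a *: u2 \in N1 >].
have Pcl : submod_closed P.
  split; first by apply/asboolP; exists 0; rewrite scale0r subrr rpred0.
  move=> b x z /asboolP[a1 H1] /asboolP[a2 H2]; apply/asboolP; exists (b * a1 + a2).
  have -> : b *: x + z - (b * a1 + a2) *: u2 = b *: (x - a1 *: u2) + (z - a2 *: u2).
    by rewrite scalerBr scalerA scalerDl; zmod.
  by apply: rpredD => //; exact: rpredZ.
move=> /asboolP/(_ (Submodule Pcl)) H; apply/asboolP; apply: H => x [->|->]; apply/asboolP.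
  by exists 1; rewrite scale1r subrr rpred0.
by exists 0; rewrite scale0r subr0; apply/cyclicP; exists 1; rewrite scale1r.
Qed.

Lemma N2_ind (S : V -> Prop) : (forall a x y, S x -> S y -> S (a •: x + y)) ->
  (forall y, y \in N1 -> S y) -> (forall j, is_pbw j -> p \notin j.1 -> S (pmon j *: u2)) ->
  forall y, y \in N2 -> S y.
Proof.
move=> SP S1 S2 y /N2P[a Ha]; have [n nN Hk] := act_u2 a.
have S0 : S 0 by apply: S1; exact: rpred0.
have -> : y = 1 •: (a *: u2 - n) + (1 •: n + (y - a *: u2)) by rewrite !kscale1; zmod.
apply: (SP); last by apply: SP; exact: S1.
elim: Hk => {a n y Ha nN} [//|a x y [j /andP[pj jp] ->] _ IH].
by apply: SP => //; exact: S2.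
Qed.

(** By [f2_low] and [N2_f2], these index the leading terms in [N2], and [B2] the
    complement. *)
Definition F2 (i : pbw_idx) := (p \in i.1) || (r <= count_mem p i.2)%N.
Definition B2 (i : pbw_idx) := (p \notin i.1) && (count_mem p i.2 < r)%N.
Definition delp (s : seq nat) := iter r (rem p) s.
Definition insp (s : seq nat) := sort geq (nseq r p ++ s).
Definition f2 (i : pbw_idx) : V :=
  if p \in i.1 then f1 V p i else pmon (i.1, delp i.2) *: u2.

Lemma delp_perm s : (r <= count_mem p s)%N -> perm_eq (nseq r p ++ delp s) s.
Proof.
rewrite /delp; elim: (r) => [//|k IH] kc; have {}IH := IH (ltnW kc).
have pin : p \in iter k (rem p) s.
  move/permP/(_ (pred1 p)): IH; rewrite count_cat count_nseq /= eqxx mul1n => e.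
  by rewrite -has_pred1 has_count; move: kc; rewrite -e -{1}[k]addn0 ltn_add2l.
apply: perm_trans IH; apply/permP => a; have /permP/(_ a) /= e := perm_to_rem pin.
by rewrite !count_cat e /= addnCA.
Qed.

Lemma delp_part s : part s -> part (delp s).
Proof.
move=> ps; rewrite /delp; elim: (r) => [//|k IH]; apply: part_subseq IH; exact: rem_subseq.
Qed.

Lemma insp_part s : part s -> part (insp s).
Proof.
move=> /andP[_ ps]; apply/andP; split; first exact: (sort_sorted total_geq).
by rewrite all_sort all_cat ps andbT; apply/allP => x /nseqP[->].
Qed.

Lemma insp_perm s : perm_eq (insp s) (nseq r p ++ s). Proof. by rewrite perm_sort. Qed.

Lemma insp_count s : (r <= count_mem p (insp s))%N.
Proof.
by rewrite (permP (insp_perm s)) count_cat count_nseq /= eqxx mul1n leq_addr.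
Qed.

Lemma delpK s : part s -> delp (insp s) = s.
Proof.
move=> ps; have /andP[s1 _] := ps; have /andP[s2 _] := delp_part (insp_part ps).
apply: geq_sorted_eq => //; rewrite -(perm_cat2l (nseq r p)).
exact: perm_trans (delp_perm (insp_count s)) (insp_perm s).
Qed.

Lemma f2_low i : is_pbw i -> F2 i -> supv (low i) (f2 i - ev i).
Proof.
rewrite /F2 /f2; case: ifP => /= [ip pi _|ip pi ri]; first exact: f1_low.
have /andP[p1 p2] := pi; apply: (@lead_act _ _ _ _ _ _ _ (nseq r (false, p))) => //.
- by apply: okw_pword; rewrite /is_pbw /= p1 delp_part.
- exact: okw_Lp.
- rewrite -ev_Lp; apply: supvS u2_lead => j /andP[dj ej].
  rewrite /wt map_nseq /= sumn_nseq mulnC ej andbT.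
  by rewrite /wW count_nseq mul0n.
apply/permP => a; rewrite /pword !count_cat /= !count_map count_nseq.
have /permP/(_ (preim (pair false) a)) := delp_perm ri.
by rewrite count_cat count_nseq /= => <-; rewrite -addnA; congr addn; exact: addnC.
Qed.

Lemma f2_N2 i : is_pbw i -> F2 i -> f2 i \in N2.
Proof.
rewrite /F2 /f2; case: ifP => [ip pi _|_ _ _]; first by apply/N1_N2/f1_N1.
by apply: rpredZ; exact: u2_N2.
Qed.

Lemma N2_f2 y : y \in N2 -> exists2 x : V, supv F2 x & y = lmap f2 x.
Proof.
move: y; apply: N2_ind => [a x y [x1 H1 ->] [y1 H2 ->]|y /(N1_sp char0 c0 p0 hcp)|j pj jp].
- by exists (a •: x1 + y1); [exact: supvP|rewrite lmapDl].
- elim=> {y} [|a y z [i /andP[pi _] ->] _ [x Hx ->]].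
    by exists 0; [exact: supv0|rewrite lmap0].
  have [qi e] := f1_ins V p0 pi; exists (a •: ev (ins p i.1, i.2) + x).
    by apply: supvP => //; apply: supv_ev => //; rewrite /F2 /= mem_ins.
  by rewrite lmapDl lmap_ev // /f2 /= mem_ins e.
have /andP[p1 p2] := pj; have qj : is_pbw (j.1, insp j.2) by rewrite /is_pbw /= p1 insp_part.
exists (ev (j.1, insp j.2)).
  by apply: supv_ev => //; rewrite /F2 /= insp_count orbT.
by rewrite lmap_ev // /f2 /= (negPf jp) delpK // -surjective_pairing.
Qed.

Lemma F2B2 i : F2 i -> ~~ B2 i.
Proof. by rewrite /F2 /B2 negb_and negbK -leqNgt. Qed.
Lemma F2B2T i : is_pbw i -> F2 i || B2 i.
Proof. by rewrite /F2 /B2 ltnNge -negb_or orbN. Qed.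

Lemma lead2 : leadfree (fun y => y \in N2) B2.
Proof. exact: (leadfree_tri f2_low N2_f2 F2B2). Qed.
Lemma N2_eq0 y : y \in N2 -> supv B2 y -> y = 0.
Proof. exact: (leadfree_eq0 (N := fun y => y \in N2) f2_low N2_f2 F2B2). Qed.
Lemma N2_lin (a : K) (x y : V) : x \in N2 -> y \in N2 -> a •: x + y \in N2.
Proof. exact: sub_kscP. Qed.
Lemma reduce2 x : exists2 y, y \in N2 & supv B2 (x - y).
Proof.
exact: (reduce (N := fun y => y \in N2) f2_low F2B2T (rpred0 _) N2_lin f2_N2 x).
Qed.
Lemma reduce2_wt k x : supv (fun i => iwt i == k) x ->
  exists2 y, y \in N2 & supv (fun i => B2 i && (iwt i == k)) (x - y).
Proof.
exact: (reduce_wt (N := fun y => y \in N2) f2_low F2B2T (rpred0 _) N2_lin f2_N2).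
Qed.

Lemma v_N2 : v \notin N2.
Proof.
apply/negP => vN; have v0 : v = 0.
  apply: N2_eq0 => //; rewrite -ev0; apply: supv_ev => //.
have := @crdv_ev _ _ _ _ _ V ([::], [::]) ([::], [::]) isT.
by rewrite ev0 v0 crdv0 eqxx => /esym/eqP; rewrite oner_eq0.
Qed.

(** The vector [u2] has weight [r p], so in lower weights [N2] is no bigger than
    [N1]. *)
Lemma N2_small k y : y \in N2 -> (k < r * p)%N -> supv (fun i => iwt i == k) y -> y \in N1.
Proof.
move=> yN kr yk; rewrite -[y](restr_id (@vfree _ _ _ _ _ V) yk) -/(weight_comp k y).
move: y yN {yk}; apply: N2_ind => [a x y Hx Hy|y|j pj _]; last 1 first.
- have -> : weight_comp k (pmon j *: u2) = 0; last exact: rpred0.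
  apply: crdv_inj => i; rewrite crd_weight_comp crdv0; case: eqP => // ik.
  have H : supv (fun i => r * p <= iwt i)%N (pmon j *: u2).
    apply: (supv_wd (okw_pword pj) _ u2_wt) => l /eqP <- i' /same_cat[_ ->] _.
    exact: leq_addl.
  by apply: (supv_crd0 H); rewrite -ltnNge ik.
- have -> : weight_comp k (a •: x + y) = a •: weight_comp k x + weight_comp k y.
    by apply: crdv_inj => i; rewrite crdvDl !crd_weight_comp crdvDl; case: ifP; rewrite ?mulr0 ?addr0.
  exact: sub_kscP.
exact: sub_weight_comp.
Qed.

(** A singular vector modulo [N2], reduced to be supported in [B2], has leading
    term [L_{-p}^s] with [s < r] by [lead_sing]. Its weight being less than
    [r p], it is already singular modulo [N1], which contradicts [sing1_wt]. *)
Lemma N2_irr : irreducible_mod (quot_mod N2).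
Proof.
have [[y [k [yN k0 ky sy]]]|//] := irr_or_sing char0 v_N2; exfalso.
have [x xN Hz] := reduce2_wt ky; set z := y - x in Hz.
have zB : supv B2 z by apply: supvS Hz => i /andP[].
have zk : supv (fun i => iwt i == k) z by apply: supvS Hz => i /andP[].
have sz n : (0 < n)%N -> gL n%:Z *: z \in N2 /\ gW n%:Z *: z \in N2.
  by move=> /sy[s1 s2]; rewrite /z !scalerBr; split; apply: rpredB => //; exact: rpredZ.
have zN : z \notin N2 by apply: contra yN => zN; rewrite -(subrK x y); exact: rpredD.
have z0 : z != 0 by apply: contraNneq zN => ->; exact: rpred0.
have B2rem i n : B2 i -> B2 (i.1, rem n i.2) /\ B2 (rem n i.1, i.2).
  rewrite /B2 /= => /andP[ip ci]; rewrite ip ci andbT; split.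
    by apply: leq_ltn_trans ci; apply: leq_count_subseq; exact: rem_subseq.
  by apply: contra ip => /mem_rem.
have B2W i : B2 i -> p \notin i.1 by case/andP.
have [s [cs _]] := lead_sing (phi_neq0 char0 c0 hcp) char0 lead2 B2rem B2W z0 zB sz.
have /andP[_] := zB _ cs; rewrite /= count_nseq /= eqxx mul1n => sr.
have /eqP := zk _ cs; rewrite iwt_Lp => ek.
have krp : (k < r * p)%N by rewrite -ek ltn_mul2r p0.
suff /sing1_wt[e _] : sing N1 z k by move: krp; rewrite e ltnn.
split=> // [|n n0]; first by apply: contra zN; exact: N1_N2.
have [w1 w2] := wt_gL char0 n zk; have [s1 s2] := sz n n0.
have kn : (k - n < r * p)%N by exact: leq_ltn_trans (leq_subr _ _) krp.
by split; apply: (N2_small _ kn) => //; [apply: supvS w1|apply: supvS w2] => i /eqP <-;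
  rewrite addnK.
Qed.

Lemma N2_max : N2 = max_submod V.
Proof. exact: (max_submodE char0 v_N2 N2_irr). Qed.

End Subsingular.

(** * Cyclic modules and normalised singular vectors *)

(** Two cyclic modules whose generators have the same annihilator are
    isomorphic; the first one is given as a submodule. *)
Section CyclicIso.
Variables (A : pzRingType) (M M2 : lmodType A) (x : M) (x2 : M2).
Hypothesis gen2 : forall y : M2, exists a, y = a *: x2.
Hypothesis ann12 : forall a : A, a *: x = 0 -> a *: x2 = 0.
Hypothesis ann21 : forall a : A, a *: x2 = 0 -> a *: x = 0.

Let coef (y : submod_type (cyclic x)) : {a : A | \val y = a *: x}.
Proof. by apply: cid; have /asboolP := valP y. Qed.

Let ann_eq a b : a *: x = b *: x -> a *: x2 = b *: x2.
Proof. by move=> e; apply/eqP; rewrite -subr_eq0 -scalerBl ann12 // scalerBl e subrr. Qed.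
Let ann_eq2 a b : a *: x2 = b *: x2 -> a *: x = b *: x.
Proof. by move=> e; apply/eqP; rewrite -subr_eq0 -scalerBl ann21 // scalerBl e subrr. Qed.

Definition cyclic_map (y : submod_type (cyclic x)) : M2 := sval (coef y) *: x2.

Lemma cyclic_mapE y a : \val y = a *: x -> cyclic_map y = a *: x2.
Proof. by move=> e; apply: ann_eq; rewrite -(svalP (coef y)). Qed.

Lemma cyclic_map_linear : linear cyclic_map.
Proof.
move=> a y z; rewrite (@cyclic_mapE _ (a * sval (coef y) + sval (coef z))).
  by rewrite scalerDl scalerA.
by rewrite linearP /= scalerDl -scalerA -(svalP (coef y)) -(svalP (coef z)).
Qed.

HB.instance Definition _ := GRing.isLinear.Build A (submod_type (cyclic x)) M2 *:%R
  cyclic_map cyclic_map_linear.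

Lemma cyclic_iso : isomorphic_mod (submod_type (cyclic x)) M2.
Proof.
exists cyclic_map; have Px a : a *: x \in cyclic x by apply/asboolP; exists a.
exists (fun y => SubmodElt (Px (sval (cid (gen2 y))))) => y.
  apply: val_inj; rewrite /= (svalP (coef y)); apply: ann_eq2.
  by rewrite -(svalP (cid (gen2 (cyclic_map y)))).
by apply: etrans (esym (svalP (cid (gen2 y)))); exact: cyclic_mapE.
Qed.

End CyclicIso.

Section Main1.
Variables (K : fieldType) (U : w22_alg K) (c h hW : K) (V : vermaT U c h hW) (p : nat).
Hypothesis char0 : forall n, n.+1%:R != 0 :> K.
Hypothesis c0 : c != 0.
Hypothesis p0 : (0 < p)%N.
Hypothesis hcp : 2 * hW + (p%:R ^+ 2 - 1) / 12 * c = 0.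

Lemma u1_neq0 : uprime V p != 0.
Proof.
apply/eqP => e.
have := @u1_free _ _ _ _ _ V p c0 p0 [:: ([::], [::])] (fun _ => 1) isT isT.
rewrite big_seq1 e scaler0 kscale0r => /(_ erefl ([::], [::]) (mem_head _ _)) /eqP.
by rewrite oner_eq0.
Qed.

Lemma u1_calW : supv (fun i => i.2 == [::]) (uprime V p).
Proof.
have H w : okw w -> pureW w -> supv (fun i => i.2 == [::]) (wd w *: vvac V).
  move=> ow pw; apply: supvS (wd_supv ow) => j /andP[_].
  suff -> : wL w = 0%N by rewrite leqn0 size_eq0.
  by apply/eqP; rewrite -leqn0 leqNgt -has_count -all_predC; apply: sub_all pw => z /= ->.
rewrite -[uprime V p](subrK (gW (- p%:Z) *: vvac V)); apply: supvA; last first.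
  have -> : gW (- p%:Z) = wd [:: (true, p)] :> U by rewrite wd_cons wd_nil mulr1.
  by apply: H; rewrite /okw /= ?p0.
have := uop_lead (U := U) c0 p0 (vvac V); rewrite -/(uprime V p); move: (_ - _) => y.
elim=> {y} [|a y z [w [ow pw _ _] ->] _ IH]; first exact: supv0.
by apply: supvP => //; exact: H.
Qed.

Lemma sing_lead y k : sing (Nprime V p) y k -> exists r (u2 : V), [/\ (0 < r)%N,
  h = hW + (13 * p%:R + 1) * (p%:R - 1) / 12 + (1 - r%:R) * p%:R / 2,
  supv (fun i => (0 < Wdeg i)%N && (iwt i == (r * p)%N)) (u2 - pbwv V ([::], nseq r p)) &
  forall n : nat, (0 < n)%N -> gL n%:Z *: u2 \in Nprime V p /\ gW n%:Z *: u2 \in Nprime V p].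
Proof.
move=> /(sing1 char0 c0 p0 hcp)[r [z [r0 -> hr yz [cz Hz sz]]]].
exists r, ((crdv z ([::], nseq r p))^-1 •: z); split=> // [i|n /sz[s1 s2]]; last first.
  by rewrite !kscale_act; split; exact: sub_ksc.
rewrite crdvB crdvZ crdv_ev ?is_pbw_Lp //; have [<-|ne] := eqVneq _ i.
  by rewrite mulVf // subrr eqxx.
rewrite subr0 mulf_eq0 negb_or => /andP[_ /Hz] /andP[/andP[+ ->] _].
by rewrite [i == _]eq_sym (negPf ne) implybF lt0n => ->.
Qed.

Lemma not_N1 r (u2 : V) : 
  supv (fun i => (0 < Wdeg i)%N && (iwt i == (r * p)%N)) (u2 - pbwv V ([::], nseq r p)) ->
  u2 \notin Nprime V p.
Proof.
move=> Hu; apply/negP => /(N1_W0 char0 c0 p0 hcp)/(_ ([::], nseq r p)).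
rewrite -[u2](subrK (pbwv V ([::], nseq r p))) crdvD (supv_crd0 Hu) // add0r.
by rewrite crdv_ev ?is_pbw_Lp // eqxx oner_eq0 => /(_ isT).
Qed.

End Main1.

(** * The Verma module of the enveloping algebra *)

Lemma act_qproj1 (A : pzRingType) (N : submodule A^o) (a : A) :
  a *: qproj N (1 : A^o) = qproj N a.
Proof. by rewrite -linearZ /= [a *: _]mulr1. Qed.

Lemma act_qproj1_eq0 (A : pzRingType) (N : submodule A^o) (a : A) :
  a *: qproj N (1 : A^o) = 0 <-> a \in N.
Proof. by rewrite act_qproj1; split=> [/eqP|aN]; [|apply/eqP]; rewrite qproj_eq0. Qed.

Lemma gen_ann (A : pzRingType) (S : A^o -> Prop) (M : lmodType A) (m : M) (a : A) :
  (forall x : A, S x -> x *: m = 0) -> a \in submod_gen S -> a *: m = 0.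
Proof.
move=> Sm; pose P : {pred A^o} := fun a => `[< (a : A) *: m = 0 >].
have Pcl : submod_closed P.
  split; first by apply/asboolP; rewrite scale0r.
  move=> b x y /asboolP ex /asboolP ey; apply/asboolP.
  by rewrite scalerDl ey addr0 -scalerA ex scaler0.
move=> /asboolP /(_ (Submodule Pcl)) H; apply/asboolP; apply: H => x Sx; apply/asboolP.
exact: Sm.
Qed.

Lemma act_sub (A : pzRingType) (M : lmodType A) (m : M) (x y : A) :
  (x - y) *: m = 0 <-> x *: m = y *: m.
Proof. by rewrite scalerBl; split=> [/eqP|->]; rewrite ?subrr // subr_eq0 => /eqP. Qed.

Section Instance.
Variables (K : fieldType).
Local Notation U := (u22_alg K).

Lemma pmonE i : pmon (U := U) i = pbw_mon K i.
Proof. by rewrite /pbw_mon /pmon /pword wd_cat /wd !big_map. Qed.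

Section Conversions.
Variables (M : lmodType (U22 K)) (m : M).
Lemma kscE a : ksc (U := U) a m = kscale a m. Proof. by []. Qed.
Lemma gLE n : gL (w := U) n *: m = uL K n *: m. Proof. by []. Qed.
Lemma gWE n : gW (w := U) n *: m = uW K n *: m. Proof. by []. Qed.
Lemma gCE : gC (w := U) *: m = uC K *: m. Proof. by []. Qed.

Lemma hwvecE c h hW : hwvec (U := U) c h hW m <->
  [/\ forall n : nat, (0 < n)%N -> uL K n%:Z *: m = 0 /\ uW K n%:Z *: m = 0,
      uC K *: m = kscale c m, uL K 0 *: m = kscale h m & uW K 0 *: m = kscale hW m].
Proof.
split=> [] [Hn HC HL HW]; split.
- by move=> n /Hn; rewrite gLE gWE.
- by rewrite -gCE -kscE.
- by rewrite -gLE -kscE.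
- by rewrite -gWE -kscE.
- by move=> n /Hn; rewrite gLE gWE.
- by rewrite gCE kscE.
- by rewrite gLE kscE.
by rewrite gWE kscE.
Qed.
End Conversions.

Variables (c h hW : K).
Local Notation V := (verma c h hW).
Local Notation v := (vac c h hW).

Lemma vac_rel (u : U22 K) : verma_relator c h hW u -> u *: v = 0.
Proof. by move=> Hu; apply/act_qproj1_eq0/asboolP => N; apply. Qed.

Lemma vac_hw : hwvec (U := U) c h hW v.
Proof.
apply/hwvecE; split.
- by move=> n n0; split; apply: vac_rel; [exact: VermaL|exact: VermaW].
- by apply/act_sub/vac_rel; exact: VermaC.
- by apply/act_sub/vac_rel; exact: VermaL0.
by apply/act_sub/vac_rel; exact: VermaW0.
Qed.

Lemma vac_gen (x : V) : exists u : U22 K, x = u *: v.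
Proof. by have [a ->] := qproj_surj x; exists a; rewrite /vac act_qproj1. Qed.

Lemma vac_univ (M : lmodType (U22 K)) (m : M) (u : U22 K) :
  hwvec (U := U) c h hW m -> u *: v = 0 -> u *: m = 0.
Proof.
move=> /hwvecE [Hn HC HL HW].
move=> /act_qproj1_eq0; apply: gen_ann => x Rx.
case: Rx => [n n0|n n0|||].
- exact: (proj1 (Hn n n0)).
- exact: (proj2 (Hn n n0)).
- exact: (proj2 (act_sub _ _ _) HC).
- exact: (proj2 (act_sub _ _ _) HL).
exact: (proj2 (act_sub _ _ _) HW).
Qed.

Lemma vac_free (s : seq pbw_idx) (a : pbw_idx -> K) : uniq s -> all is_pbw s ->
  \sum_(i <- s) ksc (U := U) (a i) (pmon (U := U) i *: v) = 0 -> {in s, forall i, a i = 0}.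
Proof.
move=> us ps e; apply: (pbw_free us ps (c := c) (h := h) (hW := hW)); rewrite -[RHS]e.
by apply: eq_bigr => i _; rewrite pmonE.
Qed.

Definition mkverma : vermaT U c h hW := VermaT vac_hw vac_gen vac_free vac_univ.

End Instance.

(** * From coordinates to the PBW basis *)

Section Bridge.
Variables (K : fieldType) (c h hW : K).
Local Notation U := (u22_alg K).
Local Notation VV := (mkverma c h hW).
Local Notation V := (verma c h hW).
Local Notation v := (vac c h hW).
Local Notation e := (fun i : pbw_idx => pbw_mon K i *: v).

Lemma evE i : pbwv VV i = pbw_mon K i *: v.
Proof. by rewrite -pmonE. Qed.

Lemma lin_combE (s : seq pbw_idx) (a : pbw_idx -> K) :
  lin_comb s a e = \sum_(i <- s) ksc (U := U) (a i) (pbwv VV i).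
Proof. by apply: eq_bigr => i _; rewrite evE. Qed.

Lemma supv_lin_comb P (s : seq pbw_idx) (a : pbw_idx -> K) :
  all (fun i => is_pbw i && P i) s -> supv (V := VV) P (lin_comb s a e).
Proof.
rewrite lin_combE; elim: s => [|i s IH]; first by rewrite big_nil => _; exact: supv0.
rewrite big_cons => /andP[/andP[pi Pi] /IH H]; apply: supvP => //.
exact: supv_ev.
Qed.

Lemma csupp_lin_comb (x : V) :
  let s := csupp (@ev_span _ _ _ _ _ VV) x in
  [/\ uniq s, forall i, (i \in s) = (crdv (V := VV) x i != 0) & x = lin_comb s (crdv (V := VV) x) e].
Proof.
move=> s; split; [exact: csupp_uniq|exact: mem_csupp|].
by rewrite lin_combE; exact: csuppE.
Qed.

Lemma supv_in_span P (x : V) : supv (V := VV) P x -> in_span (fun i => is_pbw i && P i) e x.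
Proof.
move=> Px; have [_ ms ex] := csupp_lin_comb x.
exists (csupp (@ev_span _ _ _ _ _ VV) x), (crdv (V := VV) x); split=> //.
by apply/allP => i; rewrite ms => ci; rewrite (crdv_pbw ci) Px.
Qed.

Lemma lowest_compI d (x y : V) : y != 0 -> supv (V := VV) (fun i => Wdeg i == d) y ->
  supv (V := VV) (fun i => d < Wdeg i)%N (x - y) -> lowest_comp x y.
Proof.
move=> y0 Hy Hxy; have [us ms ex] := csupp_lin_comb x.
set s := csupp _ x in us ms ex; exists s, (crdv (V := VV) x), d.
have cE i : crdv (V := VV) x i = crdv (V := VV) (x - y) i + crdv (V := VV) y i.
  by rewrite -{1}[x](subrK y) (crdvD (V := VV)).
have xd i : Wdeg i = d -> crdv (V := VV) x i = crdv (V := VV) y i.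
  by move=> di; rewrite cE (supv_crd0 Hxy) ?add0r // di ltnn.
have yd i : Wdeg i != d -> crdv (V := VV) y i = 0 by move=> di; exact: supv_crd0 Hy di.
split=> //.
- rewrite us; apply/allP => i; rewrite ms; exact: crdv_pbw.
- by move=> i; rewrite ms.
- apply/andP; split.
    apply/negPn/negP => /hasPn H; case/eqP: y0; apply: (crdv_inj (V := VV)) => i.
    rewrite crdv0; apply/eqP/negPn/negP => ci; have di := Hy i ci.
    by have := H i; rewrite di ms xd ?(eqP di) // => /(_ ci).
  apply/allP => i; rewrite ms cE; have [/eqP->|di] := boolP (Wdeg i == d); first by rewrite leqnn.
  by rewrite (yd i di) addr0 => /Hxy /ltnW.
rewrite lin_combE; apply: (crdv_inj (V := VV)) => i; rewrite big_filter.
rewrite -[\sum_(_ <- _ | _) _]/(restr (@ev_span _ _ _ _ _ VV) (fun i => Wdeg i == d) x).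
rewrite /crdv (crd_restr (@ev_span _ _ _ _ _ VV) (@vfree _ _ _ _ _ VV)) -!/(crdv (V := VV) _ _).
by case: ifP => [/eqP/xd->|/negbT/yd].
Qed.

Lemma quot_basis (N : submodule V) P :
  (forall x : V, exists2 y, y \in N & supv (V := VV) P (x - y)) ->
  (forall y : V, y \in N -> supv (V := VV) P y -> y = 0) ->
  is_basis (fun i => is_pbw i && P i) (fun i => qproj N (pbw_mon K i *: v)).
Proof.
move=> red indep; have qlc (s : seq pbw_idx) (a : pbw_idx -> K) :
    lin_comb s a (fun i => qproj N (e i)) = qproj N (lin_comb s a e).
  by rewrite /lin_comb raddf_sum; apply: eq_bigr => i _; rewrite /kscale -linearZ.
split=> [y|s a us ps].
  have [x ->] := qproj_surj y; have [n nN /supv_in_span[s [a [ps es]]]] := red x.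
  exists s, a; split=> //; rewrite qlc -es raddfB /=.
  by have /eqP-> : qproj N n == 0; rewrite ?qproj_eq0 // subr0.
rewrite qlc => /eqP; rewrite qproj_eq0 => H.
apply: (pbw_free (c := c) (h := h) (hW := hW)) => //.
  by apply: sub_all ps => i /andP[].
by apply: indep; [exact: H|exact: supv_lin_comb].
Qed.

End Bridge.

(** * The structure theorem *)

Section Structure.
Variables (K : fieldType) (c h hW : K) (p : nat).
Hypothesis char0 : forall n, n.+1%:R != 0 :> K.
Hypothesis c0 : c != 0.
Hypothesis p0 : (0 < p)%N.
Hypothesis hcp : 2 * hW + (p%:R ^+ 2 - 1) / 12 * c = 0.
Local Notation U := (u22_alg K).
Local Notation VV := (mkverma c h hW).
Local Notation V := (verma c h hW).
Local Notation v := (vac c h hW).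
Local Notation e := (fun i : pbw_idx => pbw_mon K i *: v).
Definition sv : V := uprime VV p.
Local Notation Uu := (cyclic sv).

Lemma sv_hw : [/\ forall n : nat, (0 < n)%N -> uL K n%:Z *: sv = 0 /\ uW K n%:Z *: sv = 0,
  uC K *: sv = kscale c sv, uL K 0 *: sv = kscale (h + p%:R) sv & uW K 0 *: sv = kscale hW sv].
Proof. exact: (proj1 (hwvecE _ _ _ _) (u1_hw VV char0 c0 p0 hcp)). Qed.

Lemma sv_singular : singular sv.
Proof.
case: sv_hw => Hn _ HL _; split; last exact: Hn; first exact: (u1_neq0 VV c0 p0).
by exists (h + p%:R); exact: HL.
Qed.

Lemma sv_calW : in_calW sv.
Proof. exact: (supv_in_span (u1_calW (V := VV) c0 p0)). Qed.

Lemma sv_lowest : lowest_comp sv (uW K (- p%:Z) *: v).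
Proof.
have pi : is_pbw ([:: p], [::]) by rewrite /is_pbw /part /= p0.
have ew : uW K (- p%:Z) *: v = pbwv VV ([:: p], [::]).
  by rewrite evE /pbw_mon big_seq1 big_nil mulr1.
apply: (lowest_compI (d := 1)); rewrite ew.
- apply/eqP => e0; have := @crdv_ev _ _ _ _ _ VV ([:: p], [::]) ([:: p], [::]) pi.
  by rewrite e0 crdv0 eqxx => /esym/eqP; rewrite oner_eq0.
- by apply: supv_ev.
rewrite (ev_pword VV (w := [:: (true, p)])) //.
by apply: supvS (u1_lead (V := VV) c0 p0) => i /andP[].
Qed.

Lemma sv_iso : isomorphic_mod (submod_type Uu) (verma c (h + p%:R) hW).
Proof.
apply: (cyclic_iso (x2 := vac c (h + p%:R) hW)) => [|a|a]; first exact: vac_gen.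
  apply: (free_ann (mkverma c (h + p%:R) hW)).
    exact: (u1_hw VV char0 c0 p0 hcp).
  exact: (u1_free (V := VV) c0 p0).
by apply: vac_univ; exact: (u1_hw VV char0 c0 p0 hcp).
Qed.

Lemma sv_basis : is_basis (fun i : pbw_idx => is_pbw i && (p \notin i.1)) (fun i => qproj Uu (e i)).
Proof.
apply: quot_basis => [x|y]; first exact: (reduce1 (V := VV) c0 p0 x).
exact: (N1_eq0 (V := VV) char0 c0 p0 hcp).
Qed.

Lemma Jmax_maximal : maximal_submod (Jmax c h hW).
Proof.
have /max_submodP/(_ (Jmax c h hW)) H : proper_submod (Jmax c h hW).
  by apply/(proper_v (V := VV)); exact: (max_proper VV char0).
exact/H.
Qed.

Lemma sv_irr : (forall y k, ~ sing (Nprime VV p) y k) ->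
  [/\ Uu = Jmax c h hW, maximal_submod Uu, quot_mod Uu = irr_quot c h hW :> lmodType (U22 K)
    & irreducible_mod (quot_mod Uu)].
Proof.
move=> ns; have vN := v_N1 VV char0 c0 p0 hcp.
have irr : irreducible_mod (quot_mod Uu).
  by have [[y [k /ns//]]|] := irr_or_sing (V := VV) char0 vN.
have eJ : Uu = Jmax c h hW by exact: (max_submodE (V := VV) char0 vN irr).
by split=> //; rewrite eJ //; exact: Jmax_maximal.
Qed.

Lemma sv_red : ~ irreducible_mod (quot_mod Uu) ->
  exists (r : nat) (u : V),
    [/\ (0 < r)%N, subsingular Uu u, lowest_comp u (uL K (- p%:Z) ^+ r *: v)
      & [/\ submod_gen (fun x => x = u \/ x = sv) = Jmax c h hW,
            maximal_submod (Jmax c h hW),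
            is_basis (fun i : pbw_idx => [&& is_pbw i, p \notin i.1 & (count_mem p i.2 < r)%N])
              (fun i => qproj (Jmax c h hW) (e i))
          & irreducible_mod (irr_quot c h hW)]].
Proof.
move=> nirr; have vN := v_N1 VV char0 c0 p0 hcp.
have [[y [k Hs]]|//] := irr_or_sing (V := VV) char0 vN.
have [r [u [r0 hr ulead usg]]] := sing_lead char0 c0 p0 hcp Hs.
have eN := N2_max char0 c0 p0 hcp (mkverma c (h + (r * p)%:R) hW) r0 hr ulead usg.
have irr := N2_irr char0 c0 p0 hcp (mkverma c (h + (r * p)%:R) hW) r0 hr ulead usg.
exists r, u; split=> //.
- split; first by exists (h + (r * p)%:R); exact: (u2_gL0 (V := VV) p0 ulead).
  have [Hn _ HL _] := proj1 (hwvecE (qproj Uu u) c (h + (r * p)%:R) hW) (qu2_hw char0 c0 p0 hcp r0 hr ulead usg).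
  split=> //; first by rewrite qproj_eq0; exact: (not_N1 char0 c0 p0 hcp ulead).
  by exists (h + (r * p)%:R).
- have ew : uL K (- p%:Z) ^+ r *: v = pbwv VV ([::], nseq r p).
    by rewrite evE /pbw_mon big_nil mul1r big_nseq iter_mulr_1.
  have pr := is_pbw_Lp p0 r.
  apply: (lowest_compI (d := 0)); rewrite ew.
  + apply/eqP => e0; have := @crdv_ev _ _ _ _ _ VV ([::], nseq r p) ([::], nseq r p) pr.
    by rewrite e0 crdv0 eqxx => /esym/eqP; rewrite oner_eq0.
  + exact: supv_ev.
  by apply: supvS ulead => i /andP[].
split; first exact: eN.
- exact: Jmax_maximal.
- rewrite /Jmax -eN; apply: (quot_basis (P := B2 p r)) => [x|x].
    exact: (reduce2 c0 p0 ulead).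
  exact: (N2_eq0 char0 c0 p0 hcp (mkverma c (h + (r * p)%:R) hW) r0 hr ulead usg).
by rewrite /irr_quot /Jmax -eN; exact: irr.
Qed.

End Structure.

Theorem theorem3 (R : realType) (c h hW : R[i]) (p : nat) (hc : c != 0)
  (hp : (0 < p)%N) (hcp : 2 * hW + (p%:R ^+ 2 - 1) / 12 * c = 0) :
  let V := verma c h hW in
  let v : V := vac c h hW in
  exists u' : V,
    let Uu' := cyclic u' in
    let L' : lmodType (U22 R[i]) := quot_mod Uu' in
    [/\ singular u',
        weight_vec (h + p%:R) u' /\ in_calW u',
        lowest_comp u' (uW R[i] (- p%:Z) *: v)
      & isomorphic_mod (submod_type Uu') (verma c (h + p%:R) hW)] /\
    is_basis (fun i : pbw_idx => is_pbw i && (p \notin i.1))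
      (fun i => qproj Uu' (pbw_mon R[i] i *: v)) /\
    ((forall r : nat, (0 < r)%N ->
        h != hW + (13 * p%:R + 1) * (p%:R - 1) / 12 + (1 - r%:R) * p%:R / 2) ->
      [/\ Uu' = Jmax c h hW, maximal_submod Uu',
          L' = irr_quot c h hW & irreducible_mod L']) /\
    (~ irreducible_mod L' ->
      exists (r : nat) (u : V),
        [/\ (0 < r)%N, subsingular Uu' u,
            lowest_comp u (uL R[i] (- p%:Z) ^+ r *: v)
          & [/\ submod_gen (fun x => x = u \/ x = u') = Jmax c h hW,
                maximal_submod (Jmax c h hW),
                is_basis
                  (fun i : pbw_idx =>
                     [&& is_pbw i, p \notin i.1 & (count_mem p i.2 < r)%N])
                  (fun i => qproj (Jmax c h hW) (pbw_mon R[i] i *: v))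
              & irreducible_mod (irr_quot c h hW)]]).
Proof.
have char0 n : n.+1%:R != 0 :> R[i] by rewrite Num.Theory.pnatr_eq0.
move=> V v; exists (sv c h hW p); split.
  split; last exact: (sv_iso h char0 hc hp hcp).
  - exact: (sv_singular h char0 hc hp hcp).
  - split; last exact: (sv_calW h hW hc hp).
    by have [_ _ HL _] := sv_hw h char0 hc hp hcp; exact: HL.
  - exact: (sv_lowest h hW hc hp).
split; first exact: (sv_basis h char0 hc hp hcp).
split; last exact: (sv_red char0 hc hp hcp).
move=> nh; apply: (sv_irr char0 hc hp hcp) => y k.
move=> /(sing_lead char0 hc hp hcp)[r [u [r0 hr _ _]]].
by have := nh r r0; rewrite -hr eqxx.
Qed.
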